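(* Let $q,k\ge1$ be integers, $\psi_\downarrow\in(0,1/q)$ and $\psi_\uparrow=1/\psi_\downarrow$. Then every pair $(p,\gamma^* )\in\mathcal P_{\mathrm{val}}\times\mathcal P([q])$ with $\gamma^*(z)\ge\psi_\downarrow$ for all $z\in[q]$ and $\bar Z_p(\gamma^* )=\xi_p$ belongs to $\mathfrak A$.
   Context: Notation. $\mathcal P(X)$ is the set of Borel probability measures on $X$; $[q]=\{1,\dots,q\}$; $\mathrm u(S)$ is uniform on $S$; $\otimes$ denotes product measures; bold symbols are random; $\Lambda(t)=t\ln t$. For $\psi:[q]^k\to\mathbb R_{\ge0}$, $\gamma,\gamma'\in\mathcal P([q])^k$, $h\in[k]$ let $Z_{\mathrm f}(\psi,\gamma)=\sum_{\tau\in[q]^k}\psi(\tau)\prod_{h'}\gamma_{h'}(\tau_{h'})$ and $Z_{\mathrm{fm}}(\psi,h,\gamma,\gamma')=\sum_\tau\psi(\tau)\gamma_h(\tau_h)\prod_{h'\ne h}\gamma'_{h'}(\tau_{h'})$. For $p\in\mathcal P([\psi_\downarrow,\psi_\uparrow]^{[q]^k})$ and $\gamma\in\mathcal P([q])$ let $\bar Z_p(\gamma)=\mathbb E[Z_{\mathrm f}(\boldsymbol\psi,(\gamma,\dots,\gamma))]$ with $\boldsymbol\psi\sim p$, and $\xi_p=\sup_{\gamma\in\mathcal P([q])}\bar Z_p(\gamma)$. Let $\mathcal P^2_{*,\gamma}$ be the set of $\pi\in\mathcal P(\mathcal P([q]))$ whose mean is $\gamma$. For $\pi_1,\pi_2\in\mathcal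 P(\mathcal P([q]))$ let $$\nabla_p(\pi_1,\pi_2)=\mathbb E\big[\Lambda(Z_{\mathrm f}(\boldsymbol\psi,\boldsymbol\gamma_1))+(k-1)\Lambda(Z_{\mathrm f}(\boldsymbol\psi,\boldsymbol\gamma_2))-k\Lambda(Z_{\mathrm{fm}}(\boldsymbol\psi,\boldsymbol h,\boldsymbol\gamma_1,\boldsymbol\gamma_2))\big],$$ with $(\boldsymbol\psi,\boldsymbol h,\boldsymbol\gamma_1,\boldsymbol\gamma_2)\sim p\otimes\mathrm u([k])\otimes\pi_1^{\otimes k}\otimes\pi_2^{\otimes k}$. The set $\mathfrak A$ consists of all $(p,\gamma^* )\in\mathcal P([\psi_\downarrow,\psi_\uparrow]^{[q]^k})\times\mathcal P([q])$ with $\gamma^*(z)\ge\psi_\downarrow$ for all $z$, $\bar Z_p(\gamma^* )=\xi_p$, and $\nabla_p(\pi_1,\pi_2)\ge0$ for all $\pi_1,\pi_2\in\mathcal P^2_{*,\gamma^*}$. Valid models. For $i\in\{-1,1\}$ consider random $(\boldsymbol a_i,\boldsymbol b_i,\boldsymbol\Delta_i)\in\mathbb R_{>0}\times\mathbb R\times\mathbb R^{[q]^k}$ such that: $\mathbb E[\boldsymbol b_i^\ell\mid\boldsymbol a_i]\ge0$ for all integers $\ell\ge3$; $|\boldsymbol b_i\boldsymbol\Delta_i(\sigma)|<1$ for all $\sigma\in[q]^k$; $\boldsymbol b_i$ and $\boldsymbol\Delta_i$ are conditionally independent given $\boldsymbol a_i$; and $\boldsymbol\psi_i(\sigma):=\boldsymbol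 a_i(1-\boldsymbol b_i\boldsymbol\Delta_i(\sigma))\in[\psi_\downarrow,\psi_\uparrow]$ for all $\sigma\in[q]^k$. In addition: - for $i=-1$: $\mathbb E[\boldsymbol b_{-1}^{2\ell+1}\mid\boldsymbol a_{-1}]=0$ for all integers $\ell\ge1$, and $\boldsymbol\Delta_{-1}(\sigma)=\prod_{h=1}^k\boldsymbol f_{-1,h}(\sigma(h))$, where $(\boldsymbol f_{-1,h})_{h\in[k]}\in(\mathbb R^q)^k$ is conditionally i.i.d. given $\boldsymbol a_{-1}$; - for $i=1$: $\boldsymbol\Delta_1(\sigma)=\sum_{j=1}^\infty\prod_{h=1}^k\boldsymbol f_{1,h,j}(\sigma(h))$, where $(\boldsymbol f_{1,h})_{h\in[k]}$, $\boldsymbol f_{1,h}=(\boldsymbol f_{1,h,j})_{j\ge1}\in(\mathbb R_{\ge0}^q)^{\mathbb Z_{>0}}$, is conditionally i.i.d. (over $h$) given $\boldsymbol a_1$. Let $\mathcal P_i$ be the set of laws $p$ of $\boldsymbol\psi_i$ obtained from such triples. Then $\mathcal P_{\mathrm{val}}$ is the set of all countable convex combinations $\sum_{j\ge1}\alpha(j)p(j)$ with $\alpha\in\mathcal P(\mathbb Z_{>0})$ and $p(j)\in\mathcal P_{-1}\cup\mathcal P_1$ for all $j$. *)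

(* Defs.v *)
From HB Require Import structures.
From mathcomp Require Import all_boot all_order all_algebra.
From mathcomp Require Import all_classical all_reals all_analysis.
From mathcomp Require Import measurable_realfun.

Set Implicit Arguments.
Unset Strict Implicit.
Unset Printing Implicit Defensive.
Import Order.TTheory GRing.Theory Num.Theory.
Import numFieldNormedType.Exports.

Local Open Scope classical_set_scope.
Local Open Scope ring_scope.
Local Open Scope ereal_scope.

Set Warnings "-redundant-canonical-projection".

(* Throughout, [q] is 'I_q.+1 and [k] is 'I_k.+1, so that the natural number
   parameters q and k stand for the paper's q - 1 and k - 1: every q, k >= 1 is
   covered, and 'I_q.+1, 'I_k.+1 are nonempty, as measurableType demands. *)
HB.instance Definition _ n := isPointed.Build 'I_n.+1 ord0.
HB.instance Definition _ n := @isMeasurable.Build default_measure_display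
  'I_n.+1 discrete_measurable discrete_measurable0
  discrete_measurableC discrete_measurableU.

(* The space T^I with the product sigma-algebra; for countable I and T = R
   this is the Borel sigma-algebra. *)
Definition cylinders (I : Type) d (T : measurableType d) : set (set (I -> T)) :=
  \bigcup_(i in [set: I])
    preimage_set_system [set: I -> T] (fun f => f i) measurable.

Notation fun_space I T := (g_sigma_algebraType (@cylinders I _ T)).

Notation config q k := {ffun 'I_k.+1 -> 'I_q.+1}.

Notation weight_space R q k := (fun_space (config q k) R).

(* P([q]) with its Borel structure: pprobability carries the sigma-algebra
   generated by the evaluation maps. *)
Notation spin_law R q := (pprobability 'I_q.+1 R).

(* u([k]); the total mass of counting is k.+1, so the default argument of
   mnormalize is irrelevant. *)
Definition uniform_ord (R : realType) (k : nat) : probability 'I_k.+1 R :=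
  mnormalize (@counting 'I_k.+1 R) (@dirac _ 'I_k.+1 ord0 R).

Section product_power.
Context d (T : measurableType d) (R : realType).

Definition tuple_cons (n : nat) (x : T * n.-tuple T) : n.+1.-tuple T :=
  [tuple of x.1 :: x.2].

Lemma measurable_tuple_cons n :
  measurable_fun [set: (T * n.-tuple T)%type] (@tuple_cons n).
Proof. exact: measurable_cons. Qed.

HB.instance Definition _ n := isMeasurableFun.Build _ _ _ _
  (@tuple_cons n) (@measurable_tuple_cons n).

Fixpoint prob_power (pi : probability T R) (n : nat) :
    probability (n.-tuple T) R :=
  if n is m.+1
  then distribution (pi \x prob_power pi m) (@tuple_cons m)
  else @dirac _ (0.-tuple T) [tuple] R.

End product_power.

Section random_weights.
Context (R : realType) (q k : nat).

Definition pmf (gam : spin_law R q) (z : 'I_q.+1) : R := fine (gam [set z]).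

Definition Lambda (t : R) : R := (t * ln t)%R.

Definition Zf (psi : weight_space R q k) (gam : 'I_k.+1 -> spin_law R q) : R :=
  (\sum_(tau : config q k) psi tau * \prod_h pmf (gam h) (tau h))%R.

Definition Zfm (psi : weight_space R q k) (h : 'I_k.+1)
    (gam gam' : 'I_k.+1 -> spin_law R q) : R :=
  (\sum_(tau : config q k) psi tau * pmf (gam h) (tau h) *
     \prod_(h' | h' != h) pmf (gam' h') (tau h'))%R.

Definition Zbar (p : probability (weight_space R q k) R) (gam : spin_law R q) :
    \bar R :=
  'E_p[fun psi => Zf psi (fun=> gam)].

Definition xi (p : probability (weight_space R q k) R) : \bar R :=
  ereal_sup (range (Zbar p)).

Definition mean_laws (gam : spin_law R q) :
    set (probability (spin_law R q) R) :=
  [set pi | forall z, \int[pi]_(mu in [set: spin_law R q]) mu [set z] =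
                      gam [set z]].

(* The integrand is bounded p-almost surely for p supported on a cube
   [psi_lo, psi_up]^([q]^k) with psi_lo > 0. *)
Definition nabla (p : probability (weight_space R q k) R)
    (pi1 pi2 : probability (spin_law R q) R) : \bar R :=
  'E_(p \x (uniform_ord R k \x (prob_power pi1 k.+1 \x prob_power pi2 k.+1)))
    [fun w =>
       let psi := w.1 in
       let h := w.2.1 in
       let gam1 := tnth w.2.2.1 in
       let gam2 := tnth w.2.2.2 in
       (Lambda (Zf psi gam1) + k%:R * Lambda (Zf psi gam2)
        - k.+1%:R * Lambda (Zfm psi h gam1 gam2))%R].

Definition weight_cube (psi_lo psi_up : R) : set (weight_space R q k) :=
  [set psi | forall tau, (psi_lo <= psi tau <= psi_up)%R].

Definition admissible (psi_lo psi_up : R) :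
    set (probability (weight_space R q k) R * spin_law R q)%type :=
  [set pg : (probability (weight_space R q k) R * spin_law R q)%type |
            [/\ pg.1 (weight_cube psi_lo psi_up) = 1,
                forall z, psi_lo%:E <= pg.2 [set z],
                Zbar pg.1 pg.2 = xi pg.1
              & forall pi1 pi2, mean_laws pg.2 pi1 -> mean_laws pg.2 pi2 ->
                  0 <= nabla pg.1 pi1 pi2]].

End random_weights.

(* Conditioning on a real random variable a.  A sigma(a)-measurable random
   variable is written as a Borel function g of a. *)
Section conditioning.
Context d (T : measurableType d) (R : realType) (P : probability T R).
Variable a : T -> R.

(* g(a) is a version of E[X | a], for X >= 0 *)
Definition cond_exp_ge0 (X : T -> \bar R) (g : R -> \bar R) : Prop :=
  [/\ measurable_fun [set: R] g,
      forall x, 0 <= g x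
    & forall B : set R, measurable B ->
        \int[P]_(w in a @^-1` B) X w = \int[P]_(w in a @^-1` B) g (a w)].

(* g(a) is a version of E[X | a] = E[X^+ | a] - E[X^- | a]; as usual, the
   conditional expectation exists if the difference is almost surely not of the
   form oo - oo, so that X need not be integrable. *)
Definition cond_exp (X : T -> R) (g : R -> \bar R) : Prop :=
  exists gp gn : R -> \bar R,
    [/\ cond_exp_ge0 (EFin \o X^\+%R) gp,
        cond_exp_ge0 (EFin \o X^\-%R) gn,
        {ae P, forall w, gp (a w) +? - gn (a w)}
      & forall x, g x = gp x - gn x].

(* g(a) is a version of P(A | a) *)
Definition cond_prob (A : set T) (g : R -> R) : Prop :=
  cond_exp_ge0 (EFin \o \1_A) (EFin \o g).

(* Versions are unique up to null sets; P(A | a) exists for every event A. *)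
Definition cond_indep d1 d2 (T1 : measurableType d1) (T2 : measurableType d2)
    (X : T -> T1) (Y : T -> T2) : Prop :=
  forall (A : set T1) (B : set T2), measurable A -> measurable B ->
    exists gX gY : R -> R,
      [/\ cond_prob (X @^-1` A) gX, cond_prob (Y @^-1` B) gY
        & cond_prob (X @^-1` A `&` Y @^-1` B) (gX \* gY)%R].

Definition cond_iid (I : finType) d' (T' : measurableType d')
    (X : I -> T -> T') : Prop :=
  (forall A : I -> set T', (forall i, measurable (A i)) ->
     exists g : I -> R -> R,
       (forall i, cond_prob (X i @^-1` A i) (g i)) /\
       cond_prob (\bigcap_i X i @^-1` A i) (fun x => \prod_i g i x)%R) /\
  (forall (A : set T') (i j : I), measurable A ->
     exists g : R -> R,
       cond_prob (X i @^-1` A) g /\ cond_prob (X j @^-1` A) g).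

End conditioning.

Section valid_models.
Context (R : realType) (q k : nat) (psi_lo psi_up : R).

(* Codomain constraints are imposed pointwise and relations between random
   variables almost surely; changing the triple on a null set turns the latter
   into pointwise ones without changing the law of psi. *)
Definition valid_triple d (T : measurableType d) (P : probability T R)
    (a b : {RV P >-> R}) (Delta psi : {RV P >-> weight_space R q k}) : Prop :=
  (forall w, (0 < a w)%R) /\
  (forall l, (3 <= l)%N ->
     exists g, cond_exp P a (fun w => b w ^+ l)%R g /\
               {ae P, forall w, 0 <= g (a w)}) /\
  {ae P, forall w, forall sigma, (`|b w * Delta w sigma| < 1)%R} /\
  cond_indep P a b Delta /\
  (forall w sigma, psi w sigma = a w * (1 - b w * Delta w sigma))%R /\
  {ae P, forall w, weight_cube psi_lo psi_up (psi w)}.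

Definition Pminus : set (probability (weight_space R q k) R) :=
  [set p | exists d (T : measurableType d) (P : probability T R)
      (a b : {RV P >-> R}) (Delta psi : {RV P >-> weight_space R q k})
      (f : 'I_k.+1 -> {RV P >-> fun_space 'I_q.+1 R}),
    valid_triple a b Delta psi /\
    (forall l, (1 <= l)%N ->
       exists g, cond_exp P a (fun w => b w ^+ l.*2.+1)%R g /\
                 {ae P, forall w, g (a w) = 0}) /\
    {ae P, forall w, forall sigma : config q k,
       Delta w sigma = (\prod_h f h w (sigma h))%R} /\
    cond_iid P a (fun h w => f h w) /\
    (forall A, measurable A -> p A = distribution P psi A)].

(* The index j >= 1 of the series is shifted to j : nat. *)
Definition Pplus : set (probability (weight_space R q k) R) :=
  [set p | exists d (T : measurableType d) (P : probability T R)
      (a b : {RV P >-> R}) (Delta psi : {RV P >-> weight_space R q k})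
      (f : 'I_k.+1 ->
           {RV P >-> fun_space nat (fun_space 'I_q.+1 R)}),
    valid_triple a b Delta psi /\
    (forall h w j z, (0 <= f h w j z)%R) /\
    {ae P, forall w, forall sigma : config q k,
       (Delta w sigma)%:E =
       \sum_(0 <= j <oo) (\prod_h f h w j (sigma h))%:E} /\
    cond_iid P a (fun h w => f h w) /\
    (forall A, measurable A -> p A = distribution P psi A)].

Definition Pval : set (probability (weight_space R q k) R) :=
  [set p | exists (alpha : probability nat R)
      (pj : nat -> probability (weight_space R q k) R),
    (forall j, (Pminus `|` Pplus) (pj j)) /\
    (forall A, measurable A ->
       p A = \sum_(0 <= j <oo) alpha [set j] * pj j A)].

End valid_models.

(* Main.v *)
Require Import Defs.
From mathcomp Require Import all_boot all_order all_algebra.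
From mathcomp Require Import all_classical all_reals all_analysis.
From mathcomp Require Import measurable_realfun ring lra.

(* Write psi = a (1 - b Delta), so that Z_f(psi, gamma) = a (1 - b X) with X the
   multilinear extension of Delta, |b X| <= 1. In the expansion
   Lambda (a (1 - x)) = affine (x) + a sum_(l >= 2) x^l / (l (l - 1)), uniform up
   to O(a / n) after n terms, the affine part cancels in nabla because pi1 and
   pi2 have the same mean. The l-th term contributes b^l M_l(Delta), where M_l is
   the nabla functional applied to X^l. If Delta is a sum of products of factors f_h, then
   M_l is a sum of terms
     prod_h x_h + (k - 1) prod_h y_h - sum_h x_h prod_(h' != h) y_h'
   in which x_h, y_h depend on f_h only; given a they are i.i.d. over h, so AM-GM
   gives E[M_l(Delta) | a] >= 0 as soon as x_h, y_h >= 0 (f >= 0, or l even), and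
   b, Delta conditionally independent given a gives E[b^l M_l(Delta) | a] >= 0
   (for i = -1 and odd l, because E[b^l | a] = 0).
   The variables b and Delta need not be bounded or integrable, but |b Delta| < 1
   and conditional independence force the a-line to be exhausted, up to
   b Delta = 0, by Borel sets on which a, b and Delta are all bounded; all
   conditional identities are applied there, first to step functions. *)

Set Implicit Arguments.
Unset Strict Implicit.
Unset Printing Implicit Defensive.
Import Order.TTheory GRing.Theory Num.Theory.
Import numFieldNormedType.Exports.

Local Open Scope classical_set_scope.
Local Open Scope ring_scope.

(* [all_analysis] has a different [pmf]. *)
Local Notation pmf := Defs.pmf.

(** * Real inequalities *)

(** Conditional independence and the conditional i.i.d. property are given for events only, with
    versions that are unique up to null sets. General conditional expectations are therefore
    avoided: a sign of E[X | a] is expressed by the signs of the integrals of X over {a in B}, for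
    all Borel sets B inside a given set, and step functions reduce these integrals to finitely many
    conditional probabilities. All passages to the limit for random variables then rest on bounded
    convergence, which is why the variables are first truncated to everywhere bounded functions. The
    logarithmic series is not summed either. Since |b Delta| < 1 comes without a uniform gap from 1,
    a geometric error bound would be useless; the Taylor error must be uniform on the closed
    interval [-1, 1], including the singular endpoint x = 1. The bound 1 / (n + 1) suffices, because
    n tends to infinity last, after a, b and Delta have been bounded. *)

Section real_inequalities.
Context {R : realType}.
Implicit Types x y t : R.

(** The gap at [n + 1] is [x] times the gap at [n] plus [(n + 1) y^n (x - y)^2]. *)
Lemma weighted_amgm (n : nat) x y : 0 <= x -> 0 <= y ->
  n.+1%:R * (x * y ^+ n) <= x ^+ n.+1 + n%:R * y ^+ n.+1.
Proof.
move=> x0 y0; elim: n => [|n IHn]; first by rewrite !expr0 !expr1; lra.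
have /(ler_wpM2l x0) := IHn.
have : 0 <= n.+1%:R * (y ^+ n * (x - y) ^+ 2).
  by rewrite mulr_ge0// mulr_ge0 ?sqr_ge0// exprn_ge0.
by rewrite !exprS -!natr1 => h1 h2; nra.
Qed.

(** The interval is open at [c] to allow for the pole of the second derivative of
    [(1 - x) ln (1 - x)] at 1. *)
Lemma le_of_derive_ge0 (c : R) (F G : R -> R) :
  (forall x, 0 <= x < c -> is_derive x 1 F (G x)) ->
  (forall x, 0 <= x < c -> 0 <= G x) ->
  forall x y, 0 <= x -> x <= y -> y < c -> F x <= F y.
Proof.
move=> dF G0 x y x0 xy yc.
have H t : t \in `[x, y] -> 0 <= t < c.
  by rewrite in_itv/= => /andP[xt ty]; rewrite (le_trans x0)//= (le_lt_trans ty).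
have [||t tx] := @MVT_segment R F G x y xy.
- by move=> t tx; apply/dF/H/(subset_itv_oo_cc tx).
- apply: derivable_within_continuous => t tx.
  by have [] := dF t (H _ tx).
rewrite -subr_ge0 => ->; rewrite mulr_ge0 ?subr_ge0//.
exact/G0/H.
Qed.

(** [P1] and [P0] are the first and second antiderivatives of [P2] that vanish at 0. Since
    [(1 - x) ln (1 - x) + x] has second derivative [1 / (1 - x)], its Taylor estimate is a
    comparison with a finite geometric sum, integrated twice. *)
Let P2 (c : nat -> R) n : {poly R} := \sum_(i < n) c i *: 'X^i.
Let P1 (c : nat -> R) n : {poly R} :=
  \sum_(i < n) (c i / i.+1%:R) *: 'X^(i.+1).
Let P0 (c : nat -> R) n : {poly R} :=
  \sum_(i < n) (c i / (i.+1%:R * i.+2%:R)) *: 'X^(i.+2).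

Let deriv_P1 c n : (P1 c n)^`() = P2 c n.
Proof.
rewrite raddf_sum; apply: eq_bigr => i _ /=.
by rewrite derivZ derivXn -[X in _ *: X]scaler_nat scalerA divfK// pnatr_eq0.
Qed.

Let deriv_P0 c n : (P0 c n)^`() = P1 c n.
Proof.
rewrite raddf_sum; apply: eq_bigr => i _ /=.
rewrite derivZ derivXn -[X in _ *: X]scaler_nat scalerA invfM mulrA divfK ?pnatr_eq0//.
Qed.

Let P2E c n x : (P2 c n).[x] = \sum_(i < n) c i * x ^+ i.
Proof. by rewrite horner_sum; apply: eq_bigr => i _; rewrite hornerZ hornerXn. Qed.

Let P0E c n x :
  (P0 c n).[x] = \sum_(i < n) c i / (i.+1%:R * i.+2%:R) * x ^+ i.+2.
Proof. by rewrite horner_sum; apply: eq_bigr => i _; rewrite hornerZ hornerXn. Qed.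

Let P1_0 c n : (P1 c n).[0] = 0.
Proof.
rewrite horner_sum big1// => i _.
by rewrite hornerZ hornerXn expr0n mulr0.
Qed.

Let P0_0 c n : (P0 c n).[0] = 0.
Proof. by rewrite P0E big1// => i _; rewrite expr0n mulr0. Qed.

Let is_derive_ln_affine (e x : R) : 0 < 1 + e * x ->
  is_derive x 1 (fun t => ln (1 + e * t)) (e / (1 + e * x)).
Proof.
move=> x1; have d1 : is_derive x 1 (fun t : R => 1 + e * t) e.
  have := @is_deriveD _ _ _ _ _ x 1 _ _ (is_derive_cst (1 : R) x (1 : R))
    (is_deriveZ e (is_derive_id x (1 : R))).
  by rewrite add0r [e *: _]mulr1.
have := @is_derive1_comp R (@ln R) (fun t => 1 + e * t) x _ _ (is_derive1_ln x1) d1.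
by rewrite mulrC.
Qed.

Let is_derive_xlnx_affine (e x : R) : 0 < 1 + e * x ->
  is_derive x 1 (fun t => (1 + e * t) * ln (1 + e * t) - e * t)
    (e * ln (1 + e * x)).
Proof.
move=> x1; have d1 : is_derive x 1 (fun t : R => 1 + e * t) e.
  have := @is_deriveD _ _ _ _ _ x 1 _ _ (is_derive_cst (1 : R) x (1 : R))
    (is_deriveZ e (is_derive_id x (1 : R))).
  by rewrite add0r [e *: _]mulr1.
have := is_deriveB (is_deriveM d1 (is_derive_ln_affine x1))
  (is_deriveZ e (is_derive_id x (1 : R))).
move=> /is_derive_eq; apply; rewrite /GRing.scale/= mulr1.
by field; exact: lt0r_neq0.
Qed.

Let is_derive_diff (f : R -> R) df (p : {poly R}) (s : R) x :
  is_derive x 1 f df ->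
  is_derive x 1 (fun t => s * (f t - p.[t])) (s * (df - p^`().[x])).
Proof.
by move=> dF; exact (is_deriveZ s (is_deriveB dF (is_derive_poly p x))).
Qed.

(** The sign [e] moves either side of the origin to [t >= 0]; the factor [s] selects an upper or a
    lower estimate. The derivative [e ln (1 + e t)] and [P1] both vanish at 0, so the sign of the
    second derivative passes to the first one. The conclusion is monotonicity, and not just a sign,
    because the estimate up to [x = 1] needs it. *)
Let xlnx_convex (e s u : R) (c : nat -> R) n : e ^+ 2 = 1 ->
  (forall t, 0 <= t < u -> 0 < 1 + e * t) ->
  (forall t, 0 <= t < u -> 0 <= s * ((1 + e * t)^-1 - (P2 c n).[t])) ->
  forall x y, 0 <= x -> x <= y -> y < u ->
    s * ((1 + e * x) * ln (1 + e * x) - e * x - (P0 c n).[x]) <=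
    s * ((1 + e * y) * ln (1 + e * y) - e * y - (P0 c n).[y]).
Proof.
move=> e2 u0 s0.
apply: (@le_of_derive_ge0 u
  (fun t => s * ((1 + e * t) * ln (1 + e * t) - e * t - (P0 c n).[t]))
  (fun t => s * (e * ln (1 + e * t) - (P0 c n)^`().[t]))) => x xu.
  exact (is_derive_diff (P0 c n) s (is_derive_xlnx_affine (u0 _ xu))).
rewrite deriv_P0; have [x0 xltu] := andP xu.
have := @le_of_derive_ge0 u (fun t => s * (e * ln (1 + e * t) - (P1 c n).[t]))
  (fun t => s * ((1 + e * t)^-1 - (P2 c n).[t])) _ s0 0 x (lexx 0) x0 xltu.
rewrite P1_0 mulr0 addr0 ln1 mulr0 subr0 mulr0; apply => t tu.
rewrite -deriv_P1; apply: is_derive_diff.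
have := is_deriveZ e (is_derive_ln_affine (u0 _ tu)).
by rewrite /GRing.scale/= mulrA -expr2 e2 mul1r.
Qed.

Let geom_sum t n : t != 1 -> \sum_(i < n) t ^+ i = (1 - t ^+ n) / (1 - t).
Proof.
move=> t1; have t1' : 1 - t != 0 by rewrite subr_eq0 eq_sym.
apply: (mulIf t1'); rewrite divfK// mulrC -opprB mulNr -subrX1; ring.
Qed.

Let telescope_sum n :
  \sum_(i < n) (i.+1%:R * i.+2%:R)^-1 = 1 - n.+1%:R^-1 :> R.
Proof.
elim: n => [|n IHn]; first by rewrite big_ord0 invr1 subrr.
rewrite big_ord_recr/= IHn.
have h1 : (1 + n%:R : R) != 0 by rewrite nat1r pnatr_eq0.
have h2 : (1 + (1 + n%:R) : R) != 0 by rewrite !nat1r pnatr_eq0.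
by rewrite -!nat1r; field; rewrite h1 h2.
Qed.

Let one_sub_expr_le y m : 0 <= y <= 1 -> 1 - y ^+ m <= m%:R * (1 - y).
Proof.
move=> /andP[y0 y1]; elim: m => [|m IHm]; first by rewrite expr0 subrr mul0r.
have ym : y ^+ m <= 1 by rewrite exprn_ile1.
have ym0 : 0 <= y ^+ m by rewrite exprn_ge0.
rewrite exprS -nat1r; nra.
Qed.

Lemma xlnx_taylor_le0 n x : -1 <= x <= 0 ->
  `|(1 - x) * ln (1 - x) + x - \sum_(i < n) x ^+ i.+2 / (i.+1%:R * i.+2%:R)|
    <= n.+1%:R^-1.
Proof.
move=> /andP[x1 x0].
(* The extra term - s t^n dominates the remainder of the geometric series, so
   that s times the second derivative is nonnegative, for both signs s. *)
pose c (s : R) i : R := if i == n then - s else (-1) ^+ i.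
have sumc s (g : nat -> R) : \sum_(i < n.+1) c s i * g i =
    \sum_(i < n) (-1) ^+ i * g i - s * g n.
  rewrite big_ord_recr/= /c eqxx mulNr; congr (_ - _).
  by apply: eq_bigr => i _; rewrite ltn_eqF.
have P0c s t : (P0 (c s) n.+1).[t] =
  \sum_(i < n) (- t) ^+ i.+2 / (i.+1%:R * i.+2%:R)
   - s * (t ^+ n.+2 / (n.+1%:R * n.+2%:R)).
  rewrite P0E; under eq_bigr do rewrite -mulrA.
  rewrite (sumc s (fun i => (i.+1%:R * i.+2%:R)^-1 * t ^+ i.+2)); congr (_ - _).
    by apply: eq_bigr => i _; rewrite [(- t) ^+ _]exprNn !exprS; ring.
  by rewrite [_^-1 * _]mulrC.
have H s : s ^+ 2 = 1 -> 0 <= s * ((1 - x) * ln (1 - x) + x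
    - (P0 (c s) n.+1).[- x]).
  move=> s2.
  have := @xlnx_convex 1 s 2 (c s) n.+1 (expr1n _ _) _ _ 0 (- x) (lexx 0).
  rewrite P0_0 mulr0 addr0 ln1 mulr0 !subr0 mulr0 mul1r opprK.
  apply; [|move=> t /andP[t0 t2]|lra|lra]; first by move=> t /andP[t0 t2]; lra.
  rewrite P2E (sumc s (fun i => t ^+ i)).
  under eq_bigr do rewrite -exprNn.
  rewrite geom_sum; last by rewrite lt_eqF//; lra.
  rewrite opprK mul1r opprB addrCA mulrDr mulrA -expr2 s2 mul1r.
  have t1 : 1 + t != 0 by rewrite gt_eqF//; lra.
  rewrite [X in s * X](_ : _ = (- t) ^+ n / (1 + t)); last by field.
  have tn : `|s * ((- t) ^+ n / (1 + t))| <= t ^+ n.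
    have s1 : `|s| = 1.
      by apply/eqP; rewrite -(@eqrXn2 _ 2)// real_normK ?num_real// s2 expr1n.
    rewrite normrM s1 mul1r normrM normfV normrX normrN (ger0_norm t0).
    rewrite ger0_norm; last by lra.
    by rewrite ler_piMr ?exprn_ge0// invf_le1; lra.
  by rewrite ler_norml in tn; lra.
have sN1 : (-1) ^+ 2 = 1 :> R by rewrite sqrrN expr1n.
have := H 1 (expr1n R 2); have := H (-1) sN1.
rewrite !P0c !mulN1r !mul1r !opprK.
set S := \sum_(i < n) _.
(* The extra term integrates to at most [1 / ((n + 1) (n + 2))]; the weaker bound is the one that
   also holds on the positive side. *)
have : (- x) ^+ n.+2 / (n.+1%:R * n.+2%:R) <= n.+1%:R^-1 :> R.
  rewrite invfM mulrCA ler_piMr ?invr_ge0//.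
  rewrite mulr_ile1 ?exprn_ge0 ?invr_ge0//; [lra| |].
    by rewrite exprn_ile1//; lra.
  by rewrite invf_le1// ler1n.
rewrite ler_norml.
set v := (- x) ^+ _ / _; set w := _^-1; set u := (_ * ln _).
by clearbody u v w S; lra.
Qed.

(** The remainder is nondecreasing on [[0, 1)], so its limit at 1 bounds it. The coefficients
    telescope to [1 - 1 / (n + 1)], which makes [1 / (n + 1)] the exact error at [x = 1]. *)
Lemma xlnx_taylor_ge0 n x : 0 <= x <= 1 ->
  `|(1 - x) * ln (1 - x) + x - \sum_(i < n) x ^+ i.+2 / (i.+1%:R * i.+2%:R)|
    <= n.+1%:R^-1.
Proof.
move=> /andP[x0 x1].
have [->|xn1] := eqVneq x 1.
  rewrite subrr mul0r add0r; under eq_bigr do rewrite expr1n mul1r.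
  by rewrite telescope_sum opprB addrC subrK ger0_norm ?invr_ge0.
have xlt1 : x < 1 by rewrite lt_neqAle xn1.
pose c (i : nat) : R := 1.
have P0c t : (P0 c n).[t] = \sum_(i < n) t ^+ i.+2 / (i.+1%:R * i.+2%:R).
  by rewrite P0E; apply: eq_bigr => i _; rewrite mul1r mulrC.
have mono u v : 0 <= u -> u <= v -> v < 1 ->
   (1 - u) * ln (1 - u) + u - (P0 c n).[u] <=
   (1 - v) * ln (1 - v) + v - (P0 c n).[v].
  move=> u0 uv v1.
  have := @xlnx_convex (-1) 1 1 c n _ _ _ u v u0 uv v1.
  rewrite !mul1r !mulN1r !opprK; apply.
  - by rewrite sqrrN expr1n.
  - by move=> t; lra.
  - move=> t /andP[t0 t1]; rewrite mul1r mulN1r P2E.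
    under eq_bigr do rewrite mul1r.
    rewrite geom_sum ?lt_eqF// -[X in X - _]mul1r -mulrBl opprB addrC subrK.
    by rewrite divr_ge0 ?exprn_ge0//; lra.
rewrite -P0c ger0_norm; last first.
  have := mono 0 x (lexx 0) x0 xlt1.
  by rewrite P0_0 !subr0 ln1 mulr0 addr0.
apply/ler_addgt0Pr => eps eps0.
(* A point below 1 replaces the limit. By [1 - y^m <= m (1 - y)], each of the [n] terms falls short
   of its value at 1 by at most [1 - y], hence the sum by at most [eps]. *)
pose y := Num.max x (1 - eps / n.+1%:R).
have e1 : 0 < eps / n.+1%:R by rewrite divr_gt0.
have xy : x <= y by rewrite le_max lexx.
have y1 : y < 1 by rewrite gt_max xlt1/= ltrBlDr ltrDl.
have y2 : 1 - y <= eps / n.+1%:R.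
  by rewrite lerBlDr -lerBlDl le_max lexx orbT.
have y0 : 0 <= y := le_trans x0 xy.
apply: (le_trans (mono x y x0 xy y1)).
have lny : (1 - y) * ln (1 - y) <= 0.
  by rewrite mulr_ge0_le0 ?ln_le0//; lra.
have : \sum_(i < n) (i.+1%:R * i.+2%:R)^-1 - (P0 c n).[y] <= n%:R * (1 - y).
  have -> : n%:R * (1 - y) = \sum_(i < n) (1 - y).
    by rewrite sumr_const card_ord mulr_natl.
  rewrite P0c -sumrB; apply: ler_sum => i _.
  rewrite -[X in X - _]mul1r -mulrBl ler_pdivrMr ?mulr_gt0//.
  apply: le_trans (one_sub_expr_le i.+2 _) _; first by rewrite y0 ltW.
  have := ltr0Sn R i; rewrite -[i.+1%:R]nat1r => ?.
  have : 0 <= i%:R :> R by [].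
  rewrite -[i.+2%:R]nat1r -[i.+1%:R]nat1r.
  set a : R := i%:R => a0; nra.
rewrite telescope_sum => h.
suff : n%:R * (1 - y) <= eps.
  move=> /(le_trans h); move: lny (n.+1%:R^-1).
  set u := _ * ln _; set v := _.[_]; clearbody u v => ? w ?; lra.
have n0 : 0 <= n%:R :> R by [].
apply: (@le_trans _ _ (n%:R * (eps / n.+1%:R))); first exact: ler_wpM2l.
by rewrite mulrCA ler_piMr ?ltW// ltr_pdivrMr// mul1r ltr_nat.
Qed.

Lemma xlnx_taylor n x : `|x| <= 1 ->
  `|(1 - x) * ln (1 - x) + x - \sum_(i < n) x ^+ i.+2 / (i.+1%:R * i.+2%:R)|
    <= n.+1%:R^-1.
Proof.
rewrite ler_norml => /andP[x1 x2]; have [x0|/ltW x0] := leP 0 x.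
- by apply: xlnx_taylor_ge0; rewrite x0.
- by apply: xlnx_taylor_le0; rewrite x0 x1.
Qed.

End real_inequalities.

(** * Bounded integrals *)

(** Boundedness everywhere, and not only almost everywhere, makes the class independent of the law,
    closed under products and compositions, and integrable for every probability, so that linearity
    and Fubini need no further side condition. *)
Definition bounded_mfun d (T : measurableType d) (R : realType) (f : T -> R) :=
  measurable_fun setT f /\ exists M : R, forall x, `|f x| <= M.

Section bounded_mfun.
Context d (T : measurableType d) (R : realType).
Implicit Types f g : T -> R.

Lemma bounded_mfun_cst (c : R) : bounded_mfun (fun _ : T => c).
Proof. by split; [exact: measurable_cst|exists `|c|]. Qed.

Lemma bounded_mfun_indic (A : set T) : measurable A ->
  bounded_mfun (\1_A : T -> R).
Proof.
move=> mA; split; first exact: measurable_indic.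
by exists 1 => x; rewrite indicE; case: (_ \in _); rewrite ?normr1 ?normr0.
Qed.

Lemma bounded_mfunD f g : bounded_mfun f -> bounded_mfun g ->
  bounded_mfun (fun x => f x + g x).
Proof.
move=> [mf [M fM]] [mg [N gN]]; split; first exact: measurable_funD.
by exists (M + N) => x; rewrite (le_trans (ler_normD _ _))// lerD.
Qed.

Lemma bounded_mfunM f g : bounded_mfun f -> bounded_mfun g ->
  bounded_mfun (fun x => f x * g x).
Proof.
move=> [mf [M fM]] [mg [N gN]]; split; first exact: measurable_funM.
by exists (M * N) => x; rewrite normrM ler_pM.
Qed.

Lemma bounded_mfunN f : bounded_mfun f -> bounded_mfun (fun x => - f x).
Proof.
move=> [mf [M fM]]; split; first exact: measurableT_comp.
by exists M => x; rewrite normrN.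
Qed.

Lemma bounded_mfunB f g : bounded_mfun f -> bounded_mfun g ->
  bounded_mfun (fun x => f x - g x).
Proof. by move=> bf bg; exact: bounded_mfunD bf (bounded_mfunN bg). Qed.

Lemma bounded_mfunX f n : bounded_mfun f -> bounded_mfun (fun x => f x ^+ n).
Proof.
move=> bf; elim: n => [|n IHn]; first exact: bounded_mfun_cst.
by under eq_fun do rewrite exprS; exact: bounded_mfunM.
Qed.

Lemma bounded_mfun_sum (I : Type) (r : seq I) (P : pred I) (F : I -> T -> R) :
  (forall i, bounded_mfun (F i)) ->
  bounded_mfun (fun x => \sum_(i <- r | P i) F i x).
Proof.
move=> bF; elim: r => [|i r IHr].
  by under eq_fun do rewrite big_nil; exact: bounded_mfun_cst.
under eq_fun do rewrite big_cons; case: (P i) => //; exact: bounded_mfunD.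
Qed.

Lemma bounded_mfun_prod (I : Type) (r : seq I) (P : pred I) (F : I -> T -> R) :
  (forall i, bounded_mfun (F i)) ->
  bounded_mfun (fun x => \prod_(i <- r | P i) F i x).
Proof.
move=> bF; elim: r => [|i r IHr].
  by under eq_fun do rewrite big_nil; exact: bounded_mfun_cst.
under eq_fun do rewrite big_cons; case: (P i) => //; exact: bounded_mfunM.
Qed.

Lemma bounded_mfun_comp d' (T' : measurableType d') (h : T' -> T) f :
  measurable_fun setT h -> bounded_mfun f -> bounded_mfun (fun x => f (h x)).
Proof.
by move=> mh [mf [M fM]]; split; [exact: measurableT_comp|exists M].
Qed.

Lemma bounded_mfun_integrable (P : probability T R) f :
  bounded_mfun f -> P.-integrable setT (EFin \o f).
Proof.
move=> [mf [M fM]]; apply: measurable_bounded_integrable => //.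
  by rewrite (le_lt_trans (probability_le1 P measurableT))// ltry.
by exists M; split; [exact: num_real|move=> x Mx y _; exact: le_trans (fM y) (ltW Mx)].
Qed.

End bounded_mfun.

Section bounded_integral.
Context d (T : measurableType d) (R : realType) (P : probability T R).
Implicit Types f g : T -> R.

Lemma EFin_Rintegral f : bounded_mfun f ->
  (\int[P]_x (f x)%:E = (\int[P]_x f x)%R%:E)%E.
Proof.
move=> /(bounded_mfun_integrable P) fi; rewrite /Rintegral fineK//.
exact: integrable_fin_num.
Qed.

Lemma bRintegralD f g : bounded_mfun f -> bounded_mfun g ->
  \int[P]_x (f x + g x) = \int[P]_x f x + \int[P]_x g x.
Proof. by move=> ? ?; rewrite RintegralD//; exact: bounded_mfun_integrable. Qed.

Lemma bRintegralB f g : bounded_mfun f -> bounded_mfun g ->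
  \int[P]_x (f x - g x) = \int[P]_x f x - \int[P]_x g x.
Proof. by move=> ? ?; rewrite RintegralB//; exact: bounded_mfun_integrable. Qed.

Lemma bRintegralZ (c : R) f : bounded_mfun f ->
  \int[P]_x (c * f x) = c * \int[P]_x f x.
Proof. by move=> ?; rewrite RintegralZl//; exact: bounded_mfun_integrable. Qed.

Lemma Rintegral_prob_cst (c : R) : \int[P]_(x in setT) c = c.
Proof.
rewrite Rintegral_cst// -[RHS]mulr1; congr (_ * _).
exact: (congr1 fine (probability_setT P)).
 Qed.

Lemma bRintegral_sum (I : Type) (r : seq I) (Q : pred I) (F : I -> T -> R) :
  (forall i, bounded_mfun (F i)) ->
  \int[P]_x (\sum_(i <- r | Q i) F i x) = \sum_(i <- r | Q i) \int[P]_x F i x.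
Proof.
move=> bF; elim: r => [|i r IHr].
  by under eq_Rintegral do rewrite big_nil; rewrite Rintegral_prob_cst big_nil.
under eq_Rintegral do rewrite big_cons; rewrite big_cons -IHr.
case: (Q i) => //; rewrite bRintegralD//; exact: bounded_mfun_sum.
Qed.

Lemma le_bRintegral f g : bounded_mfun f -> bounded_mfun g ->
  (forall x, f x <= g x) -> \int[P]_x f x <= \int[P]_x g x.
Proof.
by move=> ? ? fg; apply: le_Rintegral => //; exact: bounded_mfun_integrable.
Qed.

Lemma ae_eq_bRintegral f g : measurable_fun setT f -> measurable_fun setT g ->
  {ae P, forall x, f x = g x} -> \int[P]_x f x = \int[P]_x g x.
Proof.
move=> mf mg fg; congr fine; apply: ae_eq_integral => //.
- exact/measurable_EFinP.
- exact/measurable_EFinP.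
- by apply: filterS fg => x /= -> _.
Qed.

Lemma Rintegral_ae_ge0 f : measurable_fun setT f ->
  {ae P, forall x, 0 <= f x} -> 0 <= \int[P]_x f x.
Proof.
move=> mf f0; rewrite (_ : \int[P]_x f x = \int[P]_x (Num.max (f x) 0)).
  by apply: Rintegral_ge0 => x _; rewrite le_max lexx orbT.
apply: ae_eq_bRintegral => //.
  by apply: measurable_maxr => //; exact: measurable_cst.
by apply: filterS f0 => x /= f0; rewrite max_l.
Qed.

Lemma ge0_Rintegral_eq0 f : bounded_mfun f -> (forall x, 0 <= f x) ->
  \int[P]_x f x = 0 -> {ae P, forall x, f x = 0}.
Proof.
move=> bf f0 if0.
have {}if0 : (\int[P]_x (f x)%:E = 0)%E by rewrite EFin_Rintegral// if0.
have mf : measurable_fun setT (EFin \o f) by apply/measurable_EFinP; case: bf.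
have : (\int[P]_x `|(EFin \o f) x| = 0)%E.
  by rewrite -[RHS]if0; apply: eq_integral => x _; rewrite gee0_abs// lee_fin.
move=> /(ae_eq_integral_abs P measurableT mf).
by apply: filterS => x /= /(_ I) [].
Qed.

Lemma Rintegral_le_norm f (M : R) : bounded_mfun f ->
  (forall x, `|f x| <= M) -> `|\int[P]_x f x| <= M.
Proof.
move=> bf fM; rewrite (le_trans (le_normr_Rintegral _ _))//.
  exact: bounded_mfun_integrable.
rewrite -[leRHS]Rintegral_prob_cst; apply: le_bRintegral => //.
  case: bf => mf _; split; first exact: measurableT_comp.
  by exists M => x; rewrite normr_id.
exact: bounded_mfun_cst.
Qed.

Lemma bounded_convergence (f_ : nat -> T -> R) f (M : R) :
  (forall n, measurable_fun setT (f_ n)) -> measurable_fun setT f ->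
  {ae P, forall x n, `|f_ n x| <= M} ->
  {ae P, forall x, f_ n x @[n --> \oo] --> f x} ->
  \int[P]_x f_ n x @[n --> \oo] --> \int[P]_x f x.
Proof.
move=> mf_ mf fM ff.
have := @dominated_convergence _ _ _ P setT measurableT
  (fun n x => (f_ n x)%:E) (fun x => (f x)%:E) (fun=> M%:E) _ _ _ _ _.
case.
- by move=> n; exact/measurable_EFinP.
- exact/measurable_EFinP.
- by apply: filterS ff => x fx _; apply/fine_cvgP; split => //; exact: nearW.
- exact: (bounded_mfun_integrable P (bounded_mfun_cst _ M)).
- by apply: filterS fM => x fM n _; rewrite lee_fin.
- move=> fi _ h; apply: fine_cvg; rewrite fineK//.
  exact: (integrable_fin_num _ fi).
Qed.

Lemma bRintegral_nneg_lim (f_ : nat -> T -> R) f (M : R) :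
  (forall n, measurable_fun setT (f_ n)) -> measurable_fun setT f ->
  {ae P, forall x n, `|f_ n x| <= M} ->
  {ae P, forall x, f_ n x @[n --> \oo] --> f x} ->
  (forall n, 0 <= \int[P]_x f_ n x) -> 0 <= \int[P]_x f x.
Proof.
move=> mf_ mf fM ff f0; have := bounded_convergence mf_ mf fM ff.
move=> h; rewrite -(cvg_lim _ h)//; apply: limr_ge; first exact: cvgP h.
exact: nearW.
Qed.

End bounded_integral.

(** * Conditional probabilities of events *)

Section conditional_probability.
Context d (T : measurableType d) (R : realType) (P : probability T R).
Variables (a : T -> R) (ma : measurable_fun setT a).

Lemma bounded_mfun_indic_comp (B : set R) : measurable B ->
  bounded_mfun (fun w => \1_B (a w) : R).
Proof.
by move=> mB; apply: (bounded_mfun_comp ma); exact: bounded_mfun_indic.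
Qed.

(** Tested on the part of [C] where [w < 0], the hypothesis forces a nonpositive function to have
    integral 0. In this way signs of integrals over Borel sets become the almost sure sign of a
    conditional expectation. *)
Lemma ae_ge0_of_integral_ge0 (C : set R) (w : R -> R) : measurable C ->
  bounded_mfun w ->
  (forall B : set R, measurable B -> B `<=` C ->
     0 <= \int[P]_x (\1_B (a x) * w (a x))) ->
  {ae P, forall x, C (a x) -> 0 <= w (a x)}.
Proof.
move=> mC bw w0.
pose B := C `&` [set x | w x < 0].
have mB : measurable B.
  apply: measurableI => //; have [mw _] := bw.
  have := mw measurableT _ (measurable_itv `]-oo, 0[).
  by rewrite setTI; congr measurable; apply/seteqP; split => x /=; rewrite in_itv.
pose f x := \1_B (a x) * w (a x).
have bf : bounded_mfun f.
  apply: bounded_mfunM; first exact: bounded_mfun_indic_comp.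
  exact: (bounded_mfun_comp ma bw).
have f0 x : f x <= 0.
  rewrite /f indicE; case: (boolP (_ \in _)) => [|_]; last by rewrite mul0r.
  by rewrite inE mul1r => -[_ /ltW].
have : \int[P]_x (- f x) = 0.
  apply/eqP; rewrite eq_le Rintegral_ge0 ?andbT; last first.
    by move=> x _; rewrite oppr_ge0.
  under eq_Rintegral do rewrite -mulN1r.
  rewrite bRintegralZ// mulN1r oppr_le0; apply: w0 => //.
  exact: subIsetl.
move=> /(ge0_Rintegral_eq0 (bounded_mfunN bf)).
have Nf0 x : 0 <= - f x by rewrite oppr_ge0.
move=> /(_ Nf0); apply: filterS => x /eqP; rewrite oppr_eq0 => fx0 Cax.
rewrite leNgt; apply/negP => wax.
move: fx0; rewrite /f indicE mem_set; last by split.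
by rewrite mul1r lt_eqF.
Qed.

(* [[0, 1]]-valued versions of the conditional probability, with the defining
   identity written as an identity of real integrals. *)
Definition is_cprob (A : set T) (g : R -> R) :=
  [/\ measurable_fun setT g, forall x, 0 <= g x <= 1 &
      forall B : set R, measurable B ->
        \int[P]_x (\1_B (a x) * \1_A x) = \int[P]_x (\1_B (a x) * g (a x))].

Lemma is_cprob_bounded A g : is_cprob A g -> bounded_mfun g.
Proof.
move=> [mg g01 _]; split => //; exists 1 => x.
by rewrite ger0_norm; case/andP: (g01 x).
Qed.

Lemma is_cprob_unique A g h : is_cprob A g -> is_cprob A h ->
  {ae P, forall x, g (a x) = h (a x)}.
Proof.
move=> cg ch.
have bg := is_cprob_bounded cg; have bh := is_cprob_bounded ch.
have H u v : is_cprob A u -> is_cprob A v ->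
    {ae P, forall x, u (a x) <= v (a x)}.
  move=> cu cv.
  have bu := is_cprob_bounded cu; have bv := is_cprob_bounded cv.
  have : {ae P, forall x, setT (a x) -> 0 <= v (a x) - u (a x)}.
    apply: (ae_ge0_of_integral_ge0 (w := fun x => v x - u x)) => //.
      exact: bounded_mfunB.
    move=> B mB _; under eq_Rintegral do rewrite mulrBr.
    rewrite bRintegralB.
    - by case: cu => _ _ /(_ _ mB) <-; case: cv => _ _ /(_ _ mB) <-; rewrite subrr.
    - apply: bounded_mfunM (bounded_mfun_indic_comp mB) _.
      exact: (bounded_mfun_comp ma).
    - apply: bounded_mfunM (bounded_mfun_indic_comp mB) _.
      exact: (bounded_mfun_comp ma).
  by apply: filterS => x /(_ I); rewrite subr_ge0.
near=> x; apply/eqP; rewrite eq_le; apply/andP; split; near: x; exact: H.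
Unshelve. all: by end_near.
Qed.

Lemma integral_preimageE (B : set R) (X : T -> R) :
  (\int[P]_(x in a @^-1` B) (X x)%:E = \int[P]_x (\1_B (a x) * X x)%:E)%E.
Proof.
rewrite integral_mkcond; apply: eq_integral => x _.
rewrite restrict_EFin; congr EFin; rewrite patchE indicE.
have -> : (x \in a @^-1` B) = (a x \in B) by [].
by case: (_ \in _); rewrite ?mul1r ?mul0r.
Qed.

(** Over [{g (a) > 1}] the integral of [g (a)] is the mass of a part of that event, so the integral
    of [g (a) - 1] is at most 0. Hence [g (a) <= 1] almost surely, and capping at 1 yields another
    version. *)
Lemma cond_prob_is_cprob (A : set T) (g : R -> R) : measurable A ->
  cond_prob P a A g ->
  {ae P, forall x, g (a x) <= 1} /\ is_cprob A (fun x => Num.min (g x) 1).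
Proof.
move=> mA [/measurable_EFinP mg g0 gA].
have g0' x : 0 <= g x by rewrite -lee_fin g0.
have mga : measurable_fun setT (g \o a) by exact: measurableT_comp.
have ga1 : {ae P, forall x, g (a x) <= 1}.
  pose B := [set x | 1 < g x].
  have mB : measurable B.
    have := mg measurableT _ (measurable_itv `]1, +oo[).
    rewrite setTI; congr measurable; apply/seteqP; split => x /=.
      by rewrite in_itv/= andbT.
    by rewrite in_itv/= andbT.
  have maB : measurable (a @^-1` B) by rewrite -[_ @^-1` _]setTI; exact: ma.
  (* At this point [g] is not known to be integrable, so the positive part of [g - 1] is integrated
     in the extended reals. *)
  pose h x := Num.max (g x - 1) 0.
  have mha : measurable_fun setT (h \o a).
    apply: measurableT_comp => //.
    apply: measurable_maxr; last exact: measurable_cst.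
    by apply: measurable_funB => //; exact: measurable_cst.
  have h0 x : 0 <= h x by rewrite le_max lexx orbT.
  have hB x : h x = \1_B x * (g x - 1).
    rewrite indicE /h; case: (boolP (_ \in _)); rewrite ?inE ?notin_setE /B/=.
      by move=> gx; rewrite mul1r max_l// subr_ge0 ltW.
    by move=> /negP; rewrite -leNgt => gx; rewrite mul0r max_r// subr_le0.
  have : (\int[P]_x (h (a x))%:E = 0)%E.
    have := gA B mB.
    rewrite /= !integral_preimageE.
    under [in RHS]eq_integral => x _.
      rewrite (_ : \1_B (a x) * g (a x) = \1_B (a x) + h (a x)); last first.
        by rewrite hB; ring.
      over.
    under [in RHS]eq_integral do rewrite EFinD.
    have nB x : setT x -> (0 <= (\1_B (a x) : R)%:E)%E.
      by rewrite lee_fin indicE; case: (_ \in _).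
    have mB' : measurable_fun setT (fun x => (\1_B (a x) : R)%:E).
      by apply/measurable_EFinP; case: (bounded_mfun_indic_comp mB).
    have nh x : setT x -> (0 <= (h (a x))%:E)%E by rewrite lee_fin.
    have mh' : measurable_fun setT (fun x => (h (a x))%:E) by exact/measurable_EFinP.
    rewrite (ge0_integralD P measurableT nB mB' nh mh').
    have bB := bounded_mfun_indic_comp mB.
    have bAB : bounded_mfun (fun x => \1_B (a x) * \1_A x : R).
      by apply: bounded_mfunM => //; exact: bounded_mfun_indic.
    rewrite (EFin_Rintegral P bAB) (EFin_Rintegral P bB) => e.
    have le : \int[P]_x (\1_B (a x) * \1_A x) <= \int[P]_x \1_B (a x).
      apply: le_bRintegral => // x; rewrite [\1_A x]indicE.
      by case: (_ \in A); rewrite ?mulr1// mulr0 indicE; case: (_ \in _).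
    have : (0 <= \int[P]_x (h (a x))%:E)%E by apply: integral_ge0 => x _; rewrite lee_fin.
    move: e; case: (\int[P]_x (h (a x))%:E)%E => [r| |]//.
    rewrite -EFinD => -[e]; rewrite lee_fin => r0; congr EFin; lra.
  have e : forall x, (h (a x))%:E = `|(h (a x))%:E|%E.
    by move=> x; rewrite gee0_abs// lee_fin.
  under eq_integral do rewrite e.
  have mha' : measurable_fun setT (fun x => (h (a x))%:E) by exact/measurable_EFinP.
  move=> /(ae_eq_integral_abs P measurableT mha').
  apply: filterS => x /= /(_ I) [hx].
  by have : g (a x) - 1 <= h (a x); [rewrite le_max lexx|rewrite hx subr_le0].
split => //; split.
- by apply: measurable_minr => //; exact: measurable_cst.
- by move=> x; rewrite le_min g0' ler01 ge_min lexx orbT.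
- move=> B mB; have := gA B mB; rewrite /= !integral_preimageE.
  move=> e; transitivity (\int[P]_x (\1_B (a x) * g (a x))).
    by rewrite /Rintegral e.
  apply: ae_eq_bRintegral.
  + by apply: measurable_funM => //; case: (bounded_mfun_indic_comp mB).
  + apply: measurable_funM => //; first by case: (bounded_mfun_indic_comp mB).
    by apply: measurable_minr => //; exact: measurable_cst.
  + by apply: filterS ga1 => x gx; rewrite min_l.
Qed.

Section product_formula.
Variables (I J : finType) (E : I -> J -> set T).
Hypothesis mE : forall i j, measurable (E i j).
Hypothesis indepE : forall s : I -> J, exists g : I -> R -> R,
  (forall i, cond_prob P a (E i (s i)) (g i)) /\
  cond_prob P a (\bigcap_i E i (s i)) (fun x => \prod_i g i x).

Lemma measurable_bigcap_fin (s : I -> J) : measurable (\bigcap_i E i (s i)).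
Proof. by apply: fin_bigcap_measurable => // i _; exact: mE. Qed.

(** The versions provided by [indepE] may change with the selection [s]. Almost sure uniqueness
    allows one version per event to be fixed once and for all, so that different selections can be
    added up. *)
Lemma cprob_family : exists G : I -> J -> R -> R,
  (forall i j, is_cprob (E i j) (G i j)) /\
  (forall s : I -> J,
     is_cprob (\bigcap_i E i (s i)) (fun x => \prod_i G i (s i) x)).
Proof.
have H i j : exists g, is_cprob (E i j) g.
  have [g [/(_ i) gi _]] := indepE (fun=> j).
  by exists (fun x => Num.min (g i x) 1); case: (cond_prob_is_cprob (mE i j) gi).
pose G i j := projT1 (cid (H i j)).
have HG i j : is_cprob (E i j) (G i j) by rewrite /G; case: cid.
exists G; split => // s.
have [g [gi [_ _ gs]]] := indepE s.
split.
- by apply: measurable_prod => i _; case: (HG i (s i)).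
- move=> x; have G01 i : 0 <= G i (s i) x <= 1 by case: (HG i (s i)).
  by rewrite prodr_ge0 => [|i _]; [exact: numdomain.Num.Theory.prodr_ile1|case/andP: (G01 i)].
- move=> B mB; have := gs B mB; rewrite /= !integral_preimageE.
  move=> e; transitivity (\int[P]_x (\1_B (a x) * \prod_i g i (a x))).
    by rewrite /Rintegral e.
  apply: ae_eq_bRintegral.
  + apply: measurable_funM; first by case: (bounded_mfun_indic_comp mB).
    apply: measurable_prod => i _; apply: measurableT_comp => //.
    by case: (gi i) => /measurable_EFinP.
  + apply: measurable_funM; first by case: (bounded_mfun_indic_comp mB).
    apply: measurable_prod => i _; apply: measurableT_comp => //.
    by case: (HG i (s i)).
  + have : {ae P, forall x, forall i, g i (a x) = G i (s i) (a x)}.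
      apply: filter_forall => i; have [ga1 cg] := cond_prob_is_cprob (mE i (s i)) (gi i).
      move: ga1 (is_cprob_unique cg (HG i (s i))); apply: filterS2 => x gx <-.
      by rewrite min_l.
    apply: filterS => x gx; congr (_ * _).
    by apply: eq_bigr => i _; rewrite gx.
Qed.

Lemma indic_bigcap (s : I -> J) x :
  \1_(\bigcap_i E i (s i)) x = \prod_i \1_(E i (s i)) x :> R.
Proof.
rewrite indicE; case: (boolP (_ \in _)) => [|].
  rewrite inE => sx; rewrite big1// => i _; rewrite indicE mem_set//; exact: sx.
rewrite notin_setE => /= nsx.
have [i nsi] : exists i, ~ E i (s i) x.
  by apply: contra_notP nsx => /forallNP h i _; have /contrapT := h i.
by rewrite (bigD1 i)//= indicE memNset// mul0r.
Qed.

(** The product rule for conditional expectations of step functions: the product of sums is expanded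
    over all selections, and each selection is an intersection of events. The events [E i j] may
    overlap in [j], so the levels of two different step functions fit into one family. *)
Lemma cprob_product_formula : exists G : I -> J -> R -> R,
  (forall i j, is_cprob (E i j) (G i j)) /\
  (forall (c : I -> J -> R) (B : set R), measurable B ->
    \int[P]_x (\1_B (a x) * \prod_i \sum_j c i j * \1_(E i j) x) =
    \int[P]_x (\1_B (a x) * \prod_i \sum_j c i j * G i j (a x))).
Proof.
have [G [HG Gs]] := cprob_family; exists G; split => // c B mB.
have bB := bounded_mfun_indic_comp mB.
have expand (F : I -> J -> R) : \prod_i \sum_j c i j * F i j =
    \sum_(s : {ffun I -> J}) (\prod_i c i (s i)) * \prod_i F i (s i).
  by rewrite bigA_distr_bigA; apply: eq_bigr => s _; rewrite big_split.
under eq_Rintegral do rewrite expand mulr_sumr.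
under [in RHS]eq_Rintegral do rewrite expand mulr_sumr.
rewrite !bRintegral_sum; last 2 first.
- move=> s; apply: bounded_mfunM bB (bounded_mfunM (bounded_mfun_cst _ _) _).
  by apply: bounded_mfun_prod => i; apply: (bounded_mfun_comp ma); exact: is_cprob_bounded.
- move=> s; apply: bounded_mfunM bB (bounded_mfunM (bounded_mfun_cst _ _) _).
  by apply: bounded_mfun_prod => i; exact: bounded_mfun_indic.
apply: eq_bigr => s _.
under eq_Rintegral do rewrite mulrCA -indic_bigcap.
under [in RHS]eq_Rintegral do rewrite mulrCA.
have [_ _ /(_ B mB) e] := Gs s.
rewrite !bRintegralZ ?e//.
- apply: bounded_mfunM bB _.
  by apply: bounded_mfun_prod => i; apply: (bounded_mfun_comp ma); exact: is_cprob_bounded.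
- apply: bounded_mfunM bB _.
  exact/bounded_mfun_indic/measurable_bigcap_fin.
Qed.

End product_formula.
End conditional_probability.

(** * Conditional independence and positivity *)

(** Values are rounded down to the grid [lo + i / (n + 1)]. The bound [lo <= c i] holds for all
    levels, even empty ones, so a nonnegative function gets nonnegative coefficients. *)
Lemma step_approx d (T : measurableType d) (R : realType) (f : T -> R)
    (lo hi : R) (n : nat) : measurable_fun setT f ->
  (forall x, lo <= f x <= hi) ->
  exists (N : nat) (c : 'I_N.+1 -> R) (S : 'I_N.+1 -> set T),
    [/\ forall i, measurable (S i), forall i, lo <= c i &
        forall x, let s := \sum_i c i * \1_(S i) x in
                  lo <= s /\ s <= f x <= s + n.+1%:R^-1].
Proof.
move=> mf fb; have n0 : 0 < n.+1%:R :> R by [].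
pose y x := (f x - lo) * n.+1%:R.
have y0 x : 0 <= y x.
  by case/andP: (fb x) => lof _; rewrite mulr_ge0// subr_ge0.
pose N := Num.trunc ((hi - lo) * n.+1%:R).
pose c (i : 'I_N.+1) : R := lo + i%:R / n.+1%:R.
pose S (i : 'I_N.+1) := [set x | i%:R <= y x < i.+1%:R].
have my : measurable_fun setT y.
  apply: measurable_funM; last exact: measurable_cst.
  by apply: measurable_funB => //; exact: measurable_cst.
have yN x : (Num.trunc (y x) < N.+1)%N.
  rewrite ltnS; apply: le_truncn; rewrite ler_wpM2r// lerB//.
  by case/andP: (fb x).
exists N, c, S; split.
- move=> i; have := my measurableT _ (measurable_itv `[i%:R, i.+1%:R[).
  by rewrite setTI; congr measurable; apply/seteqP; split => x /=; rewrite in_itv.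
- by move=> i; rewrite lerDl divr_ge0.
move=> x /=; pose i0 := Ordinal (yN x).
have SE i : S i x <-> i = i0.
  split; last by move=> ->; exact: truncn_itv.
  by move=> Six; apply/val_inj => /=; apply/esym/truncn_def.
have -> : \sum_i c i * \1_(S i) x = c i0.
  rewrite (bigD1 i0)//= big1 ?addr0 => [|i ii0].
    by rewrite indicE mem_set ?mulr1//; apply/SE.
  by rewrite indicE memNset ?mulr0// => /SE /eqP; apply/negP.
have /andP[h1 h2] := truncn_itv (y0 x).
rewrite /c; split; first by rewrite lerDl divr_ge0.
apply/andP; split.
  by rewrite addrC -lerBrDr ler_pdivrMr.
rewrite -[X in _ + X]mul1r -addrA -mulrDl natr1 addrC -lerBlDr ler_pdivlMr//.
exact: ltW.
Qed.

Section pair_defect.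
Context {R : realType}.

(* With the paper's k = n + 1: averaging the mixed product k x_h prod y_h' over
   uniform h turns it into the sum. *)
Definition pair_defect (n : nat) (x y : 'I_n.+1 -> R) : R :=
  \prod_h x h + n%:R * \prod_h y h - \sum_h x h * \prod_(h' | h' != h) y h'.

Lemma pair_defect_cst (n : nat) (x y : R) :
  @pair_defect n (fun=> x) (fun=> y) =
  x ^+ n.+1 + n%:R * y ^+ n.+1 - n.+1%:R * (x * y ^+ n).
Proof.
rewrite /pair_defect !prodr_const !card_ord; congr (_ - _).
under eq_bigr => h _.
  rewrite prodr_const (_ : #|_| = n); last first.
    by apply: (etrans (cardC1 h)); rewrite card_ord.
  over.
by rewrite sumr_const card_ord mulr_natl.
Qed.

Lemma pair_defect_cst_ge0 (n : nat) (x y : R) : 0 <= x -> 0 <= y ->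
  0 <= @pair_defect n (fun=> x) (fun=> y).
Proof. by move=> x0 y0; rewrite pair_defect_cst subr_ge0 weighted_amgm. Qed.

(** The coefficients cancel: [1 + n - (n + 1) = 0]. This removes the exponents 0 and 1, for which
    both laws have the same moments. *)
Lemma pair_defect_diag (n : nat) (x : 'I_n.+1 -> R) : pair_defect x x = 0.
Proof.
rewrite /pair_defect.
have -> : \sum_h x h * \prod_(h' | h' != h) x h' = \sum_(h < n.+1) \prod_h' x h'.
  by apply: eq_bigr => h _; rewrite [RHS](bigD1 h).
by rewrite sumr_const card_ord mulrS mulr_natl subrr.
Qed.

(** Every mixed term becomes a product with one factor per index, the shape to which a product
    formula applies. *)
Lemma pair_defectE (n : nat) (x y : 'I_n.+1 -> R) :
  pair_defect x y = \prod_h x h + n%:R * \prod_h y h -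
    \sum_h \prod_h' (if h' == h then x h' else y h').
Proof.
congr (_ - _); apply: eq_bigr => h _; rewrite [RHS](bigD1 h)//= eqxx.
by congr (_ * _); apply: eq_bigr => h' /negPf ->.
Qed.

Lemma bounded_mfun_pair_defect d (T : measurableType d) (n : nat)
    (x y : 'I_n.+1 -> T -> R) :
  (forall h, bounded_mfun (x h)) -> (forall h, bounded_mfun (y h)) ->
  bounded_mfun (fun t => pair_defect (x ^~ t) (y ^~ t)).
Proof.
move=> bx hy; apply: bounded_mfunB; first apply: bounded_mfunD.
- exact: bounded_mfun_prod.
- by apply: bounded_mfunM (bounded_mfun_cst _ _) _; exact: bounded_mfun_prod.
- by apply: bounded_mfun_sum => h; apply: bounded_mfunM (bx h) _; exact: bounded_mfun_prod.
Qed.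

Lemma cvg_pair_defect (n : nat) (x_ y_ : nat -> 'I_n.+1 -> R) (x y : 'I_n.+1 -> R) :
  (forall h, x_ m h @[m --> \oo] --> x h) ->
  (forall h, y_ m h @[m --> \oo] --> y h) ->
  pair_defect (x_ m) (y_ m) @[m --> \oo] --> pair_defect x y.
Proof.
have cvg_prod (P : pred 'I_n.+1) (u_ : nat -> 'I_n.+1 -> R) (u : 'I_n.+1 -> R) :
    (forall h, u_ m h @[m --> \oo] --> u h) ->
    \prod_(h | P h) u_ m h @[m --> \oo] --> \prod_(h | P h) u h.
  move=> cu; apply: cvg_big => [|h _]; last exact: cu.
  exact: mul_continuous.
move=> cx cy; apply: cvgB; first apply: cvgD.
- exact: cvg_prod.
- by apply: cvgM; [exact: cvg_cst|exact: cvg_prod].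
- apply: cvg_big => [|h _]; first exact: add_continuous.
  by apply: cvgM; [exact: cx|exact: cvg_prod].
Qed.

End pair_defect.

Section conditional_positivity.
Context d (T : measurableType d) (R : realType) (P : probability T R).
Variables (a : T -> R) (ma : measurable_fun setT a).

Let sum_inl (I J : finType) (u : I -> R) (v : I + J -> R) :
  \sum_(j : I + J) (if j is inl i then u i else 0) * v j =
  \sum_i u i * v (inl i).
Proof.
rewrite big_sumType/= [X in _ + X]big1 ?addr0// => i _; exact: mul0r.
Qed.

Let sum_inr (I J : finType) (u : J -> R) (v : I + J -> R) :
  \sum_(j : I + J) (if j is inr i then u i else 0) * v j =
  \sum_i u i * v (inr i).
Proof.
rewrite big_sumType/= [X in X + _]big1 ?add0r// => i _; exact: mul0r.
Qed.

(** Every term of the defect has exactly one factor per [h], so under the integral the indicators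
    may be replaced by conditional probabilities. These do not depend on [h] almost surely, by
    equality of the conditional laws; the defect is then taken at two constant families, where it is
    nonnegative by AM-GM. *)
Lemma pair_defect_integral_step (k : nat) (J : finType)
    (E : 'I_k.+1 -> J -> set T) (cA cB : J -> R) (C : set R) :
  (forall i j, measurable (E i j)) ->
  (forall s : 'I_k.+1 -> J, exists g : 'I_k.+1 -> R -> R,
    (forall i, cond_prob P a (E i (s i)) (g i)) /\
    cond_prob P a (\bigcap_i E i (s i)) (fun x => \prod_i g i x)) ->
  (forall h i j, exists g, cond_prob P a (E h j) g /\ cond_prob P a (E i j) g) ->
  (forall j, 0 <= cA j) -> (forall j, 0 <= cB j) -> measurable C ->
  0 <= \int[P]_w (\1_C (a w) * pair_defect
         (fun h => \sum_j cA j * \1_(E h j) w)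
         (fun h => \sum_j cB j * \1_(E h j) w)).
Proof.
move=> mE indepE idE cA0 cB0 mC.
have [G [HG HGc]] := cprob_product_formula ma mE indepE.
pose A h w : R := \sum_j cA j * \1_(E h j) w.
pose B h w : R := \sum_j cB j * \1_(E h j) w.
pose U h w := \sum_j cA j * G h j (a w).
pose V h w := \sum_j cB j * G h j (a w).
have bE (c : J -> R) h : bounded_mfun (fun w => \sum_j c j * \1_(E h j) w : R).
  apply: bounded_mfun_sum => j; apply: bounded_mfunM (bounded_mfun_cst _ _) _.
  exact: bounded_mfun_indic.
have bG (c : J -> R) h : bounded_mfun (fun w => \sum_j c j * G h j (a w)).
  apply: bounded_mfun_sum => j; apply: bounded_mfunM (bounded_mfun_cst _ _) _.
  by apply: (bounded_mfun_comp ma); exact: is_cprob_bounded.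
have bC := bounded_mfun_indic_comp ma mC.
have split_defect (x y : 'I_k.+1 -> T -> R) :
    (forall h, bounded_mfun (x h)) -> (forall h, bounded_mfun (y h)) ->
    \int[P]_w (\1_C (a w) * pair_defect (x ^~ w) (y ^~ w)) =
    \int[P]_w (\1_C (a w) * \prod_h x h w) +
    k%:R * \int[P]_w (\1_C (a w) * \prod_h y h w) -
    \sum_h \int[P]_w (\1_C (a w) * \prod_h' (if h' == h then x h' w else y h' w)).
  move=> bx hy.
  have bp (z : 'I_k.+1 -> T -> R) : (forall h, bounded_mfun (z h)) ->
      bounded_mfun (fun w => \1_C (a w) * \prod_h z h w).
    by move=> bz; apply: bounded_mfunM bC _; exact: bounded_mfun_prod.
  have bm h : bounded_mfun
      (fun w => \1_C (a w) * \prod_h' (if h' == h then x h' w else y h' w)).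
    by apply: bp => h'; case: eqP.
  have bZ : bounded_mfun (fun w => k%:R * (\1_C (a w) * \prod_h y h w)).
    by apply: bounded_mfunM (bounded_mfun_cst _ _) _; exact: bp.
  transitivity (\int[P]_w (\1_C (a w) * \prod_h x h w +
      k%:R * (\1_C (a w) * \prod_h y h w) -
      \sum_h \1_C (a w) * \prod_h' (if h' == h then x h' w else y h' w))).
    by apply: eq_Rintegral => w _; rewrite pair_defectE -mulr_sumr; ring.
  rewrite bRintegralB; [|exact: bounded_mfunD (bp _ bx) bZ|exact: bounded_mfun_sum].
  rewrite bRintegralD; [|exact: bp|exact: bZ].
  by rewrite bRintegralZ ?bRintegral_sum//; exact: bp.
have -> : \int[P]_w (\1_C (a w) * pair_defect (A ^~ w) (B ^~ w)) =
          \int[P]_w (\1_C (a w) * pair_defect (U ^~ w) (V ^~ w)).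
  rewrite (split_defect A B (bE cA) (bE cB)) (split_defect U V (bG cA) (bG cB)).
  congr (_ + _ * _ - _).
  - exact: (HGc (fun=> cA) C mC).
  - exact: (HGc (fun=> cB) C mC).
  - apply: eq_bigr => h _.
    have := HGc (fun h' => if h' == h then cA else cB) C mC.
    rewrite (_ : (fun w => _) = fun w => \1_C (a w) *
      \prod_h' (if h' == h then A h' w else B h' w)); last first.
      by apply/funext => w; congr (_ * _); apply: eq_bigr => i _; case: eqP.
    move=> ->; apply: eq_Rintegral => w _; congr (_ * _).
    by apply: eq_bigr => i _; case: eqP.
apply: Rintegral_ae_ge0.
  have [] // : bounded_mfun
    (fun w => \1_C (a w) * pair_defect (U ^~ w) (V ^~ w)).
  by apply: bounded_mfunM bC _; apply: bounded_mfun_pair_defect => h; exact: bG.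
have Geq : {ae P, forall w, forall h j, G h j (a w) = G ord0 j (a w)}.
  apply: filter_forall => h; apply: filter_forall => j.
  have [g [g1 g2]] := idE h ord0 j.
  have [_ c1] := cond_prob_is_cprob ma (mE h j) g1.
  have [_ c2] := cond_prob_is_cprob ma (mE ord0 j) g2.
  move: (is_cprob_unique ma (HG h j) c1) (is_cprob_unique ma c2 (HG ord0 j)).
  by apply: filterS2 => w -> ->.
apply: filterS Geq => w Gw; rewrite mulr_ge0//.
have e (c : J -> R) h : \sum_j c j * G h j (a w) = \sum_j c j * G ord0 j (a w).
  by apply: eq_bigr => j _; rewrite Gw.
rewrite (_ : U ^~ w = fun=> U ord0 w); last by apply/funext => h; exact: e.
rewrite (_ : V ^~ w = fun=> V ord0 w); last by apply/funext => h; exact: e.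
have G0 j : 0 <= G ord0 j (a w) by case: (HG ord0 j) => _ /(_ (a w))/andP[].
by apply: pair_defect_cst_ge0; apply: sumr_ge0 => j _; rewrite mulr_ge0.
Qed.

Lemma cond_iid_pair_defect_ge0 (k : nat) d' (T' : measurableType d')
    (X : 'I_k.+1 -> T -> T') (A B : T' -> R) (C : set R) :
  (forall h, measurable_fun setT (X h)) -> cond_iid P a X ->
  bounded_mfun A -> bounded_mfun B ->
  (forall x, 0 <= A x) -> (forall x, 0 <= B x) -> measurable C ->
  0 <= \int[P]_w (\1_C (a w) * pair_defect (fun h => A (X h w)) (fun h => B (X h w))).
Proof.
move=> mX [iX idX] [mA [MA AM]] [mB [MB BM]] A0 B0 mC.
have bA x : 0 <= A x <= MA by rewrite A0/= (le_trans (ler_norm _) (AM x)).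
have bB x : 0 <= B x <= MB by rewrite B0/= (le_trans (ler_norm _) (BM x)).
have bC := bounded_mfun_indic_comp ma mC.
have H n : exists A' B' : T' -> R,
    [/\ measurable_fun setT A', measurable_fun setT B',
        forall x, 0 <= A' x <= A x /\ A x - n.+1%:R^-1 <= A' x,
        forall x, 0 <= B' x <= B x /\ B x - n.+1%:R^-1 <= B' x &
    0 <= \int[P]_w (\1_C (a w) * pair_defect (fun h => A' (X h w)) (fun h => B' (X h w)))].
  have [N [c [S [mS c0 Sb]]]] := step_approx n mA bA.
  have [N' [c' [S' [mS' c0' Sb']]]] := step_approx n mB bB.
  exists (fun x => \sum_i c i * \1_(S i) x), (fun x => \sum_i c' i * \1_(S' i) x).
  have mstep m (e : 'I_m -> R) (Q : 'I_m -> set T') : (forall i, measurable (Q i)) ->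
      measurable_fun setT (fun x => \sum_i e i * \1_(Q i) x : R).
    move=> mQ; have [] // : bounded_mfun (fun x => \sum_i e i * \1_(Q i) x : R).
    apply: bounded_mfun_sum => i; apply: bounded_mfunM (bounded_mfun_cst _ _) _.
    exact: bounded_mfun_indic.
  split; [exact: mstep|exact: mstep| | |].
  - by move=> x; have /= [-> /andP[-> h]] := Sb x; split=> //; rewrite lerBlDr.
  - by move=> x; have /= [-> /andP[-> h]] := Sb' x; split=> //; rewrite lerBlDr.
  (* The levels of both step functions are put into one index set, because the mixed products
     contain factors of either kind and have to come from a single family of events. *)
  pose S2 (j : 'I_N.+1 + 'I_N'.+1) := match j with inl i => S i | inr i => S' i end.
  have mS2 j : measurable (S2 j) by case: j.
  have := @pair_defect_integral_step k _ (fun h j => X h @^-1` S2 j)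
    (fun j => if j is inl i then c i else 0) (fun j => if j is inr i then c' i else 0) C.
  have eE (w : T) h i : \1_(X h @^-1` S2 i) w = \1_(S2 i) (X h w) :> R by [].
  rewrite (_ : (fun w => _) = fun w => \1_C (a w) * pair_defect
     (fun h => \sum_i c i * \1_(S i) (X h w))
     (fun h => \sum_i c' i * \1_(S' i) (X h w))); last first.
    apply/funext => w; congr (_ * pair_defect _ _); apply/funext => h.
      by rewrite sum_inl.
    by rewrite sum_inr.
  apply => //.
  - by move=> i j; rewrite -[_ @^-1` _]setTI; exact: mX.
  - by move=> s; exact: (iX (fun i => S2 (s i)) (fun i => mS2 (s i))).
  - by move=> h i j; exact: idX.
  - by case.
  - by case.
pose A_ n := projT1 (cid (H n)).
have [B_ HB_] := choice (fun n => projT2 (cid (H n))).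
pose M := `|MA| + `|MB|.
have [MD MDE] : exists MD : R, forall (x y : 'I_k.+1 -> R),
    (forall h, `|x h| <= MA) -> (forall h, `|y h| <= MB) -> `|pair_defect x y| <= MD.
  exists (MA ^+ k.+1 + k%:R * MB ^+ k.+1 + k.+1%:R * (MA * MB ^+ k)) => x y xM yM.
  have prodM (Q : pred 'I_k.+1) (z : 'I_k.+1 -> R) K : (forall h, `|z h| <= K) ->
      `|\prod_(h | Q h) z h| <= K ^+ #|Q|.
    move=> zK; rewrite normr_prod -prodr_const.
    by apply: ler_prod => h _; rewrite normr_ge0/= zK.
  rewrite /pair_defect (le_trans (ler_normB _ _))// lerD//.
    rewrite (le_trans (ler_normD _ _))// lerD//.
      by rewrite (le_trans (prodM _ _ MA _))// card_ord.
    rewrite normrM ger0_norm// ler_wpM2l//.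
    by rewrite (le_trans (prodM _ _ MB _))// card_ord.
  rewrite (le_trans (ler_norm_sum _ _ _))//.
  rewrite -[k.+1 in leRHS]card_ord -sum1_card natr_sum mulr_suml.
  apply: ler_sum => h _; rewrite mul1r normrM ler_pM//.
  rewrite (le_trans (prodM _ _ MB _))// (_ : #|_| = k)//.
  by apply: (etrans (cardC1 h)); rewrite card_ord.
apply: (@bRintegral_nneg_lim _ _ _ P
  (fun n w => \1_C (a w) * pair_defect (fun h => A_ n (X h w)) (fun h => B_ n (X h w)))
  _ MD).
- move=> n; have [mA' mB' A'b B'b _] := HB_ n.
  have bA' : bounded_mfun (A_ n).
    split=> //; exists MA => x; have [/andP[h1 h2] _] := A'b x.
    by rewrite ger0_norm// (le_trans h2)//; case/andP: (bA x).
  have bB' : bounded_mfun (B_ n).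
    split=> //; exists MB => x; have [/andP[h1 h2] _] := B'b x.
    by rewrite ger0_norm// (le_trans h2)//; case/andP: (bB x).
  have [] // : bounded_mfun (fun w => \1_C (a w) *
      pair_defect (fun h => A_ n (X h w)) (fun h => B_ n (X h w))).
  apply: bounded_mfunM bC _; apply: bounded_mfun_pair_defect => h.
    exact: (bounded_mfun_comp (mX h) bA').
  exact: (bounded_mfun_comp (mX h) bB').
- have [] // : bounded_mfun (fun w => \1_C (a w) *
      pair_defect (fun h => A (X h w)) (fun h => B (X h w))).
  apply: bounded_mfunM bC _; apply: bounded_mfun_pair_defect => h.
    by apply: (bounded_mfun_comp (mX h)); split => //; exists MA.
  by apply: (bounded_mfun_comp (mX h)); split => //; exists MB.
- apply: aeW => x n; have [_ _ A'b B'b _] := HB_ n.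
  rewrite normrM (@le_trans _ _ (1 * `|pair_defect (fun h => A_ n (X h x))
    (fun h => B_ n (X h x))|))//.
    by rewrite ler_wpM2r// indicE; case: (_ \in _); rewrite ?normr1 ?normr0.
  rewrite mul1r; apply: MDE => h.
    have [/andP[h1 h2] _] := A'b (X h x).
    by rewrite ger0_norm// (le_trans h2)//; case/andP: (bA (X h x)).
  have [/andP[h1 h2] _] := B'b (X h x).
  by rewrite ger0_norm// (le_trans h2)//; case/andP: (bB (X h x)).
- have squeeze (u_ : nat -> R) u : (forall n, u - n.+1%:R^-1 <= u_ n <= u) ->
      u_ n @[n --> \oo] --> u.
    move=> hu; apply: (@squeeze_cvgr _ _ _ _ (fun n => u - n.+1%:R^-1) (fun=> u)).
    - exact: nearW.
    - rewrite -[X in _ --> X]subr0; apply: cvgB; first exact: cvg_cst.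
      exact: cvg_harmonic.
    - exact: cvg_cst.
  apply: aeW => w; apply: cvgM; first exact: cvg_cst.
  apply: cvg_pair_defect => h; apply: squeeze => n.
    by have [_ _ /(_ (X h w))[/andP[_ ->] ->]] := HB_ n.
  by have [_ _ _ /(_ (X h w))[/andP[_ ->] ->]] := HB_ n.
- by move=> n; case: (HB_ n).
Qed.

Lemma is_cprob_sum (J : finType) (E : J -> set T) (G : J -> R -> R) (c : J -> R)
    (B : set R) :
  (forall j, measurable (E j)) -> (forall j, is_cprob P a (E j) (G j)) ->
  measurable B ->
  \int[P]_w (\1_B (a w) * \sum_j c j * \1_(E j) w) =
  \int[P]_w (\1_B (a w) * \sum_j c j * G j (a w)).
Proof.
move=> mE HG mB; have bB := bounded_mfun_indic_comp ma mB.
have bE j : bounded_mfun (fun w => \1_B (a w) * \1_(E j) w : R).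
  by apply: bounded_mfunM bB _; exact: bounded_mfun_indic.
have bG j : bounded_mfun (fun w => \1_B (a w) * G j (a w)).
  by apply: bounded_mfunM bB _; apply: (bounded_mfun_comp ma); exact: is_cprob_bounded.
have bEc j : bounded_mfun (fun w => c j * (\1_(B) (a w) * \1_(E j) w)).
  exact: bounded_mfunM (bounded_mfun_cst _ _) (bE j).
have bGc j : bounded_mfun (fun w => c j * (\1_(B) (a w) * G j (a w))).
  exact: bounded_mfunM (bounded_mfun_cst _ _) (bG j).
under eq_Rintegral do (rewrite mulr_sumr; under eq_bigr do rewrite mulrCA).
under [RHS]eq_Rintegral do (rewrite mulr_sumr; under eq_bigr do rewrite mulrCA).
rewrite !bRintegral_sum//; apply: eq_bigr => j _.
rewrite !bRintegralZ//; congr (_ * _).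
by case: (HG j) => _ _; apply.
Qed.

Lemma cond_indep_integral_ge0 d1 d2 (T1 : measurableType d1)
    (T2 : measurableType d2) (X : T -> T1) (Y : T -> T2) (u : T1 -> R)
    (v : T2 -> R) (C : set R) :
  measurable_fun setT X -> measurable_fun setT Y -> cond_indep P a X Y ->
  bounded_mfun u -> bounded_mfun v -> measurable C ->
  (forall B : set R, measurable B -> B `<=` C ->
     0 <= \int[P]_w (\1_B (a w) * u (X w))) ->
  (forall B : set R, measurable B -> B `<=` C ->
     0 <= \int[P]_w (\1_B (a w) * v (Y w))) ->
  0 <= \int[P]_w (\1_C (a w) * (u (X w) * v (Y w))).
Proof.
move=> mX mY iXY bu bv mC u0 v0.
have [mu [Mu uM]] := bu; have [mv [Mv vM]] := bv.
have bC := bounded_mfun_indic_comp ma mC.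
(* Step functions [u'], [v'] lying above [u], [v] up to 1/(n+1): their
   conditional expectations given [a] are nonnegative on [C], and they
   multiply because [X] and [Y] are conditionally independent. *)
have H n : exists (u' : T1 -> R) (v' : T2 -> R),
    [/\ bounded_mfun u', bounded_mfun v',
        forall x, u x <= u' x <= u x + n.+1%:R^-1,
        forall x, v x <= v' x <= v x + n.+1%:R^-1 &
    0 <= \int[P]_w (\1_C (a w) * (u' (X w) * v' (Y w)))].
  have ub x : - Mu <= - u x <= Mu by rewrite -ler_norml normrN.
  have vb x : - Mv <= - v x <= Mv by rewrite -ler_norml normrN.
  have mNu : measurable_fun setT (fun x => - u x) by exact: measurableT_comp.
  have mNv : measurable_fun setT (fun x => - v x) by exact: measurableT_comp.
  have [N [c [S [mS _ Sb]]]] := step_approx n mNu ub.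
  have [N' [c' [S' [mS' _ Sb']]]] := step_approx n mNv vb.
  pose J : finType := ('I_N.+1 + 'I_N'.+1)%type.
  (* The events of [X] and of [Y] must be indexed by the same type: at the indices that belong to
     the other variable, the event is empty and the coefficient is 0. *)
  pose S1 (j : J) := if j is inl i then S i else set0.
  pose S2 (j : J) := if j is inr i then S' i else set0.
  pose c1 (j : J) := if j is inl i then - c i else 0.
  pose c2 (j : J) := if j is inr i then - c' i else 0.
  have mS1 j : measurable (S1 j) by case: j => i; [exact: mS|exact: measurable0].
  have mS2 j : measurable (S2 j) by case: j => i; [exact: measurable0|exact: mS'].
  pose E (b : bool) (j : J) := if b then X @^-1` S1 j else Y @^-1` S2 j.
  have mE b j : measurable (E b j).
    by case: b; rewrite /E -[_ @^-1` _]setTI; [exact: mX|exact: mY].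
  have iE (s : bool -> J) : exists g : bool -> R -> R,
      (forall b, cond_prob P a (E b (s b)) (g b)) /\
      cond_prob P a (\bigcap_b E b (s b)) (fun x => \prod_b g b x).
    have [gX [gY [h1 h2 h3]]] :=
      iXY (S1 (s true)) (S2 (s false)) (mS1 _) (mS2 _).
    exists (fun b : bool => if b then gX else gY); split; first by case.
    rewrite (_ : \bigcap_b E b (s b) =
        X @^-1` S1 (s true) `&` Y @^-1` S2 (s false)).
      by under eq_fun do rewrite big_bool.
    apply/seteqP; split => x; first by move=> h; split; [exact: (h true)|exact: (h false)].
    by move=> [? ?] [].
  have [G [HG HGc]] := cprob_product_formula ma mE iE.
  pose cc (b : bool) (j : J) := if b then c1 j else c2 j.
  pose u' x := \sum_(j : J) c1 j * \1_(S1 j) x.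
  pose v' x := \sum_(j : J) c2 j * \1_(S2 j) x.
  have u'E x : u' x = - \sum_i c i * \1_(S i) x.
    rewrite /u' (sum_inl (fun i => - c i) (fun j => \1_(S1 j) x)) -sumrN.
    by apply: eq_bigr => i _; rewrite mulNr.
  have v'E x : v' x = - \sum_i c' i * \1_(S' i) x.
    rewrite /v' (sum_inr (fun i => - c' i) (fun j => \1_(S2 j) x)) -sumrN.
    by apply: eq_bigr => i _; rewrite mulNr.
  have uu' x : u x <= u' x <= u x + n.+1%:R^-1.
    rewrite u'E; have /= := Sb x; move: (\sum_i _) => s [_ /andP[]].
    by move: (_^-1) => e; lra.
  have vv' x : v x <= v' x <= v x + n.+1%:R^-1.
    rewrite v'E; have /= := Sb' x; move: (\sum_i _) => s [_ /andP[]].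
    by move: (_^-1) => e; lra.
  have bu' : bounded_mfun u'.
    apply: bounded_mfun_sum => j; apply: bounded_mfunM (bounded_mfun_cst _ _) _.
    exact: bounded_mfun_indic.
  have bv' : bounded_mfun v'.
    apply: bounded_mfun_sum => j; apply: bounded_mfunM (bounded_mfun_cst _ _) _.
    exact: bounded_mfun_indic.
  exists u', v'; split => //.
  have Cge0 b : (forall B, measurable B -> B `<=` C ->
      0 <= \int[P]_w (\1_B (a w) * \sum_j cc b j * \1_(E b j) w)) ->
      {ae P, forall w, C (a w) -> 0 <= \sum_j cc b j * G b j (a w)}.
    move=> h; apply: (ae_ge0_of_integral_ge0 ma (w := fun r => \sum_j cc b j * G b j r)) => //.
      apply: bounded_mfun_sum => j; apply: bounded_mfunM (bounded_mfun_cst _ _) _.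
      exact (is_cprob_bounded (HG b j)).
    by move=> B mB BC; rewrite -(is_cprob_sum (cc b) (mE b) (HG b) mB); exact: h.
  have mono d' (T' : measurableType d') (Z : T -> T') (f g : T' -> R) B :
      measurable_fun setT Z -> bounded_mfun f -> bounded_mfun g ->
      (forall x, f x <= g x) -> measurable B ->
      \int[P]_w (\1_B (a w) * f (Z w)) <= \int[P]_w (\1_B (a w) * g (Z w)).
    move=> mZ bf bg fg mB; have bB := bounded_mfun_indic_comp ma mB.
    apply: le_bRintegral.
    - exact: bounded_mfunM bB (bounded_mfun_comp mZ bf).
    - exact: bounded_mfunM bB (bounded_mfun_comp mZ bg).
    - by move=> w; rewrite ler_wpM2l.
  have U0 := Cge0 true; have V0 := Cge0 false.
  have {}U0 := U0 (fun B mB BC => le_trans (u0 B mB BC)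
    (mono _ _ X u u' B mX bu bu' (fun x => proj1 (andP (uu' x))) mB)).
  have {}V0 := V0 (fun B mB BC => le_trans (v0 B mB BC)
    (mono _ _ Y v v' B mY bv bv' (fun x => proj1 (andP (vv' x))) mB)).
  have := HGc cc C mC.
  under eq_Rintegral do rewrite big_bool; under [in RHS]eq_Rintegral do rewrite big_bool.
  move=> ->; apply: Rintegral_ae_ge0.
    have bS b : bounded_mfun (fun w => \sum_j cc b j * G b j (a w)).
      apply: bounded_mfun_sum => j; apply: bounded_mfunM (bounded_mfun_cst _ _) _.
      exact (bounded_mfun_comp ma (is_cprob_bounded (HG b j))).
    by case: (bounded_mfunM bC (bounded_mfunM (bS true) (bS false))).
  move: U0 V0; apply: filterS2 => w Uw Vw; rewrite indicE.
  have [|] := boolP (_ \in _); last by rewrite mul0r.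
  by rewrite inE mul1r => Cw; rewrite mulr_ge0 ?Uw ?Vw.
have [u_ Hu] := choice H; have [v_ Hv] := choice Hu.
have small n : n.+1%:R^-1 <= 1 :> R by rewrite invf_le1 // ler1n.
have squeeze (w_ : nat -> R) w : (forall n, w <= w_ n <= w + n.+1%:R^-1) ->
    w_ n @[n --> \oo] --> w.
  move=> hw; apply: (@squeeze_cvgr _ _ _ _ (fun=> w) (fun n => w + n.+1%:R^-1)).
  - exact: nearW.
  - exact: cvg_cst.
  - rewrite -[X in _ --> X]addr0; apply: cvgD; first exact: cvg_cst.
    exact: cvg_harmonic.
apply: (@bRintegral_nneg_lim _ _ _ P
  (fun n w => \1_C (a w) * (u_ n (X w) * v_ n (Y w))) _ ((Mu + 1) * (Mv + 1))).
- move=> n; have [bu' bv' _ _ _] := Hv n.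
  by case: (bounded_mfunM bC (bounded_mfunM (bounded_mfun_comp mX bu') (bounded_mfun_comp mY bv'))).
- by case: (bounded_mfunM bC (bounded_mfunM (bounded_mfun_comp mX bu) (bounded_mfun_comp mY bv))).
- apply: aeW => w n; have [_ _ /(_ (X w)) hu /(_ (Y w)) hv _] := Hv n.
  have huM := uM (X w); have hvM := vM (Y w); rewrite ler_norml in huM; rewrite ler_norml in hvM.
  have s := small n; set e := n.+1%:R^-1 in hu hv s.
  have e0 : 0 <= e by rewrite invr_ge0.
  clearbody e.
  have h1 : `|u_ n (X w)| <= Mu + 1 by rewrite ler_norml; lra.
  have h2 : `|v_ n (Y w)| <= Mv + 1 by rewrite ler_norml; lra.
  have h3 : `|\1_C (a w) : R| <= 1.
    by rewrite indicE; case: (_ \in _); rewrite ?normr1 ?normr0.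
  by rewrite normrM normrM -[leRHS]mul1r ler_pM// ler_pM.
- apply: aeW => w; apply: cvgM; first exact: cvg_cst.
  by apply: cvgM; apply: squeeze => n; case: (Hv n).
- by move=> n; case: (Hv n).
Qed.

End conditional_positivity.

(** * Product laws *)

Section fubini_bounded.
Context d1 d2 (T1 : measurableType d1) (T2 : measurableType d2) (R : realType).
Variables (P1 : probability T1 R) (P2 : probability T2 R).

Lemma bounded_mfun_section (f : T1 * T2 -> R) : bounded_mfun f ->
  bounded_mfun (fun x => \int[P2]_y f (x, y)).
Proof.
move=> bf; have bfx x : bounded_mfun (fun y => f (x, y)).
  exact: (bounded_mfun_comp (measurable_pair1 x) bf).
have [mf [M fM]] := bf; split; last first.
  by exists M => x; apply: Rintegral_le_norm.
have := measurable_fubini_F (bounded_mfun_integrable (P1 \x P2)%E bf).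
rewrite /fubini_F => h.
have : measurable_fun setT (fine \o (fun x => \int[P2]_y (EFin \o f) (x, y))%E).
  exact: measurableT_comp.
exact: eq_measurable_fun.
Qed.

Lemma bounded_fubini (f : T1 * T2 -> R) : bounded_mfun f ->
  \int[(P1 \x P2)%E]_z f z = \int[P1]_x \int[P2]_y f (x, y).
Proof.
move=> bf; have bfx x : bounded_mfun (fun y => f (x, y)).
  exact: (bounded_mfun_comp (measurable_pair1 x) bf).
rewrite /Rintegral.
have <- := integral12_prod_meas1 (bounded_mfun_integrable (P1 \x P2)%E bf).
congr fine; apply: eq_integral => x _; rewrite /fubini_F.
exact: EFin_Rintegral.
Qed.

Lemma bounded_fubiniM (f : T1 -> R) (g : T2 -> R) :
  bounded_mfun f -> bounded_mfun g ->
  \int[(P1 \x P2)%E]_z (f z.1 * g z.2) = \int[P1]_x f x * \int[P2]_y g y.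
Proof.
move=> bf bg; rewrite bounded_fubini/=; last first.
  exact: bounded_mfunM (bounded_mfun_comp measurable_fst bf)
    (bounded_mfun_comp measurable_snd bg).
under eq_Rintegral do rewrite bRintegralZ//.
under eq_Rintegral do rewrite mulrC.
by rewrite bRintegralZ// mulrC.
Qed.

End fubini_bounded.

Lemma bounded_transfer d1 d2 (T1 : measurableType d1) (T2 : measurableType d2)
    (R : realType) (P : probability T1 R) (X : {RV P >-> T2}) (f : T2 -> R) :
  bounded_mfun f -> \int[distribution P X]_y f y = \int[P]_x f (X x).
Proof.
move=> bf; rewrite /Rintegral; congr fine.
rewrite (@integral_distribution _ _ _ _ _ P X (EFin \o f))//.
  by apply/measurable_EFinP; case: bf.
apply: bounded_mfun_integrable; exact: (bounded_mfun_comp _ bf).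
Qed.

Lemma bounded_mfun_tnth d (T : measurableType d) (R : realType) n (i : 'I_n)
    (f : T -> R) : bounded_mfun f ->
  bounded_mfun (fun t : n.-tuple T => f (tnth t i)).
Proof. by move=> bf; apply: (bounded_mfun_comp (measurable_tnth i) bf). Qed.

Lemma prob_power_prod d (T : measurableType d) (R : realType)
    (pi : probability T R) (n : nat) (F : 'I_n -> T -> R) :
  (forall i, bounded_mfun (F i)) ->
  \int[prob_power pi n]_t (\prod_i F i (tnth t i)) = \prod_i \int[pi]_x F i x.
Proof.
elim: n F => [|n IHn] F bF.
  under eq_Rintegral do rewrite big_ord0.
  by rewrite big_ord0 Rintegral_prob_cst.
have bp m (G : 'I_m -> T -> R) : (forall i, bounded_mfun (G i)) ->
    bounded_mfun (fun t : m.-tuple T => \prod_i G i (tnth t i)).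
  by move=> bG; apply: bounded_mfun_prod => i; exact: bounded_mfun_tnth.
rewrite /= bounded_transfer; last exact: bp.
under eq_Rintegral => x _.
  rewrite big_ord_recl /=.
  rewrite (_ : tnth (tuple_cons x) ord0 = x.1) ?tnth0//.
  under eq_bigr do rewrite tnthS.
  over.
rewrite /= big_ord_recl -IHn => [|i]; last exact: bF.
exact: (bounded_fubiniM pi (prob_power pi n) (bF ord0)
  (bp n (fun i => F (lift ord0 i)) (fun i => bF _))).
Qed.

Lemma measure_ord_setT (R : realType) (n : nat)
    (mu : {measure set 'I_n.+1 -> \bar R}) :
  mu setT = (\sum_z mu [set z])%E.
Proof.
rewrite -(@measure_bigsetU_ord _ _ _ mu n.+1 xpredT (fun z => [set z]))//.
  congr (mu _); apply/seteqP; split => // x _.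
  by rewrite (bigD1 x)//=; left.
by move=> i j _ _ [x [/= <- <-]].
Qed.

Lemma uniform_ord_mass (R : realType) (k : nat) (h : 'I_k.+1) :
  uniform_ord R k [set h] = (k.+1%:R^-1)%:E.
Proof.
have c1 (i : 'I_k.+1) : @counting 'I_k.+1 R [set i] = 1%E.
  by rewrite /counting asboolT// fset_set1 finmap.cardfs1.
have cT : @counting 'I_k.+1 R setT = k.+1%:R%:E.
  rewrite measure_ord_setT/=; under eq_bigr do rewrite c1.
  by rewrite sumEFin sumr_const card_ord.
rewrite /uniform_ord /= /mnormalize /= cT eqe pnatr_eq0 /=.
by rewrite c1 mul1e.
Qed.

Lemma Rintegral_uniform_ord (R : realType) (k : nat) (f : 'I_k.+1 -> R) :
  \int[uniform_ord R k]_h f h = k.+1%:R^-1 * \sum_h f h.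
Proof.
have fE h : f h = \sum_i f i * \1_[set i] h.
  rewrite (bigD1 h)//= big1 ?addr0 => [|i ih].
    by rewrite indicE mem_set// mulr1.
  by rewrite indicE memNset ?mulr0//= => hi; rewrite hi eqxx in ih.
have bi i : bounded_mfun (\1_[set i] : 'I_k.+1 -> R) by exact: bounded_mfun_indic.
under eq_Rintegral do rewrite fE.
rewrite bRintegral_sum => [|i]; last exact: bounded_mfunM (bounded_mfun_cst _ _) (bi i).
rewrite mulr_sumr; apply: eq_bigr => i _.
rewrite bRintegralZ// mulrC; congr (_ * _).
rewrite /Rintegral integral_indic// setIT.
exact: (congr1 fine (uniform_ord_mass R i)).
Qed.

Lemma bounded_mfun_ord (R : realType) (k : nat) (f : 'I_k.+1 -> R) : bounded_mfun f.
Proof.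
split => //; exists (\sum_h `|f h|) => h.
by rewrite (bigD1 h)//= lerDl sumr_ge0.
Qed.

Section spin_laws.
Context (R : realType) (q : nat).
Implicit Types gam : spin_law R q.

Lemma spin_pmf_ge0 gam z : 0 <= pmf gam z.
Proof. by rewrite /pmf fine_ge0. Qed.

Lemma EFin_pmf gam z : (pmf gam z)%:E = gam [set z].
Proof. by rewrite /pmf fineK// fin_num_measure. Qed.

Lemma spin_pmf_le1 gam z : pmf gam z <= 1.
Proof. by rewrite -lee_fin EFin_pmf probability_le1. Qed.

Lemma sum_pmf gam : \sum_z pmf gam z = 1.
Proof.
apply/EFin_inj; rewrite -sumEFin; under eq_bigr do rewrite EFin_pmf.
by rewrite -(probability_setT gam) measure_ord_setT.
Qed.

Lemma bounded_mfun_pmf z : bounded_mfun (fun gam : spin_law R q => pmf gam z).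
Proof.
split; last first.
  by exists 1 => gam; rewrite ger0_norm ?spin_pmf_ge0// spin_pmf_le1.
have mk : measurable_fun setT (fun gam : spin_law R q => gam [set z]).
  have := @measurable_kernel _ _ _ _ R (kprobability (@measurable_id _ (spin_law R q) setT)) [set z].
  exact.
have : measurable_fun setT (fine \o (fun gam : spin_law R q => gam [set z])).
  exact: measurableT_comp.
exact.
Qed.

End spin_laws.

(** * Moments of the replica integral *)

Section moments.
Context (R : realType) (q k : nat).
Implicit Types (gam : spin_law R q) (Delta psi : weight_space R q k).

(** All three terms of [nabla] thus become [Zf] at families that select, for each index, an entry of
    one of the two tuples: always the first, always the second, or the first at [h] only. *)
Lemma Zfm_Zf psi h (g g' : 'I_k.+1 -> spin_law R q) :
  Zfm psi h g g' = Zf psi (fun h' => if h' == h then g h' else g' h').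
Proof.
apply: eq_bigr => tau _; rewrite -mulrA; congr (_ * _).
rewrite [RHS](bigD1 h)//= eqxx; congr (_ * _).
by apply: eq_bigr => h' /negPf ->.
Qed.

Lemma sum_prod_pmf (g : 'I_k.+1 -> spin_law R q) :
  \sum_(tau : config q k) \prod_h pmf (g h) (tau h) = 1.
Proof.
rewrite -(bigA_distr_bigA (fun h z => pmf (g h) z)) big1// => h _.
exact: sum_pmf.
Qed.

Lemma Zf_affine (a b : R) Delta psi (g : 'I_k.+1 -> spin_law R q) :
  (forall tau, psi tau = a * (1 - b * Delta tau)) ->
  Zf psi g = a * (1 - b * Zf Delta g).
Proof.
move=> psiE; rewrite -{1}(sum_prod_pmf g) /Zf mulr_sumr -sumrB mulr_sumr.
by apply: eq_bigr => tau _; rewrite psiE; ring.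
Qed.

Lemma norm_Zf_le (M : R) Delta (g : 'I_k.+1 -> spin_law R q) :
  (forall tau, `|Delta tau| <= M) -> `|Zf Delta g| <= M.
Proof.
move=> DM; rewrite (le_trans (ler_norm_sum _ _ _))//.
apply: (@le_trans _ _ (\sum_(tau : config q k) M * \prod_h pmf (g h) (tau h))).
  apply: ler_sum => tau _.
  have p0 : 0 <= \prod_h pmf (g h) (tau h) by apply: prodr_ge0 => h _; exact: spin_pmf_ge0.
  by rewrite normrM [X in _ * X]ger0_norm// ler_wpM2r.
by rewrite -mulr_sumr sum_prod_pmf mulr1.
Qed.

(** The probability that [l] independent spins of law [gam] spell the word [s]; [word_moment] is the
    exchangeable law of words obtained by mixing over [pi]. *)
Definition word_weight l gam (s : {ffun 'I_l -> 'I_q.+1}) : R :=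
  \prod_i pmf gam (s i).

Definition word_moment l (pi : probability (spin_law R q) R)
  (s : {ffun 'I_l -> 'I_q.+1}) : R := \int[pi]_gam word_weight gam s.

Definition column l (t : {ffun 'I_l -> config q k}) (h : 'I_k.+1) :
  {ffun 'I_l -> 'I_q.+1} := [ffun i => t i h].

(** The [nabla] functional of [x^l], written as a homogeneous polynomial in the entries of [Delta].
    Bounds, measurability and continuity in [Delta] are then immediate, and the integral over the
    replicas is hidden in fixed coefficients. *)
Definition moment l (pi1 pi2 : probability (spin_law R q) R) Delta : R :=
  \sum_(t : {ffun 'I_l -> config q k}) (\prod_i Delta (t i)) *
    pair_defect (fun h => word_moment pi1 (column t h))
                (fun h => word_moment pi2 (column t h)).

Lemma bounded_mfun_word_weight l (s : {ffun 'I_l -> 'I_q.+1}) :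
  bounded_mfun (fun gam => word_weight gam s).
Proof. by apply: bounded_mfun_prod => i; exact: bounded_mfun_pmf. Qed.

Lemma word_weight_ge0 l gam (s : {ffun 'I_l -> 'I_q.+1}) : 0 <= word_weight gam s.
Proof. by apply: prodr_ge0 => i _; exact: spin_pmf_ge0. Qed.

Lemma word_moment_ge0 l pi (s : {ffun 'I_l -> 'I_q.+1}) : 0 <= word_moment pi s.
Proof. by apply: Rintegral_ge0 => gam _; exact: word_weight_ge0. Qed.

Lemma Zf_exp l Delta (g : 'I_k.+1 -> spin_law R q) :
  Zf Delta g ^+ l = \sum_(t : {ffun 'I_l -> config q k}) (\prod_i Delta (t i)) *
    \prod_h word_weight (g h) (column t h).
Proof.
rewrite -[in LHS](card_ord l) -prodr_const bigA_distr_bigA.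
apply: eq_bigr => t _; rewrite big_split exchange_big; congr (_ * _).
by apply: eq_bigr => h _; apply: eq_bigr => i _; rewrite ffunE.
Qed.

Section nabla_integral.
Variables pi1 pi2 : probability (spin_law R q) R.

Local Notation pairs := ((prob_power pi1 k.+1 \x prob_power pi2 k.+1)%E).
Local Notation omega := ('I_k.+1 * (k.+1.-tuple (spin_law R q) * k.+1.-tuple (spin_law R q)))%type.

Definition replica_law : probability omega R :=
  (uniform_ord R k \x (prob_power pi1 k.+1 \x prob_power pi2 k.+1))%E.

Local Notation mu := replica_law.

(* The integrand of [nabla], with Lambda replaced by G and psi fixed. *)
Definition nabla_int (G : R -> R) Delta (w : omega) : R :=
  G (Zf Delta (tnth w.2.1)) + k%:R * G (Zf Delta (tnth w.2.2)) -
  k.+1%:R * G (Zfm Delta w.1 (tnth w.2.1) (tnth w.2.2)).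

Lemma pairs_prod (sel : pred 'I_k.+1) (F : 'I_k.+1 -> spin_law R q -> R) :
  (forall h, bounded_mfun (F h)) ->
  \int[pairs]_z (\prod_h (if sel h then F h (tnth z.1 h) else F h (tnth z.2 h))) =
  \prod_h (if sel h then \int[pi1]_gam F h gam else \int[pi2]_gam F h gam).
Proof.
move=> bF; pose F1 h gam := if sel h then F h gam else 1.
pose F2 h gam := if sel h then 1 else F h gam.
have b1 h : bounded_mfun (F1 h) by rewrite /F1; case: (sel h) => //; exact: bounded_mfun_cst.
have b2 h : bounded_mfun (F2 h) by rewrite /F2; case: (sel h) => //; exact: bounded_mfun_cst.
have bp (G : 'I_k.+1 -> spin_law R q -> R) : (forall h, bounded_mfun (G h)) ->
    bounded_mfun (fun t : k.+1.-tuple (spin_law R q) => \prod_h G h (tnth t h)).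
  by move=> bG; apply: bounded_mfun_prod => h; exact: bounded_mfun_tnth.
transitivity (\int[pairs]_z ((\prod_h F1 h (tnth z.1 h)) * (\prod_h F2 h (tnth z.2 h)))).
  apply: eq_Rintegral => z _; rewrite -big_split; apply: eq_bigr => h _ /=.
  by rewrite /F1 /F2; case: (sel h); rewrite ?mulr1 ?mul1r.
rewrite (bounded_fubiniM (prob_power pi1 k.+1) (prob_power pi2 k.+1) (bp _ b1) (bp _ b2)).
rewrite !prob_power_prod// -big_split; apply: eq_bigr => h _ /=.
by rewrite /F1 /F2; case: (sel h); rewrite Rintegral_prob_cst ?mulr1 ?mul1r.
Qed.

Lemma bounded_mfun_Zf_power l Delta (sel : 'I_k.+1 -> pred 'I_k.+1) :
  bounded_mfun (fun w : omega =>
    Zf Delta (fun h => if sel w.1 h then tnth w.2.1 h else tnth w.2.2 h) ^+ l).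
Proof.
apply: bounded_mfunX; apply: bounded_mfun_sum => tau.
apply: bounded_mfunM (bounded_mfun_cst _ _) _; apply: bounded_mfun_prod => h.
have b1 : bounded_mfun (fun w : omega => pmf (tnth w.2.1 h) (tau h)).
  apply: (@bounded_mfun_comp _ _ _ _ _ (fun w : omega => w.2.1)
    (fun t => pmf (tnth t h) (tau h))).
    exact: (measurableT_comp measurable_fst measurable_snd).
  exact (bounded_mfun_tnth h (@bounded_mfun_pmf R q (tau h))).
have b2 : bounded_mfun (fun w : omega => pmf (tnth w.2.2 h) (tau h)).
  apply: (@bounded_mfun_comp _ _ _ _ _ (fun w : omega => w.2.2)
    (fun t => pmf (tnth t h) (tau h))).
    exact: (measurableT_comp measurable_snd measurable_snd).
  exact (bounded_mfun_tnth h (@bounded_mfun_pmf R q (tau h))).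
(* The selection is written as [s x + (1 - s) y] with [s] in {0, 1}, so that closure under sums and
   products applies. *)
have bs : bounded_mfun (fun w : omega => (sel w.1 h)%:R : R).
  exact (bounded_mfun_comp measurable_fst
    (bounded_mfun_ord (fun h0 => (sel h0 h)%:R))).
have := bounded_mfunD (bounded_mfunM bs b1)
  (bounded_mfunM (bounded_mfunB (bounded_mfun_cst _ 1) bs) b2).
congr bounded_mfun; apply/funext => w.
by case: (sel w.1 h); rewrite ?mul1r ?subrr ?mul0r ?addr0// add0r subr0 mul1r.
Qed.

Lemma mu_Zf_exp l Delta (sel : 'I_k.+1 -> pred 'I_k.+1) :
  \int[mu]_w (Zf Delta (fun h => if sel w.1 h then tnth w.2.1 h else tnth w.2.2 h) ^+ l) =
  k.+1%:R^-1 * \sum_h0 \sum_(t : {ffun 'I_l -> config q k}) (\prod_i Delta (t i)) *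
    \prod_h (if sel h0 h then word_moment pi1 (column t h)
             else word_moment pi2 (column t h)).
Proof.
rewrite bounded_fubini; last exact: bounded_mfun_Zf_power.
rewrite Rintegral_uniform_ord; congr (_ * _); apply: eq_bigr => h0 _ /=.
have bw (t : {ffun 'I_l -> config q k}) : bounded_mfun
    (fun z : k.+1.-tuple (spin_law R q) * k.+1.-tuple (spin_law R q) =>
      \prod_h (if sel h0 h then word_weight (tnth z.1 h) (column t h)
               else word_weight (tnth z.2 h) (column t h))).
  apply: bounded_mfun_prod => h; case: (sel h0 h).
    exact (bounded_mfun_comp measurable_fst
      (bounded_mfun_tnth h (bounded_mfun_word_weight (column t h)))).
  exact (bounded_mfun_comp measurable_snd
    (bounded_mfun_tnth h (bounded_mfun_word_weight (column t h)))).
transitivity (\int[pairs]_z (\sum_(t : {ffun 'I_l -> config q k})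
   (\prod_i Delta (t i)) *
     \prod_h (if sel h0 h then word_weight (tnth z.1 h) (column t h)
               else word_weight (tnth z.2 h) (column t h)))).
  apply: eq_Rintegral => z _; rewrite Zf_exp; apply: eq_bigr => t _; congr (_ * _).
  by apply: eq_bigr => h _; case: (sel h0 h).
rewrite bRintegral_sum => [|t]; last exact: bounded_mfunM (bounded_mfun_cst _ _) (bw t).
apply: eq_bigr => t _; rewrite bRintegralZ//; congr (_ * _).
rewrite (pairs_prod (sel h0) (F := fun h gam => word_weight gam (column t h)))//.
by move=> h; exact: bounded_mfun_word_weight.
Qed.

Let natk1_neq0 : k.+1%:R != 0 :> R. Proof. by rewrite pnatr_eq0. Qed.

Lemma bounded_mfun_nabla_int_exp l Delta :
  bounded_mfun (nabla_int (fun x => x ^+ l) Delta).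
Proof.
have b1 := bounded_mfun_Zf_power l Delta (fun _ _ => true).
have b2 := bounded_mfun_Zf_power l Delta (fun _ _ => false).
have b3 := bounded_mfun_Zf_power l Delta (fun h0 h => h == h0).
have := bounded_mfunB (bounded_mfunD b1 (bounded_mfunM (bounded_mfun_cst _ k%:R) b2))
  (bounded_mfunM (bounded_mfun_cst _ k.+1%:R) b3).
by congr bounded_mfun; apply/funext => w; rewrite /nabla_int Zfm_Zf.
Qed.

Lemma nabla_int_exp l Delta :
  \int[mu]_w nabla_int (fun x => x ^+ l) Delta w = moment l pi1 pi2 Delta.
Proof.
have b1 := bounded_mfun_Zf_power l Delta (fun _ _ => true).
have b2 := bounded_mfun_Zf_power l Delta (fun _ _ => false).
have b3 := bounded_mfun_Zf_power l Delta (fun h0 h => h == h0).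
transitivity (\int[mu]_w (Zf Delta (tnth w.2.1) ^+ l + k%:R * Zf Delta (tnth w.2.2) ^+ l -
   k.+1%:R * Zf Delta (fun h => if h == w.1 then tnth w.2.1 h else tnth w.2.2 h) ^+ l)).
  by apply: eq_Rintegral => w _; rewrite /nabla_int Zfm_Zf.
have bk2 := bounded_mfunM (bounded_mfun_cst _ k%:R) b2.
have bk3 := bounded_mfunM (bounded_mfun_cst _ k.+1%:R) b3.
rewrite (bRintegralB mu (bounded_mfunD b1 bk2) bk3) (bRintegralD mu b1 bk2).
rewrite (bRintegralZ mu k%:R b2) (bRintegralZ mu k.+1%:R b3).
rewrite (mu_Zf_exp l Delta (fun _ _ => true)) (mu_Zf_exp l Delta (fun _ _ => false)).
rewrite (mu_Zf_exp l Delta (fun h0 h => h == h0)).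
(* Averaging over the uniform index leaves the first two terms unchanged, while in the mixed term
   [1 / (k + 1)] cancels against the coefficient and leaves the sum over [h]. *)
have cst (x : R) : k.+1%:R^-1 * \sum_(h < k.+1) x = x.
  by rewrite sumr_const card_ord -[x *+ _]mulr_natl mulrA mulVf// mul1r.
rewrite /= !cst. rewrite mulrA divff// mul1r exchange_big/= mulr_sumr -big_split -sumrB.
apply: eq_bigr => t _; rewrite -mulr_sumr pair_defectE/=.
by rewrite mulrBr mulrDr; congr (_ + _ - _); rewrite mulrCA.
Qed.

Lemma moment_eq0 l Delta :
  (forall s : {ffun 'I_l -> 'I_q.+1}, word_moment pi1 s = word_moment pi2 s) ->
  moment l pi1 pi2 Delta = 0.
Proof.
move=> e; rewrite /moment big1// => t _.
rewrite (_ : (fun h => word_moment pi1 (column t h)) =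
             fun h => word_moment pi2 (column t h)) ?pair_defect_diag ?mulr0//.
by apply/funext => h; exact: e.
Qed.

Lemma word_moment_mean gam (pi : probability (spin_law R q) R)
    (s : {ffun 'I_1 -> 'I_q.+1}) : mean_laws gam pi ->
  word_moment pi s = pmf gam (s ord0).
Proof.
move=> mpi; apply/EFin_inj; rewrite EFin_pmf -(mpi (s ord0)) /word_moment.
rewrite -EFin_Rintegral; last exact: bounded_mfun_word_weight.
by apply: eq_integral => g _; rewrite /word_weight big_ord1 EFin_pmf.
Qed.

Lemma moment0 Delta : moment 0 pi1 pi2 Delta = 0.
Proof.
apply: moment_eq0 => s; rewrite /word_moment.
by under eq_Rintegral do rewrite /word_weight big_ord0;
   under [RHS]eq_Rintegral do rewrite /word_weight big_ord0; rewrite !Rintegral_prob_cst.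
Qed.

Lemma moment1 gam Delta : mean_laws gam pi1 -> mean_laws gam pi2 ->
  moment 1 pi1 pi2 Delta = 0.
Proof.
by move=> m1 m2; apply: moment_eq0 => s; rewrite (word_moment_mean _ m1) (word_moment_mean _ m2).
Qed.

(** [Lambda (a (1 - x)) = (1 - x) Lambda a + a (1 - x) ln (1 - x)]. The case [x = 1] is separate,
    since the logarithm of a product needs positive factors; there the vanishing factor [1 - x]
    annihilates the logarithms. *)
Lemma Lambda_taylor (a x : R) n : 0 < a -> `|x| <= 1 ->
  `|Lambda (a * (1 - x)) - (Lambda a - (Lambda a + a) * x +
     a * \sum_(i < n) x ^+ i.+2 / (i.+1%:R * i.+2%:R))| <= a / n.+1%:R.
Proof.
move=> a0 x1.
rewrite (_ : _ - _ = a * ((1 - x) * ln (1 - x) + x -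
  \sum_(i < n) x ^+ i.+2 / (i.+1%:R * i.+2%:R))).
  by rewrite normrM gtr0_norm// ler_pM2l// xlnx_taylor.
rewrite /Lambda; have [->|xn1] := eqVneq x 1.
  by rewrite subrr mulr0 !mul0r; ring.
have x1' : 0 < 1 - x.
  by rewrite subr_gt0 lt_neqAle xn1 (le_trans (ler_norm x)).
by rewrite lnM ?posrE//; ring.
Qed.

(** The constant is the absolute sum [1 + k + (k + 1)] of the coefficients. *)
Let nabla_weights_norm (x1 y1 x2 y2 x3 y3 e : R) :
  `|x1 - y1| <= e -> `|x2 - y2| <= e -> `|x3 - y3| <= e ->
  `|x1 + k%:R * x2 - k.+1%:R * x3 - (y1 + k%:R * y2 - k.+1%:R * y3)| <=
  k.+1%:R *+ 2 * e.
Proof.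
move=> h1 h2 h3.
rewrite (_ : _ - _ = (x1 - y1) + k%:R * (x2 - y2) - k.+1%:R * (x3 - y3)); last by ring.
rewrite (le_trans (ler_normB _ _))// mulr2n mulrDl lerD//; last first.
  by rewrite normrM ger0_norm// ler_wpM2l.
rewrite (le_trans (ler_normD _ _))// -nat1r mulrDl mul1r lerD//.
by rewrite normrM ger0_norm// ler_wpM2l.
Qed.

(** The pointwise Taylor estimate of [Lambda] is integrated over the replicas. The exponents 0 and 1
    disappear by [moment0] and [moment1]; the index [i] stands for the exponent [l = i + 2], which
    turns [l (l - 1)] into [(i + 1) (i + 2)]. *)
Lemma nabla_int_taylor gam (a b : R) Delta psi n :
  mean_laws gam pi1 -> mean_laws gam pi2 -> 0 < a ->
  (forall tau, `|b * Delta tau| <= 1) ->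
  (forall tau, psi tau = a * (1 - b * Delta tau)) ->
  bounded_mfun (nabla_int (@Lambda R) psi) ->
  `|\int[mu]_w nabla_int (@Lambda R) psi w -
    a * \sum_(i < n) b ^+ i.+2 * moment i.+2 pi1 pi2 Delta / (i.+1%:R * i.+2%:R)|
  <= k.+1%:R *+ 2 * (a / n.+1%:R).
Proof.
move=> m1 m2 a0 bD psiE bpsi.
pose L x : R := Lambda a - (Lambda a + a) * b * x +
  a * \sum_(i < n) b ^+ i.+2 * x ^+ i.+2 / (i.+1%:R * i.+2%:R).
pose c i : R := a * (b ^+ i.+2 / (i.+1%:R * i.+2%:R)).
have LE w : nabla_int L Delta w =
  Lambda a * nabla_int (fun x => x ^+ 0) Delta w -
  (Lambda a + a) * b * nabla_int (fun x => x ^+ 1) Delta w +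
  \sum_(i < n) c i * nabla_int (fun x => x ^+ i.+2) Delta w.
  have e x : L x = Lambda a * x ^+ 0 - (Lambda a + a) * b * x ^+ 1 +
      \sum_(i < n) c i * x ^+ i.+2.
    rewrite /L expr0 mulr1 expr1 mulr_sumr; congr (_ + _).
    by apply: eq_bigr => i _; rewrite /c; ring.
  pose S y := \sum_(i < n) c i * y ^+ i.+2.
  have -> : \sum_(i < n) c i * nabla_int (fun x => x ^+ i.+2) Delta w =
      nabla_int S Delta w.
    rewrite /nabla_int /S !mulr_sumr -big_split -sumrB; apply: eq_bigr => i _ /=.
    by ring.
  by rewrite /nabla_int !e -/(S _) -/(S _) -/(S _); ring.
have be l := bounded_mfun_nabla_int_exp l Delta.
have b0 := bounded_mfunM (bounded_mfun_cst _ (Lambda a)) (be 0%N).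
have b1 := bounded_mfunM (bounded_mfun_cst _ ((Lambda a + a) * b)) (be 1%N).
have bs : bounded_mfun (fun w => \sum_(i < n) c i * nabla_int (fun x => x ^+ i.+2) Delta w).
  by apply: bounded_mfun_sum => i; exact: bounded_mfunM (bounded_mfun_cst _ _) (be _).
have bL : bounded_mfun (nabla_int L Delta).
  have := bounded_mfunD (bounded_mfunB b0 b1) bs.
  by congr bounded_mfun; apply/funext => w; rewrite LE.
have intL : \int[mu]_w nabla_int L Delta w =
  a * \sum_(i < n) b ^+ i.+2 * moment i.+2 pi1 pi2 Delta / (i.+1%:R * i.+2%:R).
  under eq_Rintegral do rewrite LE.
  rewrite (bRintegralD mu (bounded_mfunB b0 b1) bs) (bRintegralB mu b0 b1).
  rewrite (bRintegralZ mu _ (be 0%N)) (bRintegralZ mu _ (be 1%N)).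
  rewrite !nabla_int_exp moment0 (moment1 _ m1 m2) !mulr0 subr0 add0r.
  rewrite bRintegral_sum => [|i]; last exact: bounded_mfunM (bounded_mfun_cst _ _) (be _).
  rewrite mulr_sumr; apply: eq_bigr => i _.
  by rewrite (bRintegralZ mu _ (be i.+2)) nabla_int_exp /c; ring.
rewrite -intL -bRintegralB//; apply: Rintegral_le_norm; first exact: bounded_mfunB.
move=> w.
have err (g : 'I_k.+1 -> spin_law R q) :
    `|Lambda (Zf psi g) - L (Zf Delta g)| <= a / n.+1%:R.
  have -> : L (Zf Delta g) = Lambda a - (Lambda a + a) * (b * Zf Delta g) +
     a * \sum_(i < n) (b * Zf Delta g) ^+ i.+2 / (i.+1%:R * i.+2%:R).
    by rewrite /L mulrA; congr (_ + _ * _); apply: eq_bigr => i _; rewrite exprMn.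
  rewrite (Zf_affine g psiE); apply: Lambda_taylor => //.
  have -> : b * Zf Delta g = Zf (fun tau => b * Delta tau) g.
    by rewrite /Zf mulr_sumr; apply: eq_bigr => tau _; rewrite mulrA.
  exact: norm_Zf_le.
by rewrite /nabla_int !Zfm_Zf; apply: nabla_weights_norm; exact: err.
Qed.

End nabla_integral.
End moments.

(** * Null events and weights that depend on the conditioning variable *)

Section conditional_null.
Context d (T : measurableType d) (R : realType) (P : probability T R).
Variables (a : T -> R) (ma : measurable_fun setT a).

Lemma ae_indic_eq0 (A : set T) : measurable A -> \int[P]_w \1_A w = 0 ->
  {ae P, forall w, ~ A w}.
Proof.
move=> mA A0.
have := ge0_Rintegral_eq0 (bounded_mfun_indic R mA) _ A0.
have h0 x : 0 <= \1_A x :> R by [].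
move=> /(_ h0); apply: filterS => w /eqP + Aw.
by rewrite indicE mem_set// oner_eq0.
Qed.

(** By conditional independence P(A | a) P(B | a) = 0 almost surely, so at almost every value of [a]
    one factor vanishes. The set [S] is where the version of P(B | a) is positive. *)
Lemma cond_indep_null_split d1 d2 (T1 : measurableType d1)
    (T2 : measurableType d2) (X : T -> T1) (Y : T -> T2) (A : set T1) (B : set T2) :
  measurable_fun setT X -> measurable_fun setT Y -> cond_indep P a X Y ->
  measurable A -> measurable B ->
  {ae P, forall w, ~ (A (X w) /\ B (Y w))} ->
  exists S : set R, [/\ measurable S, {ae P, forall w, S (a w) -> ~ A (X w)} &
    {ae P, forall w, ~ S (a w) -> ~ B (Y w)}].
Proof.
move=> mX mY iXY mA mB nAB.
pose E (b : bool) (_ : unit) := if b then X @^-1` A else Y @^-1` B.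
have mXA : measurable (X @^-1` A) by rewrite -[_ @^-1` _]setTI; exact: mX.
have mYB : measurable (Y @^-1` B) by rewrite -[_ @^-1` _]setTI; exact: mY.
have mE b j : measurable (E b j) by case: b.
have iE (s : bool -> unit) : exists g : bool -> R -> R,
    (forall b, cond_prob P a (E b (s b)) (g b)) /\
    cond_prob P a (\bigcap_b E b (s b)) (fun x => \prod_b g b x).
  have [gX [gY [h1 h2 h3]]] := iXY A B mA mB.
  exists (fun b : bool => if b then gX else gY); split; first by case.
  rewrite (_ : \bigcap_b E b (s b) = X @^-1` A `&` Y @^-1` B).
    by under eq_fun do rewrite big_bool.
  apply/seteqP; split => x; first by move=> h; split; [exact: (h true)|exact: (h false)].
  by move=> [? ?] [].
have [G [HG HGc]] := cprob_product_formula ma mE iE.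
pose G1 := G true tt; pose G2 := G false tt.
have [mG1 G1b G1i] : is_cprob P a (X @^-1` A) G1 := HG true tt.
have [mG2 G2b G2i] : is_cprob P a (Y @^-1` B) G2 := HG false tt.
have bG1 : bounded_mfun (fun w => G1 (a w)).
  exact (bounded_mfun_comp ma (is_cprob_bounded (HG true tt))).
have bG2 : bounded_mfun (fun w => G2 (a w)).
  exact (bounded_mfun_comp ma (is_cprob_bounded (HG false tt))).
have G10 w : 0 <= G1 w by case/andP: (G1b w).
have G20 w : 0 <= G2 w by case/andP: (G2b w).
have G12 : {ae P, forall w, G1 (a w) * G2 (a w) = 0}.
  apply: ge0_Rintegral_eq0 => [|w|]; first exact: bounded_mfunM.
    by rewrite mulr_ge0.
  have := HGc (fun _ _ => 1) setT measurableT.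
  have sum1 (F : bool -> unit -> R) : \prod_b \sum_j 1 * F b j = F true tt * F false tt.
    by rewrite big_bool !(big_pred1 tt) ?mul1r//; case.
  under eq_Rintegral do rewrite (sum1 (fun b j => \1_(E b j) _)).
  under [in RHS]eq_Rintegral => w _.
    rewrite (sum1 (fun b j => G b j (a w))) indicT mul1r; over.
  move=> <-.
  rewrite (@ae_eq_bRintegral _ _ _ P _ (fun=> 0)) ?Rintegral_prob_cst//.
    have bt := bounded_mfun_indic_comp ma measurableT.
    have [] // := bounded_mfunM bt (bounded_mfunM (bounded_mfun_indic R mXA) (bounded_mfun_indic R mYB)).
  apply: filterS nAB => w /not_andP nw; rewrite !indicE.
  case: nw => nw; first by rewrite (@memNset _ (E true tt) w nw) mul0r mulr0.
  by rewrite (@memNset _ (E false tt) w nw) !mulr0.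
pose S := [set x | 0 < G2 x].
have mS : measurable S.
  have := mG2 measurableT _ (measurable_itv `]0, +oo[).
  by rewrite setTI; congr measurable; apply/seteqP; split => x /=; rewrite in_itv/= andbT.
have null (V : set R) (F : set T) (g : R -> R) : measurable V -> measurable F ->
    is_cprob P a F g -> {ae P, forall w, \1_V (a w) * g (a w) = 0} ->
    {ae P, forall w, V (a w) -> ~ F w}.
  move=> mV mF cg Vg0.
  have maV : measurable (a @^-1` V) by rewrite -[_ @^-1` _]setTI; exact: ma.
  have : {ae P, forall w, ~ (a @^-1` V `&` F) w}.
    apply: ae_indic_eq0; first exact: measurableI.
    under eq_Rintegral do rewrite indicI.
    have [mg _ /(_ V mV) e] := cg.
    apply: etrans e _; rewrite -(Rintegral_prob_cst P 0); apply: ae_eq_bRintegral => //.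
    have [] // := bounded_mfunM (bounded_mfun_indic_comp ma mV)
      (bounded_mfun_comp ma (is_cprob_bounded cg)).
  by apply: filterS => w nw Vw Fw; apply: nw.
exists S; split => //.
- apply: (null S _ G1 mS mXA (HG true tt)).
  apply: filterS G12 => w /eqP; rewrite mulf_eq0 => /orP[/eqP ->|/eqP G0]; first by rewrite mulr0.
  by rewrite indicE memNset ?mul0r// /S/= G0 ltxx.
- apply: (null (~` S) _ G2 (measurableC mS) mYB (HG false tt)).
  apply: aeW => w; rewrite indicE; have [|] := boolP (_ \in _); last by rewrite mul0r.
  rewrite inE /S/= => /negP; rewrite -leNgt => G0.
  by rewrite mul1r; apply/eqP; rewrite eq_le G0 G20.
Qed.

(** The level sets of a step function below [phi] cut [C] into Borel pieces, to each of which the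
    hypothesis applies. *)
Lemma integral_weight_ge0 (W : T -> R) (phi : R -> R) (K : R) (C : set R) :
  bounded_mfun W -> measurable_fun setT phi -> (forall x, 0 <= phi x <= K) ->
  measurable C ->
  (forall B : set R, measurable B -> B `<=` C -> 0 <= \int[P]_w (\1_B (a w) * W w)) ->
  0 <= \int[P]_w (\1_C (a w) * (phi (a w) * W w)).
Proof.
move=> bW mphi phib mC W0; have [mW [M WM]] := bW.
have bC := bounded_mfun_indic_comp ma mC.
have K0 : 0 <= K by case/andP: (phib 0) => /le_trans; apply.
have H n : exists phi' : R -> R, [/\ measurable_fun setT phi',
    forall x, 0 <= phi' x <= K, forall x, phi x - n.+1%:R^-1 <= phi' x <= phi x &
    0 <= \int[P]_w (\1_C (a w) * (phi' (a w) * W w))].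
  have [N [c [S [mS c0 Sb]]]] := step_approx n mphi phib.
  exists (fun x => \sum_i c i * \1_(S i) x); split.
  - have [] // : bounded_mfun (fun x => \sum_i c i * \1_(S i) x : R).
    apply: bounded_mfun_sum => i; apply: bounded_mfunM (bounded_mfun_cst _ _) _.
    exact: bounded_mfun_indic.
  - move=> x; have /= [-> /andP[h _]] := Sb x; rewrite (le_trans h)//.
    by case/andP: (phib x).
  - by move=> x; have /= [_ /andP[-> h]] := Sb x; rewrite lerBlDr h.
  have e w : \1_C (a w) * ((\sum_i c i * \1_(S i) (a w)) * W w) =
      \sum_i c i * (\1_(C `&` S i) (a w) * W w).
    rewrite mulr_suml mulr_sumr; apply: eq_bigr => i _.
    by rewrite indicI /=; ring.
  under eq_Rintegral do rewrite e.
  have bi i : bounded_mfun (fun w => \1_(C `&` S i) (a w) * W w).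
    apply: bounded_mfunM bW; apply: bounded_mfun_indic_comp => //.
    exact: measurableI.
  rewrite bRintegral_sum => [|i]; last exact: bounded_mfunM (bounded_mfun_cst _ _) (bi i).
  apply: sumr_ge0 => i _; rewrite bRintegralZ// mulr_ge0// W0//.
  exact: measurableI.
have [phi_ Hphi] := choice H.
apply: (@bRintegral_nneg_lim _ _ _ P (fun n w => \1_C (a w) * (phi_ n (a w) * W w)) _ (K * M)).
- move=> n; have [m _ _ _] := Hphi n; apply: measurable_funM; first by case: bC.
  by apply: measurable_funM => //; exact: measurableT_comp.
- apply: measurable_funM; first by case: bC.
  by apply: measurable_funM => //; exact: measurableT_comp.
- apply: aeW => w n; have [_ /(_ (a w))/andP[h1 h2] _ _] := Hphi n.
  have h3 : `|\1_C (a w) : R| <= 1.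
    by rewrite indicE; case: (_ \in _); rewrite ?normr1 ?normr0.
  by rewrite normrM normrM -[leRHS]mul1r ler_pM// ler_pM// ger0_norm.
- apply: aeW => w; apply: cvgM; first exact: cvg_cst.
  apply: cvgM; last exact: cvg_cst.
  apply: (@squeeze_cvgr _ _ _ _ (fun n => phi (a w) - n.+1%:R^-1) (fun=> phi (a w))).
  - by apply: nearW => n; case: (Hphi n).
  - rewrite -[X in _ --> X]subr0; apply: cvgB; first exact: cvg_cst.
    exact: cvg_harmonic.
  - exact: cvg_cst.
- by move=> n; case: (Hphi n).
Qed.

End conditional_null.

(** * Moments of sums of products *)

Section moment_theory.
Context (R : realType) (q k l : nat).
Variables pi1 pi2 : probability (spin_law R q) R.
Implicit Types Delta : weight_space R q k.

Lemma moment_bound : exists2 c : R, 0 <= c & forall (K : R) Delta,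
  (forall tau, `|Delta tau| <= K) -> `|moment l pi1 pi2 Delta| <= c * K ^+ l.
Proof.
pose p (t : {ffun 'I_l -> config q k}) :=
  pair_defect (fun h => word_moment pi1 (column t h))
              (fun h => word_moment pi2 (column t h)).
exists (\sum_t `|p t|) => [|K Delta DK]; first exact: sumr_ge0.
rewrite (le_trans (ler_norm_sum _ _ _))// mulr_suml; apply: ler_sum => t _.
rewrite normrM mulrC ler_wpM2l// normr_prod.
rewrite -[X in K ^+ X]card_ord -prodr_const.
by apply: ler_prod => i _; rewrite normr_ge0/=.
Qed.

Lemma measurable_moment d (T : measurableType d) (D : T -> weight_space R q k) :
  (forall tau, measurable_fun setT (fun w => D w tau)) ->
  measurable_fun setT (fun w => moment l pi1 pi2 (D w)).
Proof.
move=> mD; apply: measurable_sum => t; apply: measurable_funM; last exact: measurable_cst.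
by apply: measurable_prod => i _; exact: mD.
Qed.

Lemma cvg_moment (D_ : nat -> weight_space R q k) Delta :
  (forall tau, D_ n tau @[n --> \oo] --> Delta tau) ->
  moment l pi1 pi2 (D_ n) @[n --> \oo] --> moment l pi1 pi2 Delta.
Proof.
move=> cD; apply: cvg_big => [|t _]; first exact: add_continuous.
apply: cvgM; last exact: cvg_cst.
by apply: cvg_big => [|i _]; [exact: mul_continuous|exact: cD].
Qed.

(** Transposition: a list of [l] configurations is the same as one word of length [l] for each of
    the [k.+1] positions. *)
Lemma sum_columns (g : 'I_k.+1 -> {ffun 'I_l -> 'I_q.+1} -> R) :
  \sum_(t : {ffun 'I_l -> config q k}) \prod_h g h (column t h) =
  \prod_h \sum_s g h s.
Proof.
rewrite bigA_distr_bigA.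
pose tr (u : {ffun 'I_k.+1 -> {ffun 'I_l -> 'I_q.+1}}) : {ffun 'I_l -> config q k} :=
  [ffun i => [ffun h => u h i]].
have colK u h : column (tr u) h = u h by apply/ffunP => i; rewrite !ffunE.
rewrite (reindex tr) /=.
  by apply: eq_bigr => u _; apply: eq_bigr => h _; rewrite colK.
exists (fun t => [ffun h => column t h]) => [u _|t _].
  by apply/ffunP => h; rewrite ffunE colK.
by apply/ffunP => i; apply/ffunP => h; rewrite !ffunE.
Qed.

(** The average over [pi] of [prod_i sum_z phi (J i) z * pmf gam z]. These are the numbers to which
    AM-GM is applied; [J] tells which summand of [Delta] is taken in each of the [l] factors. *)
Definition profile m (pi : probability (spin_law R q) R) (J : {ffun 'I_l -> 'I_m})
    (phi : 'I_m -> 'I_q.+1 -> R) : R :=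
  \sum_(s : {ffun 'I_l -> 'I_q.+1}) (\prod_i phi (J i) (s i)) * word_moment pi s.

(** After expansion of the [l] factors over [J], every term is a product over columns, and the sum
    over lists of configurations splits into sums over words. The [h]-th entry of each defect
    depends on [phi h] alone. *)
Lemma moment_sum_prod m (phi : 'I_k.+1 -> 'I_m -> 'I_q.+1 -> R) Delta :
  (forall tau, Delta tau = \sum_j \prod_h phi h j (tau h)) ->
  moment l pi1 pi2 Delta = \sum_(J : {ffun 'I_l -> 'I_m})
    pair_defect (fun h => profile pi1 J (phi h)) (fun h => profile pi2 J (phi h)).
Proof.
move=> DE.
pose c (J : {ffun 'I_l -> 'I_m}) h (s : {ffun 'I_l -> 'I_q.+1}) :=
  \prod_i phi h (J i) (s i).
have prodD (t : {ffun 'I_l -> config q k}) :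
    \prod_i Delta (t i) = \sum_J \prod_h c J h (column t h).
  under eq_bigr do rewrite DE; rewrite bigA_distr_bigA; apply: eq_bigr => J _.
  rewrite exchange_big; apply: eq_bigr => h _; apply: eq_bigr => i _.
  by rewrite ffunE.
rewrite /moment; under eq_bigr do rewrite prodD mulr_suml.
rewrite exchange_big; apply: eq_bigr => J _ /=.
have dist (x : 'I_k.+1 -> {ffun 'I_l -> 'I_q.+1} -> R) :
    \sum_(t : {ffun 'I_l -> config q k})
      (\prod_h c J h (column t h)) * \prod_h x h (column t h) =
    \prod_h \sum_s c J h s * x h s.
  by rewrite -sum_columns; apply: eq_bigr => t _; rewrite -big_split.
under eq_bigr do rewrite pair_defectE mulrBr mulrDr mulrCA mulr_sumr.
rewrite pair_defectE sumrB big_split/= -mulr_sumr; congr (_ + _ * _ - _).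
- exact: (dist (fun=> word_moment pi1)).
- exact: (dist (fun=> word_moment pi2)).
rewrite exchange_big; apply: eq_bigr => h0 _ /=.
transitivity (\sum_(t : {ffun 'I_l -> config q k})
    (\prod_h c J h (column t h)) *
    \prod_h (if h == h0 then word_moment pi1 else word_moment pi2) (column t h)).
  by apply: eq_bigr => t _; congr (_ * _); apply: eq_bigr => h _; case: eqP.
rewrite (dist (fun h => if h == h0 then word_moment pi1 (l := l) else word_moment pi2 (l := l))).
by apply: eq_bigr => h _; case: eqP.
Qed.

Lemma profile_ge0 m pi (J : {ffun 'I_l -> 'I_m}) phi :
  (forall j z, 0 <= phi j z) -> 0 <= profile pi J phi.
Proof.
move=> phi0; apply: sumr_ge0 => s _; rewrite mulr_ge0 ?word_moment_ge0//.
exact: prodr_ge0.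
Qed.

(** With a single summand all [l] factors coincide, so the profile is the mean of an even power. *)
Lemma profile_even_ge0 pi (J : {ffun 'I_l -> 'I_1}) phi :
  ~~ odd l -> 0 <= profile pi J phi.
Proof.
move=> el; have -> : profile pi J phi =
    \int[pi]_gam (\sum_z phi ord0 z * pmf gam z) ^+ l.
  rewrite -[in RHS](card_ord l); under [RHS]eq_Rintegral => gam _.
    rewrite -prodr_const bigA_distr_bigA.
    under eq_bigr do rewrite big_split/=.
    over.
  rewrite bRintegral_sum => [|s]; last first.
    exact (bounded_mfunM (bounded_mfun_cst _ _) (bounded_mfun_word_weight R s)).
  apply: eq_bigr => s _; rewrite bRintegralZ; last exact: bounded_mfun_word_weight.
  by congr (_ * _); apply: eq_bigr => i _; rewrite (ord1 (J i)).
by apply: Rintegral_ge0 => gam _; rewrite exprn_even_ge0.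
Qed.

Section moment_integral.
Context d (T : measurableType d) (P : probability T R).
Variables (a : T -> R) (ma : measurable_fun setT a).

Lemma moment_integral_lim (D_ : nat -> T -> weight_space R q k)
    (D : T -> weight_space R q k) (B : set R) (K : R) :
  (forall n tau, measurable_fun setT (fun w => D_ n w tau)) ->
  (forall tau, measurable_fun setT (fun w => D w tau)) ->
  {ae P, forall w, B (a w) -> forall n tau, `|D_ n w tau| <= K} ->
  {ae P, forall w, B (a w) -> forall tau, D_ n w tau @[n --> \oo] --> D w tau} ->
  measurable B ->
  (forall n, 0 <= \int[P]_w (\1_B (a w) * moment l pi1 pi2 (D_ n w))) ->
  0 <= \int[P]_w (\1_B (a w) * moment l pi1 pi2 (D w)).
Proof.
move=> mD_ mD DK cD mB; have [c c0 cb] := moment_bound.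
have [m1 _] := bounded_mfun_indic_comp ma mB.
apply: (@bRintegral_nneg_lim _ _ _ P
  (fun n w => \1_B (a w) * moment l pi1 pi2 (D_ n w)) _ (c * `|K| ^+ l)).
- by move=> n; apply: measurable_funM => //; exact: measurable_moment.
- by apply: measurable_funM => //; exact: measurable_moment.
- apply: filterS DK => w DK n; rewrite indicE.
  have [|_] := boolP (_ \in _); last by rewrite mul0r normr0 mulr_ge0// exprn_ge0.
  rewrite inE mul1r => Bw; apply: cb => tau.
  by rewrite (le_trans (DK Bw n tau))// ler_norm.
- apply: filterS cD => w cD; rewrite !indicE.
  have [|_] := boolP (_ \in _); last first.
    by under eq_cvg do rewrite mul0r; rewrite mul0r; exact: cvg_cst.
  rewrite inE => Bw; apply: cvgM; first exact: cvg_cst.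
  by apply: cvg_moment => tau; exact: cD.
Qed.

(** The factors can be unbounded even where the sum of products is bounded, so each is set to 0
    where it exceeds [n] in absolute value. Truncating factor by factor keeps the i.i.d. structure
    and the signs. The hypothesis bounds the sum of absolute values because that bound, unlike one
    on the signed sum, passes to the truncations. *)
Lemma moment_integral_ge0 m d' (T' : measurableType d') (X : 'I_k.+1 -> T -> T')
    (phi : T' -> 'I_m -> 'I_q.+1 -> R) (B : set R) (K : R) :
  (forall h, measurable_fun setT (X h)) -> cond_iid P a X ->
  (forall j z, measurable_fun setT (fun x => phi x j z)) ->
  (forall x j z, 0 <= phi x j z) \/ (m = 1 /\ ~~ odd l) ->
  measurable B ->
  {ae P, forall w, B (a w) -> forall tau : config q k,
    \sum_j \prod_h `|phi (X h w) j (tau h)| <= K} ->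
  0 <= \int[P]_w (\1_B (a w) *
    moment l pi1 pi2 (fun tau => \sum_j \prod_h phi (X h w) j (tau h))).
Proof.
move=> mX iX mphi phipos mB phiK.
pose tr n (x : R) : R := if `|x| <= n%:R then x else 0.
pose phi_ n x j z := tr n (phi x j z).
have mtr n : measurable_fun setT (tr n).
  apply: measurable_fun_ifT; [|exact: measurable_id|exact: measurable_cst].
  apply: measurable_fun_ler; last exact: measurable_cst.
  exact: normr_measurable.
have trn n x : `|tr n x| <= n%:R by rewrite /tr; case: ifP => //; rewrite normr0.
have trx n x : `|tr n x| <= `|x| by rewrite /tr; case: ifP => //; rewrite normr0.
have tr0 n x : 0 <= x -> 0 <= tr n x by rewrite /tr; case: ifP.
have ctr x : tr n x @[n --> \oo] --> x.
  apply: cvg_near_cst; near=> n; rewrite /tr ifT//.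
  near: n; exact: nbhs_infty_ger.
have mphi_ n j z : measurable_fun setT (fun x => phi_ n x j z).
  exact: measurableT_comp.
pose D_ n w : weight_space R q k := fun tau => \sum_j \prod_h phi_ n (X h w) j (tau h).
apply: (@moment_integral_lim D_ _ B K) => //.
- move=> n tau; apply: measurable_sum => j; apply: measurable_prod => h _.
  exact: (measurableT_comp (mphi_ n j (tau h)) (mX h)).
- move=> tau; apply: measurable_sum => j; apply: measurable_prod => h _.
  exact: (measurableT_comp (mphi j (tau h)) (mX h)).
- apply: filterS phiK => w phiK Bw n tau.
  rewrite (le_trans _ (phiK Bw tau))// (le_trans (ler_norm_sum _ _ _))//.
  apply: ler_sum => j _; rewrite normr_prod; apply: ler_prod => h _.
  by rewrite normr_ge0 trx.
- apply: aeW => w _ tau; apply: cvg_big => [|j _]; first exact: add_continuous.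
  by apply: cvg_big => [|h _]; [exact: mul_continuous|exact: ctr].
move=> n.
have bprof pi J : bounded_mfun (fun x => profile pi J (phi_ n x)).
  apply: bounded_mfun_sum => s; apply: bounded_mfunM (bounded_mfun_cst _ _).
  apply: bounded_mfun_prod => i; split; first exact: mphi_.
  by exists n%:R => x; exact: trn.
have prof0 pi J x : 0 <= profile pi J (phi_ n x).
  case: phipos => [phi0|[m1 el]]; first by apply: profile_ge0 => j z; exact: tr0.
  by move: J; rewrite /phi_; move: phi {mphi phiK phi_ mphi_ D_ bprof}; rewrite m1 => phi J; exact: profile_even_ge0.
under eq_Rintegral => w _.
  rewrite (@moment_sum_prod m (fun h => phi_ n (X h w)))//.
  rewrite mulr_sumr; over.
rewrite bRintegral_sum => [|J].
  apply: sumr_ge0 => J _.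
  exact (cond_iid_pair_defect_ge0 ma mX iX (bprof pi1 J) (bprof pi2 J)
    (prof0 pi1 J) (prof0 pi2 J) mB).
apply: bounded_mfunM; first exact: bounded_mfun_indic_comp.
apply: bounded_mfun_pair_defect => h.
  exact (bounded_mfun_comp (mX h) (bprof pi1 J)).
exact (bounded_mfun_comp (mX h) (bprof pi2 J)).
Unshelve. all: by end_near.
Qed.

End moment_integral.
End moment_theory.

(** * Weights in a cube *)

Lemma measurable_fun_space_eval (I : Type) d (T : measurableType d) (i : I) :
  measurable_fun setT (fun f : fun_space I T => f i).
Proof.
move=> _ A mA; apply: sub_sigma_algebra; exists i => //.
by exists A.
Qed.

Lemma measurable_Lambda (R : realType) : measurable_fun setT (@Lambda R).
Proof.
apply: measurable_funM; first exact: measurable_id.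
exact: measurable_ln.
Qed.

Lemma Lambda_bound (R : realType) (lo up : R) : 0 < lo ->
  exists2 M : R, 0 <= M & forall t, lo <= t <= up -> `|Lambda t| <= M.
Proof.
move=> lo0; exists (`|up| * (`|ln lo| + `|ln up|)) => [|t /andP[lot tup]].
  by rewrite mulr_ge0// addr_ge0.
have t0 : 0 < t by exact: lt_le_trans lot.
have h1 : ln lo <= ln t by rewrite ler_ln ?posrE.
have h2 : ln t <= ln up by rewrite ler_ln ?posrE// (lt_le_trans t0).
have h3 : `|ln t| <= `|ln lo| + `|ln up|.
  rewrite ler_norml; apply/andP; split.
    rewrite lerNl (@le_trans _ _ `|ln lo|) ?lerDl//.
    by rewrite -normrN (le_trans _ (ler_norm _))// lerN2.
  rewrite (le_trans h2)// (le_trans (ler_norm _))// lerDr//.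
by rewrite /Lambda normrM ler_pM// gtr0_norm// (le_trans tup)// ler_norm.
Qed.

Section cube.
Context (R : realType) (q k : nat) (lo up : R).
Hypothesis lo0 : 0 < lo.
Local Notation omega :=
  ('I_k.+1 * (k.+1.-tuple (spin_law R q) * k.+1.-tuple (spin_law R q)))%type.
Local Notation Q := (@weight_cube R q k lo up).

Lemma measurable_weight_cube : measurable Q.
Proof.
rewrite (_ : Q = \bigcap_(tau : config q k) [set psi | lo <= psi tau <= up]); last first.
  by apply/seteqP; split => psi /= h tau => [_|]; exact: h.
apply: fin_bigcap_measurable => // tau _.
have mtau : measurable_fun setT (fun psi : weight_space R q k => psi tau).
  exact: measurable_fun_space_eval.
have := mtau measurableT _ (measurable_itv `[lo, up]).
rewrite setTI; congr measurable; apply/seteqP; split => x /=; by rewrite in_itv.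
Qed.

Lemma Zf_itv (psi : weight_space R q k) (g : 'I_k.+1 -> spin_law R q) :
  Q psi -> lo <= Zf psi g <= up.
Proof.
move=> Qpsi.
have p0 (tau : config q k) : 0 <= \prod_h pmf (g h) (tau h).
  by apply: prodr_ge0 => h _; exact: spin_pmf_ge0.
apply/andP; split.
  rewrite -[leLHS]mulr1 -(sum_prod_pmf g) mulr_sumr; apply: ler_sum => tau _.
  by rewrite ler_wpM2r//; case/andP: (Qpsi tau).
rewrite -[leRHS]mulr1 -(sum_prod_pmf g) mulr_sumr; apply: ler_sum => tau _.
by rewrite ler_wpM2r//; case/andP: (Qpsi tau).
Qed.

Let mpmf (sel : pred bool) (h : 'I_k.+1) z : measurable_fun setT
  (fun x : weight_space R q k * omega => if sel true then pmf (tnth x.2.2.1 h) z else pmf (tnth x.2.2.2 h) z).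
Proof.
have m1 : measurable_fun setT (fun x : weight_space R q k * omega => x.2.2).
  exact: (measurableT_comp measurable_snd measurable_snd).
case: (sel true).
  have [] // := bounded_mfun_comp (measurableT_comp measurable_fst m1)
    (bounded_mfun_tnth h (@bounded_mfun_pmf R q z)).
have [] // := bounded_mfun_comp (measurableT_comp measurable_snd m1)
    (bounded_mfun_tnth h (@bounded_mfun_pmf R q z)).
Qed.

Lemma measurable_Zf (sel : 'I_k.+1 -> pred 'I_k.+1) : measurable_fun setT
  (fun x : weight_space R q k * omega =>
     Zf x.1 (fun h => if sel x.2.1 h then tnth x.2.2.1 h else tnth x.2.2.2 h)).
Proof.
apply: measurable_sum => tau; apply: measurable_funM.
  exact: (measurableT_comp (measurable_fun_space_eval tau) measurable_fst).
apply: measurable_prod => h _.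
have ms : measurable_fun setT (fun x : weight_space R q k * omega => sel x.2.1 h).
  apply: (@measurableT_comp _ _ _ _ _ _ (fun h0 : 'I_k.+1 => sel h0 h)) => //.
  exact: (measurableT_comp measurable_fst measurable_snd).
have := measurable_fun_ifT ms (mpmf xpredT h (tau h)) (mpmf pred0 h (tau h)).
by congr measurable_fun; apply/funext => x; case: (sel _ _).
Qed.

Lemma measurable_nabla_int : measurable_fun setT
  (fun x : weight_space R q k * omega => nabla_int (@Lambda R) x.1 x.2).
Proof.
have mL sel := measurableT_comp (@measurable_Lambda R) (measurable_Zf sel).
have mc (c : R) (f : weight_space R q k * omega -> R) :
    measurable_fun setT f -> measurable_fun setT (fun x => c * f x).
  by move=> mf; apply: measurable_funM => //; exact: measurable_cst.
have m1 := mL (fun _ _ => true).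
have m2 := mc k%:R _ (mL (fun _ _ => false)).
have m3 := mc k.+1%:R _ (mL (fun h0 h => h == h0)).
have := measurable_funB (measurable_funD m1 m2) m3.
by congr measurable_fun; apply/funext => x; rewrite /nabla_int Zfm_Zf.
Qed.

Lemma bounded_mfun_nabla_cube : bounded_mfun
  (fun x : weight_space R q k * omega => \1_Q x.1 * nabla_int (@Lambda R) x.1 x.2).
Proof.
have [M M0 ML] := @Lambda_bound R lo up lo0.
split.
  apply: measurable_funM; last exact: measurable_nabla_int.
  exact (proj1 (bounded_mfun_comp measurable_fst (bounded_mfun_indic R measurable_weight_cube))).
exists (M + k%:R * M + k.+1%:R * M) => x.
have [Qx|nQx] := pselect (Q x.1); last first.
  by rewrite indicE memNset// mul0r normr0 !addr_ge0// mulr_ge0.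
rewrite indicE mem_set// mul1r /nabla_int Zfm_Zf.
rewrite (le_trans (ler_normB _ _))// lerD//.
  rewrite (le_trans (ler_normD _ _))// lerD//; first exact/ML/Zf_itv.
  by rewrite normrM ger0_norm// ler_wpM2l//; exact/ML/Zf_itv.
by rewrite normrM ger0_norm// ler_wpM2l//; exact/ML/Zf_itv.
Qed.

Lemma bounded_mfun_nabla_int (psi : weight_space R q k) : Q psi ->
  bounded_mfun (nabla_int (@Lambda R) psi).
Proof.
move=> Qpsi.
have := bounded_mfun_comp (measurable_pair1 psi) bounded_mfun_nabla_cube.
by congr bounded_mfun; apply/funext => w /=; rewrite indicE mem_set// mul1r.
Qed.

Variables pi1 pi2 : probability (spin_law R q) R.

(** The inner integral of [nabla] for fixed weights, set to 0 outside the cube, where [Lambda] of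
    the partition function need not be bounded. A law that gives the cube full mass does not see the
    cutoff. *)
Definition nabla_cube (psi : weight_space R q k) : R :=
  \1_Q psi * \int[replica_law k pi1 pi2]_w nabla_int (@Lambda R) psi w.

Lemma nabla_cubeE psi : nabla_cube psi =
  \int[replica_law k pi1 pi2]_w (\1_Q psi * nabla_int (@Lambda R) psi w).
Proof.
rewrite /nabla_cube; have [Qpsi|nQ] := pselect (Q psi).
  by rewrite bRintegralZ//; exact: bounded_mfun_nabla_int.
rewrite indicE memNset// mul0r; under eq_Rintegral do rewrite mul0r.
by rewrite Rintegral_prob_cst.
Qed.

Lemma bounded_mfun_nabla : bounded_mfun nabla_cube.
Proof.
(* Measurability of the section integral does not involve the law of the first coordinate; the Dirac
   mass only fills its place. *)
have := bounded_mfun_section (@dirac _ (weight_space R q k) (fun=> 0) R)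
  (replica_law k pi1 pi2) bounded_mfun_nabla_cube.
by congr bounded_mfun; apply/funext => psi; rewrite nabla_cubeE.
Qed.

End cube.

(** * Random triples *)

Section triple.
Context (R : realType) (q k : nat) (lo up : R).
Hypothesis lo0 : 0 < lo.
Local Notation Q := (@weight_cube R q k lo up).
Variables (pi1 pi2 : probability (spin_law R q) R) (gam : spin_law R q).
Hypotheses (mean1 : mean_laws gam pi1) (mean2 : mean_laws gam pi2).
Context d (T : measurableType d) (P : probability T R).
Variables (a b : T -> R) (Delta psi : T -> weight_space R q k).
Hypotheses (ma : measurable_fun setT a) (mb : measurable_fun setT b).
Hypotheses (mDelta : measurable_fun setT Delta) (mpsi : measurable_fun setT psi).
Hypothesis a_gt0 : forall w, 0 < a w.
Hypothesis bDelta_lt1 : {ae P, forall w, forall sigma, `|b w * Delta w sigma| < 1}.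
Hypothesis bDelta_indep : cond_indep P a b Delta.
Hypothesis psiE : forall w sigma, psi w sigma = a w * (1 - b w * Delta w sigma).
Hypothesis psiQ : {ae P, forall w, Q (psi w)}.

Local Notation b_bounded B K := {ae P, forall w, B (a w) -> `|b w| <= K}.
Local Notation Delta_bounded B K :=
  {ae P, forall w, B (a w) -> forall sigma, `|Delta w sigma| <= K}.

Hypothesis b_moment_ge0 : forall l (B : set R) (K : R), (2 <= l)%N -> measurable B ->
  b_bounded B K -> 0 <= \int[P]_w (\1_B (a w) * b w ^+ l).

(** The common form of the two kinds of models: for each exponent either the moments of [Delta] have
    a sign, or those of [b] vanish. Both are required only over sets of values of [a] where the
    variable in question is bounded, since otherwise the integrals may fail to exist. *)
Hypothesis Delta_moment : forall l, (2 <= l)%N ->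
  (forall (B : set R) (K : R), measurable B -> Delta_bounded B K ->
     0 <= \int[P]_w (\1_B (a w) * moment l pi1 pi2 (Delta w))) \/
  (forall (B : set R) (K : R), measurable B -> b_bounded B K ->
     \int[P]_w (\1_B (a w) * b w ^+ l) = 0).

(** Conditional independence is exploited for functions bounded on the whole space; these cutoffs
    agree with [b^l] and with the moment wherever [b] and [Delta] are bounded by [K]. *)
Let bpow l (K x : R) : R := \1_[set y : R | `|y| <= K] x * x ^+ l.
Let dmom l (K : R) (D : weight_space R q k) : R :=
  \1_[set D : weight_space R q k | forall sigma, `|D sigma| <= K] D *
  moment l pi1 pi2 D.

Let indic_le1 (U : Type) (A : set U) (x : U) : `|\1_A x : R| <= 1.
Proof. by rewrite indicE; case: (_ \in _); rewrite ?normr1 ?normr0. Qed.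

Let measurable_ball_dim (K : R) :
  measurable [set D : weight_space R q k | forall sigma, `|D sigma| <= K].
Proof.
rewrite (_ : [set D | _] = @weight_cube R q k (- K) K).
  exact: measurable_weight_cube.
by apply/seteqP; split => D h s; have := h s; rewrite ler_norml.
Qed.

Let bounded_bpow l K : bounded_mfun (bpow l K).
Proof.
have mK : measurable [set y : R | `|y| <= K].
  have := measurable_itv `[- K, K]; congr measurable.
  by apply/seteqP; split => x /=; rewrite in_itv/= ler_norml.
split.
  apply: measurable_funM; first exact: measurable_indic.
  by apply: measurable_funX; exact: measurable_id.
exists (`|K| ^+ l) => x; rewrite /bpow indicE.
have [|_] := boolP (_ \in _); last by rewrite mul0r normr0 exprn_ge0.
rewrite inE mul1r normrX => /= xK; apply: lerXn2r; rewrite ?nnegrE//.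
by rewrite (le_trans xK)// ler_norm.
Qed.

Let bounded_dmom l K : bounded_mfun (dmom l K).
Proof.
have [c c0 cb] := @moment_bound R q k l pi1 pi2.
split.
  apply: measurable_funM; first exact: measurable_indic.
  exact (@measurable_moment R q k l pi1 pi2 _ _ id
    (fun tau => measurable_fun_space_eval tau)).
exists (c * `|K| ^+ l) => D; rewrite /dmom indicE.
have [|_] := boolP (_ \in _).
  rewrite inE mul1r => /= DK; apply: cb => tau.
  by rewrite (le_trans (DK tau))// ler_norm.
by rewrite mul0r normr0 mulr_ge0// exprn_ge0.
Qed.

Let mbl l : measurable_fun setT (fun w => b w ^+ l).
Proof. exact: measurable_funX. Qed.

Let mmom l : measurable_fun setT (fun w => moment l pi1 pi2 (Delta w)).
Proof.
apply: measurable_moment => tau.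
exact: (measurableT_comp (measurable_fun_space_eval tau) mDelta).
Qed.

Let m1 (B : set R) : measurable B -> measurable_fun setT (fun w => \1_B (a w) : R).
Proof. by move=> mB; case: (bounded_mfun_indic_comp ma mB). Qed.

Let indic_cong (B : set R) (f g : T -> R) :
  measurable B -> measurable_fun setT f -> measurable_fun setT g ->
  {ae P, forall w, B (a w) -> f w = g w} ->
  \int[P]_w (\1_B (a w) * f w) = \int[P]_w (\1_B (a w) * g w).
Proof.
move=> mB mf mg fg; apply: ae_eq_bRintegral.
- by apply: measurable_funM => //; exact: m1.
- by apply: measurable_funM => //; exact: m1.
apply: filterS fg => w fg; rewrite indicE.
by have [|_] := boolP (_ \in _); [rewrite inE => /fg ->|rewrite !mul0r].
Qed.

Let mbpow l K : measurable_fun setT (fun w => bpow l K (b w)).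
Proof. by case: (bounded_mfun_comp mb (bounded_bpow l K)). Qed.

Let mdmom l K : measurable_fun setT (fun w => dmom l K (Delta w)).
Proof. by case: (bounded_mfun_comp mDelta (bounded_dmom l K)). Qed.

Let prod_integral_ge0 l (C : set R) (K : R) : (2 <= l)%N -> measurable C ->
  b_bounded C K -> Delta_bounded C K ->
  0 <= \int[P]_w (\1_C (a w) * (bpow l K (b w) * dmom l K (Delta w))).
Proof.
move=> l2 mC bK DK.
have sub B : B `<=` C -> b_bounded B K /\ Delta_bounded B K.
  by move=> BC; split; [apply: filterS bK|apply: filterS DK] => w h /BC.
have bE B : measurable B -> B `<=` C ->
    \int[P]_w (\1_B (a w) * bpow l K (b w)) = \int[P]_w (\1_B (a w) * b w ^+ l).
  move=> mB BC; have [h _] := sub B BC; apply: indic_cong => //.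
  by apply: filterS h => w h /h bw; rewrite /bpow indicE mem_set// mul1r.
have DE B : measurable B -> B `<=` C ->
    \int[P]_w (\1_B (a w) * dmom l K (Delta w)) =
    \int[P]_w (\1_B (a w) * moment l pi1 pi2 (Delta w)).
  move=> mB BC; have [_ h] := sub B BC; apply: indic_cong => //.
  by apply: filterS h => w h /h Dw; rewrite /dmom indicE mem_set// mul1r.
have b0 B : measurable B -> B `<=` C -> 0 <= \int[P]_w (\1_B (a w) * bpow l K (b w)).
  by move=> mB BC; rewrite bE//; have [h _] := sub B BC; exact: b_moment_ge0 h.
have [D0|bz] := Delta_moment l2.
  apply: (cond_indep_integral_ge0 ma mb mDelta bDelta_indep
    (bounded_bpow l K) (bounded_dmom l K) mC) => // B mB BC.
  by rewrite DE//; have [_ h] := sub B BC; exact: D0 h.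
(* In the remaining case [dmom] has no sign. Adding its bound [M] makes it nonnegative, and the
   extra contribution is [M] times the integral of [b^l], which vanishes. *)
have [_ [M DM]] := bounded_dmom l K.
have M0 : 0 <= M by rewrite (le_trans _ (DM (fun=> 0))).
have bC := bounded_mfun_indic_comp ma mC.
have bb := bounded_mfun_comp mb (bounded_bpow l K).
have bd := bounded_mfun_comp mDelta (bounded_dmom l K).
have bdM : bounded_mfun (fun D => dmom l K D + M).
  exact: bounded_mfunD (bounded_dmom l K) (bounded_mfun_cst _ _).
have : 0 <= \int[P]_w (\1_C (a w) * (bpow l K (b w) * (dmom l K (Delta w) + M))).
  apply: (cond_indep_integral_ge0 ma mb mDelta bDelta_indep
    (bounded_bpow l K) bdM mC) => // B mB BC.
  apply: Rintegral_ge0 => w _; rewrite mulr_ge0//.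
  by have := DM (Delta w); rewrite ler_norml; lra.
have e w : \1_C (a w) * (bpow l K (b w) * (dmom l K (Delta w) + M)) =
   \1_C (a w) * (bpow l K (b w) * dmom l K (Delta w)) +
   M * (\1_C (a w) * bpow l K (b w)) by ring.
under eq_Rintegral do rewrite e.
rewrite bRintegralD.
- rewrite bRintegralZ; last exact: bounded_mfunM.
  have [h _] := sub C (@subset_refl _ C).
  by rewrite bE// (bz C K)// mulr0 addr0.
- exact: bounded_mfunM bC (bounded_mfunM bb bd).
- exact: bounded_mfunM (bounded_mfun_cst _ _) (bounded_mfunM bC bb).
Qed.

(** A weight with values in [[0, K]] on the whole line that equals [a] on the set in question, where
    [0 < a <= K]. *)
Let clip (K x : R) : R := Num.min (Num.max x 0) K.

Let a_integral_ge0 l (C : set R) (K : R) : 0 <= K -> (2 <= l)%N -> measurable C ->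
  b_bounded C K -> Delta_bounded C K ->
  0 <= \int[P]_w (\1_C (a w) * (clip K (a w) * (bpow l K (b w) * dmom l K (Delta w)))).
Proof.
move=> K0 l2 mC bK DK; apply: (integral_weight_ge0 (K := K) ma) => //.
- exact: bounded_mfunM (bounded_mfun_comp mb (bounded_bpow l K))
    (bounded_mfun_comp mDelta (bounded_dmom l K)).
- apply: measurable_minr; last exact: measurable_cst.
  by apply: measurable_maxr; [exact: measurable_id|exact: measurable_cst].
- by move=> x; rewrite /clip le_min K0 le_max lexx orbT/= ge_min lexx orbT.
move=> B mB BC; apply: prod_integral_ge0 => //.
  by apply: filterS bK => w h /BC.
by apply: filterS DK => w h /BC.
Qed.

Let nab := @nabla_cube R q k lo up pi1 pi2.

Let bounded_nab : bounded_mfun (fun w => nab (psi w)).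
Proof. exact (bounded_mfun_comp mpsi (@bounded_mfun_nabla R q k lo up lo0 pi1 pi2)). Qed.

(** For each [n], the Taylor polynomial has nonnegative integral over [{a in C}] and the error is at
    most [2 (k + 1) K / (n + 1)] because [a <= K] there; then [n] tends to infinity. *)
Let nab_integral_ge0 (C : set R) (K : R) : 0 <= K -> measurable C ->
  b_bounded C K -> Delta_bounded C K -> (forall x, C x -> x <= K) ->
  0 <= \int[P]_w (\1_C (a w) * nab (psi w)).
Proof.
move=> K0 mC bK DK aK.
have bC := bounded_mfun_indic_comp ma mC.
pose c (i : nat) : R := (i.+1%:R * i.+2%:R)^-1.
pose W (i : nat) w := \1_C (a w) * (clip K (a w) * (bpow i.+2 K (b w) * dmom i.+2 K (Delta w))).
have bclip : bounded_mfun (fun w => clip K (a w)).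
  split; last first.
    exists K => w; rewrite ger0_norm /clip ?ge_min ?lexx ?orbT//.
    by rewrite le_min K0 le_max lexx orbT.
  apply: measurableT_comp => //; apply: measurable_minr; last exact: measurable_cst.
  by apply: measurable_maxr; [exact: measurable_id|exact: measurable_cst].
have bW i : bounded_mfun (W i).
  exact: bounded_mfunM bC (bounded_mfunM bclip (bounded_mfunM
    (bounded_mfun_comp mb (bounded_bpow i.+2 K))
    (bounded_mfun_comp mDelta (bounded_dmom i.+2 K)))).
have main n : - (k.+1%:R *+ 2 * K * n.+1%:R^-1) <= \int[P]_w (\1_C (a w) * nab (psi w)).
  have bS : bounded_mfun (fun w => \sum_(i < n) c i * W i w).
    by apply: bounded_mfun_sum => i; exact: bounded_mfunM (bounded_mfun_cst _ _) (bW i).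
  have bCn := bounded_mfunM bC bounded_nab.
  have S0 : 0 <= \int[P]_w (\sum_(i < n) c i * W i w).
    rewrite bRintegral_sum => [|i]; last exact: bounded_mfunM (bounded_mfun_cst _ _) (bW i).
    apply: sumr_ge0 => i _; rewrite bRintegralZ// mulr_ge0//.
      by rewrite invr_ge0 mulr_ge0.
    exact: a_integral_ge0.
  have bcst := bounded_mfun_cst T (k.+1%:R *+ 2 * K * n.+1%:R^-1).
  have : 0 <= \int[P]_w (\1_C (a w) * nab (psi w) -
      (\sum_(i < n) c i * W i w) + k.+1%:R *+ 2 * K * n.+1%:R^-1).
    apply: Rintegral_ae_ge0; first by case: (bounded_mfunD (bounded_mfunB bCn bS) bcst).
    have : {ae P, forall w, [/\ C (a w) -> `|b w| <= K,
        C (a w) -> forall sigma, `|Delta w sigma| <= K,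
        forall sigma, `|b w * Delta w sigma| < 1 & Q (psi w)]}.
      near=> w; split; near: w; [exact: bK|exact: DK|exact: bDelta_lt1|exact: psiQ].
    apply: filterS => w [bw Dw bDw Qw].
    have e0 : 0 <= k.+1%:R *+ 2 * K * n.+1%:R^-1.
      by rewrite !mulr_ge0// ?invr_ge0// mulrn_wge0.
    rewrite /W indicE; have [|_] := boolP (_ \in _); last first.
      by rewrite mul0r big1 ?subr0 ?add0r// => i _; rewrite mul0r mulr0.
    rewrite inE mul1r => Cw.
    have := @nabla_int_taylor R q k pi1 pi2 gam (a w) (b w) (Delta w) (psi w) n
      mean1 mean2 (a_gt0 w) (fun s => ltW (bDw s)) (psiE w)
      (bounded_mfun_nabla_int lo0 Qw).
    rewrite /nab /nabla_cube indicE mem_set// mul1r.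
    set N := \int[_]_w _; set S := _ * \sum_(i < n) _.
    have -> : \sum_(i < n) c i * (1 * (clip K (a w) * (bpow i.+2 K (b w) * dmom i.+2 K (Delta w)))) = S.
      rewrite /S mulr_sumr; apply: eq_bigr => i _.
      rewrite /clip max_l ?ltW// min_l; last exact: aK.
      have -> : bpow i.+2 K (b w) = b w ^+ i.+2.
        by rewrite /bpow indicE mem_set ?mul1r//; exact: bw Cw.
      have -> : dmom i.+2 K (Delta w) = moment i.+2 pi1 pi2 (Delta w).
        by rewrite /dmom indicE mem_set ?mul1r//; exact: Dw Cw.
      by rewrite /c; ring.
    have : k.+1%:R *+ 2 * (a w / n.+1%:R) <= k.+1%:R *+ 2 * K * n.+1%:R^-1 :> R.
      rewrite -mulrA ler_wpM2l// ?mulrn_wge0// ler_wpM2r ?invr_ge0//.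
      exact: aK.
    move: (_ * (a w / _)) (_ * K * _) => e1 e2.
    by rewrite ler_norml; lra.
  rewrite (bRintegralD P (bounded_mfunB bCn bS) bcst) (bRintegralB P bCn bS).
  rewrite Rintegral_prob_cst => h.
  by rewrite -subr_ge0 opprK (le_trans h)// lerD2r gerBl.
set I := \int[P]_w _ in main *.
have cv : I + k.+1%:R *+ 2 * K * n.+1%:R^-1 @[n --> \oo] --> I.
  rewrite -[X in _ --> X]addr0; apply: cvgD; first exact: cvg_cst.
  rewrite -[X in _ --> X](mulr0 (k.+1%:R *+ 2 * K)); apply: cvgM; first exact: cvg_cst.
  exact: cvg_harmonic.
rewrite -(cvg_lim _ cv)//; apply: limr_ge; first exact: cvgP cv.
by apply: nearW => n; rewrite -lerBlDr sub0r; exact: main.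
Unshelve. all: by end_near.
Qed.

(** All partition functions equal [a w], and [1 + k - (k + 1) = 0]. This covers the outcomes that no
    bounded piece of the [a]-line captures. *)
Let nab_cst w : (forall sigma, b w * Delta w sigma = 0) -> nab (psi w) = 0.
Proof.
move=> bD0.
have e (g : 'I_k.+1 -> spin_law R q) : Zf (psi w) g = a w.
  rewrite (@Zf_affine _ _ _ (a w) 0 (Delta w)) ?mul0r ?subr0 ?mulr1// => tau.
  by rewrite psiE bD0 mul0r.
rewrite /nab /nabla_cube (_ : nabla_int _ _ = fun=> 0) ?Rintegral_prob_cst ?mulr0//.
by apply/funext => x; rewrite /nabla_int Zfm_Zf !e -nat1r; ring.
Qed.

Let inv_natS_small (x : R) : (forall i, `|x| < i.+1%:R^-1) -> x = 0.
Proof.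
move=> xi; apply/eqP; rewrite -normr_le0; apply/ler_addgt0Pr => e e0; rewrite add0r.
have := truncnS_gt e^-1; set n := Num.trunc _ => en.
rewrite (le_trans (ltW (xi n)))// invf_ple ?posrE//.
exact: ltW.
Qed.

Let measurable_norm_gt (K : R) (s : bool) :
  measurable [set x : R | if s then K <= `|x| else K < `|x|].
Proof.
have := @normr_measurable R setT measurableT _
  (measurable_itv (Interval (BSide s K) +oo%O)).
rewrite setTI; congr measurable; apply/seteqP.
by case: s; split => x /=; rewrite in_itv/= andbT.
Qed.

Let measurable_norm_gt_dim (K : R) (s : bool) :
  measurable [set D : weight_space R q k |
    exists sigma, if s then K <= `|D sigma| else K < `|D sigma|].
Proof.
rewrite (_ : [set D | _] = \bigcup_(sigma : config q k)
   ((fun D : weight_space R q k => D sigma) @^-1`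
     [set x : R | if s then K <= `|x| else K < `|x|])).
  apply: fin_bigcup_measurable => // sigma _.
  rewrite -[_ @^-1` _]setTI; exact: measurable_fun_space_eval.
by apply/seteqP; split => D /= [sigma]; [move=> h; exists sigma|move=> _ h; exists sigma].
Qed.

Lemma triple_nabla_ge0 : 0 <= \int[P]_w nabla_cube lo up pi1 pi2 (psi w).
Proof.
pose bset (s : bool) (K : R) := [set x : R | if s then K <= `|x| else K < `|x|].
pose Dset (s : bool) (K : R) := [set D : weight_space R q k |
  exists sigma, if s then K <= `|D sigma| else K < `|D sigma|].
have prod_gt1 (i : nat) (x y : R) :
    (i.+1%:R < `|x| /\ i.+1%:R^-1 <= `|y|) \/ (i.+1%:R^-1 <= `|x| /\ i.+1%:R < `|y|) ->
    ~ (`|x * y| < 1).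
  have i0 : 0 < i.+1%:R :> R by [].
  case=> -[h1 h2]; apply/negP; rewrite -leNgt normrM -(divff (lt0r_neq0 i0)).
    by rewrite ler_pM// ltW.
  by rewrite mulrC ler_pM// ltW.
(* [|b| > i + 1] together with an entry [|Delta sigma| >= 1 / (i + 1)] would give
   [|b Delta sigma| >= 1], a null event. So almost surely the value of [a] decides between a bounded
   [b] and a small [Delta]; [HS'] exchanges the roles. *)
have HS i : exists S : set R, [/\ measurable S,
    {ae P, forall w, S (a w) -> ~ bset false i.+1%:R (b w)} &
    {ae P, forall w, ~ S (a w) -> ~ Dset true i.+1%:R^-1 (Delta w)}].
  apply: (cond_indep_null_split ma mb mDelta bDelta_indep
    (measurable_norm_gt _ false) (measurable_norm_gt_dim _ true)).
  apply: filterS bDelta_lt1 => w bD [/= h1 [sigma h2]].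
  by apply: (@prod_gt1 i (b w) (Delta w sigma)) => //; left.
have HS' i : exists S : set R, [/\ measurable S,
    {ae P, forall w, S (a w) -> ~ bset true i.+1%:R^-1 (b w)} &
    {ae P, forall w, ~ S (a w) -> ~ Dset false i.+1%:R (Delta w)}].
  apply: (cond_indep_null_split ma mb mDelta bDelta_indep
    (measurable_norm_gt _ true) (measurable_norm_gt_dim _ false)).
  apply: filterS bDelta_lt1 => w bD [/= h1 [sigma h2]].
  by apply: (@prod_gt1 i (b w) (Delta w sigma)) => //; right.
have [S HSS] := choice HS; have [S' HSS'] := choice HS'.
(* On [S i], |b| <= i + 1, and off [S' i], |Delta| <= i + 1; off all the [S i]
   Delta vanishes, and on all the [S' i] b vanishes. *)
pose C n := \bigcup_(i in `I_n.+1) S i `&` \bigcup_(i in `I_n.+1) ~` S' i `&`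
  [set x : R | x <= n.+1%:R].
have mC n : measurable (C n).
  apply: measurableI; last by have := measurable_itv `]-oo, n.+1%:R : R]; congr measurable;
    apply/seteqP; split => x /=; rewrite in_itv.
  apply: measurableI; apply: bigcup_measurable => i _; first by case: (HSS i).
  by apply: measurableC; case: (HSS' i).
have aeall : {ae P, forall w, forall i,
    (S i (a w) -> ~ bset false i.+1%:R (b w)) /\
    (~ S i (a w) -> ~ Dset true i.+1%:R^-1 (Delta w)) /\
    (S' i (a w) -> ~ bset true i.+1%:R^-1 (b w)) /\
    (~ S' i (a w) -> ~ Dset false i.+1%:R (Delta w))}.
  apply/ae_foralln => i; have [_ h1 h2] := HSS i; have [_ h3 h4] := HSS' i.
  near=> w; split; [|split; [|split]]; near: w; [exact: h1|exact: h2|exact: h3|exact: h4].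
have Cge0 n : 0 <= \int[P]_w (\1_(C n) (a w) * nab (psi w)).
  apply: (@nab_integral_ge0 _ n.+1%:R) => //.
  - apply: filterS aeall => w h [[[i /= iN Si] _] _].
    have [/(_ Si)/negP + _] := h i; rewrite -leNgt => /le_trans; apply.
    by rewrite ler_nat.
  - apply: filterS aeall => w h [[_ [i /= iN Si]] _] sigma.
    have [_ [_ [_ /(_ Si) hD]]] := h i.
    rewrite leNgt; apply/negP => Dn; apply: hD; exists sigma.
    by apply: le_lt_trans Dn; rewrite ler_nat.
  - by move=> x [].
have [mn [M nM]] := bounded_nab.
apply: (@bRintegral_nneg_lim _ _ _ P (fun n w => \1_(C n) (a w) * nab (psi w)) _ M) => //.
- by move=> n; apply: measurable_funM => //; exact: m1.
- apply: aeW => w n; by rewrite normrM -[leRHS]mul1r ler_pM//; exact: nM.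
apply: filterS aeall => w h.
(* The sequence is eventually constant: either [b Delta = 0] and all terms vanish, or [b] and some
   entry of [Delta] are nonzero, and then [a w] lies in [C n] for all large [n]. *)
have [bD0|] := pselect (forall sigma, b w * Delta w sigma = 0).
  rewrite (nab_cst bD0) -/nab (nab_cst bD0).
  by under eq_cvg do rewrite mulr0; exact: cvg_cst.
move=> /existsNP [sigma /eqP]; rewrite mulf_eq0 negb_or => /andP[b0 D0].
have [i Si] : exists i, S i (a w).
  apply: contrapT => /forallNP nS; move/negP: D0; apply.
  apply/eqP/inv_natS_small => i; have [_ [/(_ (nS i)) hD _]] := h i.
  by rewrite ltNge; apply/negP => Dn; apply: hD; exists sigma.
have [j Sj] : exists j, ~ S' j (a w).
  apply: contrapT => /forallNP nS; move/negP: b0; apply.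
  apply/eqP/inv_natS_small => j; have [_ [_ [hb _]]] := h j.
  by rewrite ltNge; apply/negP; apply: hb; exact: (contrapT (nS j)).
apply: cvg_near_cst; near=> n.
rewrite indicE mem_set ?mul1r//; split; first split.
- by exists i => //=; rewrite ltnS; near: n; exact: nbhs_infty_ge.
- by exists j => //=; rewrite ltnS; near: n; exact: nbhs_infty_ge.
- rewrite /= (@le_trans _ _ n%:R)//; last by rewrite ler_nat.
  by near: n; exact: nbhs_infty_ger.
Unshelve. all: by end_near.
Qed.

End triple.

(** * Valid models *)

Section cond_exp_sign.
Context d (T : measurableType d) (R : realType) (P : probability T R).
Variables (a : T -> R) (ma : measurable_fun setT a).

(** [X] need not be integrable, and [gp], [gn] may take the value [+oo]. Over [{a in B}], however,
    [X] is almost surely bounded, both parts have finite integrals, and the sign of [gp - gn]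
    compares them. The cutoff [Y] makes this bound hold everywhere. *)
Lemma cond_exp_integral (X : T -> R) (g : R -> \bar R) (B : set R) (K : R) :
  measurable_fun setT X -> cond_exp P a X g -> measurable B ->
  {ae P, forall w, B (a w) -> `|X w| <= K} ->
  ({ae P, forall w, (0 <= g (a w))%E} -> 0 <= \int[P]_w (\1_B (a w) * X w)) /\
  ({ae P, forall w, g (a w) = 0%E} -> \int[P]_w (\1_B (a w) * X w) = 0).
Proof.
move=> mX [gp [gn [[mgp gp0 gpE] [mgn gn0 gnE] _ gE]]] mB XK.
have maB : measurable (a @^-1` B) by rewrite -[_ @^-1` _]setTI; exact: ma.
have bB := bounded_mfun_indic_comp ma mB.
have [m1 _] := bB.
pose Y w := if `|X w| <= K then X w else 0.
have mY : measurable_fun setT Y.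
  apply: measurable_fun_ifT; [|exact: mX|exact: measurable_cst].
  apply: measurable_fun_ler; last exact: measurable_cst.
  exact: measurableT_comp.
have bY (s : R -> R) : measurable_fun setT s -> (forall x, `|s x| <= `|x|) ->
    bounded_mfun (fun w => \1_B (a w) * s (Y w)).
  move=> ms sx; apply: bounded_mfunM bB _; split; first exact: measurableT_comp.
  exists `|K| => w; rewrite (le_trans (sx _))// /Y.
  by case: ifP => [/le_trans|_]; [apply; exact: ler_norm|rewrite normr0].
pose pos (x : R) := Num.max x 0; pose neg (x : R) := Num.max (- x) 0.
have mpos : measurable_fun setT pos.
  by apply: measurable_maxr; [exact: measurable_id|exact: measurable_cst].
have mneg : measurable_fun setT neg.
  by apply: measurable_maxr; [exact: oppr_measurable|exact: measurable_cst].
have posx x : `|pos x| <= `|x|.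
  by rewrite /pos; case: (leP x 0); rewrite ?normr0.
have negx x : `|neg x| <= `|x|.
  by rewrite /neg; case: (leP (- x) 0); rewrite ?normr0 ?normrN.
have intE (s : R -> R) : measurable_fun setT s -> (forall x, `|s x| <= `|x|) ->
    (\int[P]_(w in a @^-1` B) (s (X w))%:E = (\int[P]_w (\1_B (a w) * s (Y w)))%R%:E)%E.
  move=> ms sx; rewrite integral_preimageE -EFin_Rintegral; last exact: bY.
  apply: ae_eq_integral => //.
  - apply/measurable_EFinP; apply: measurable_funM => //; exact: measurableT_comp.
  - apply/measurable_EFinP; apply: measurable_funM => //; exact: measurableT_comp.
  apply: filterS XK => w XK _; congr EFin; rewrite indicE.
  have [|_] := boolP (_ \in _); last by rewrite !mul0r.
  by rewrite inE => /XK Xw; rewrite /Y ifT.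
have Ip := intE pos mpos posx; have In := intE neg mneg negx.
have gpI : (\int[P]_(w in a @^-1` B) gp (a w) = (\int[P]_w (\1_B (a w) * pos (Y w)))%R%:E)%E.
  by rewrite -Ip -(gpE B mB).
have gnI : (\int[P]_(w in a @^-1` B) gn (a w) = (\int[P]_w (\1_B (a w) * neg (Y w)))%R%:E)%E.
  by rewrite -In -(gnE B mB).
have mgpa : measurable_fun (a @^-1` B) (gp \o a).
  by apply: (measurable_funS measurableT) => //; exact: measurableT_comp.
have mgna : measurable_fun (a @^-1` B) (gn \o a).
  by apply: (measurable_funS measurableT) => //; exact: measurableT_comp.
have XE : \int[P]_w (\1_B (a w) * X w) =
    \int[P]_w (\1_B (a w) * pos (Y w)) - \int[P]_w (\1_B (a w) * neg (Y w)).
  rewrite -bRintegralB; [|exact: bY|exact: bY]; apply: ae_eq_bRintegral.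
  - exact: measurable_funM.
  - by case: (bounded_mfunB (bY pos mpos posx) (bY neg mneg negx)).
  apply: filterS XK => w XK; rewrite -mulrBr indicE.
  have [|_] := boolP (_ \in _); last by rewrite !mul0r.
  rewrite inE => /XK Xw; rewrite /Y ifT// /pos /neg; congr (_ * _).
  by case: (lerP (X w) 0) => h; case: (lerP (- X w) 0) => h'; lra.
rewrite XE; split => g0.
- rewrite subr_ge0 -lee_fin -gpI -gnI.
  apply: ae_ge0_le_integral => //.
  apply: filterS g0 => w; rewrite gE => g0 _.
  move: g0 (gp0 (a w)) (gn0 (a w)).
  case: (gp (a w)) => [x| |]; case: (gn (a w)) => [y| |] //=; rewrite ?leey ?leNye//.
  by rewrite -EFinB !lee_fin subr_ge0.
- apply/eqP; rewrite subr_eq0; apply/eqP/EFin_inj; rewrite -gpI -gnI.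
  apply: ae_eq_integral => //.
  apply: filterS g0 => w; rewrite gE => g0 _.
  (* The difference is infinite as soon as one part is, so its being 0 leaves only the finite
     case. *)
  move: g0 (gp0 (a w)) (gn0 (a w)).
  case: (gp (a w)) => [x| |]; case: (gn (a w)) => [y| |] //=.
  by rewrite -EFinB => -[/eqP]; rewrite subr_eq0 => /eqP ->.
Qed.

End cond_exp_sign.

Section valid_laws.
Context (R : realType) (q k : nat) (lo up : R).
Hypothesis lo0 : 0 < lo.
Variables (pi1 pi2 : probability (spin_law R q) R) (gam : spin_law R q).
Hypotheses (mean1 : mean_laws gam pi1) (mean2 : mean_laws gam pi2).
Local Notation Q := (@weight_cube R q k lo up).

Lemma integral_law_nabla (p : probability (weight_space R q k) R)
    d (T : measurableType d) (P : probability T R) (psi : {RV P >-> weight_space R q k}) :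
  (forall A, measurable A -> p A = distribution P psi A) ->
  \int[p]_x nabla_cube lo up pi1 pi2 x = \int[P]_w nabla_cube lo up pi1 pi2 (psi w).
Proof.
move=> pE; rewrite -(bounded_transfer (P := P) psi); last exact: bounded_mfun_nabla.
by congr fine; apply: eq_measure_integral => A mA _; exact: pE.
Qed.

Lemma valid_law_cube p : (Pminus lo up `|` Pplus lo up) p -> p Q = 1%E.
Proof.
have mQ : measurable Q by exact: measurable_weight_cube.
have H d (T : measurableType d) (P : probability T R)
    (psi : {RV P >-> weight_space R q k}) :
    (forall A, measurable A -> p A = distribution P psi A) ->
    {ae P, forall w, Q (psi w)} -> p Q = 1%E.
  move=> pE psiQ; rewrite pE// /distribution /pushforward.
  have mpQ : measurable (psi @^-1` Q).
    by rewrite -[_ @^-1` _]setTI; exact: measurable_funPT.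
  have : P (~` (psi @^-1` Q)) = 0%E.
    by apply/negligibleP; [exact: measurableC|exact: psiQ].
  rewrite probability_setC// => /eqP.
  by rewrite sube_eq ?fin_num_measure// add0e eq_sym => /eqP.
case=> -[d [T [P [a [b [Delta [psi [f [[_ [_ [_ [_ [_ psiQ]]]]] [_ [_ [_ pE]]]]]]]]]]]];
  exact: H pE psiQ.
Qed.

Lemma even_moment_ge0 d (T : measurableType d) (P : probability T R)
    (a b : T -> R) (B : set R) l : ~~ odd l ->
  0 <= \int[P]_w (\1_B (a w) * b w ^+ l).
Proof.
by move=> el; apply: Rintegral_ge0 => w _; rewrite mulr_ge0// exprn_even_ge0.
Qed.

Lemma power_bounded d (T : measurableType d) (P : probability T R)
    (a b : T -> R) (B : set R) (K : R) l :
  {ae P, forall w, B (a w) -> `|b w| <= K} ->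
  {ae P, forall w, B (a w) -> `|b w ^+ l| <= `|K| ^+ l}.
Proof.
apply: filterS => w h /h bK; rewrite normrX; apply: lerXn2r; rewrite ?nnegrE//.
by rewrite (le_trans bK)// ler_norm.
Qed.

(** The model constrains the exponents from 3 on; the Taylor series starts at 2, where the power is
    a square. *)
Lemma moment_hypothesis d (T : measurableType d) (P : probability T R)
    (a b : {RV P >-> R}) (Delta psi : {RV P >-> weight_space R q k}) :
  valid_triple lo up a b Delta psi ->
  forall l (B : set R) (K : R), (2 <= l)%N -> measurable B ->
    {ae P, forall w, B (a w) -> `|b w| <= K} -> 0 <= \int[P]_w (\1_B (a w) * b w ^+ l).
Proof.
move=> [_ [bm _]] l B K; rewrite leq_eqVlt => /predU1P[<- _ _|l3 mB bK].
  exact: even_moment_ge0.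
have [g [cg g0]] := bm l l3.
have ma : measurable_fun setT a by exact: measurable_funPT.
have mbl : measurable_fun setT (fun w => b w ^+ l).
  by apply: measurable_funX; exact: measurable_funPT.
have [h _] := cond_exp_integral ma mbl cg mB (power_bounded l bK).
exact: h.
Qed.

Lemma Pminus_nabla_ge0 p : Pminus lo up p ->
  0 <= \int[p]_x @nabla_cube R q k lo up pi1 pi2 x.
Proof.
move=> [d [T [P [a [b [Delta [psi [f [vt [bodd [DeltaE [iidf pE]]]]]]]]]]]].
have bm := moment_hypothesis vt.
have [a0 [_ [bD [ci [psiE psiQ]]]]] := vt.
have ma : measurable_fun setT a by exact: measurable_funPT.
have mb : measurable_fun setT b by exact: measurable_funPT.
have mD : measurable_fun setT Delta by exact: measurable_funPT.
have mpsi : measurable_fun setT psi by exact: measurable_funPT.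
have mf h : measurable_fun setT (f h) by exact: measurable_funPT.
rewrite (integral_law_nabla pE).
apply: (triple_nabla_ge0 lo0 mean1 mean2 ma mb mD mpsi a0 bD ci psiE psiQ bm).
move=> l l2; have [ol|el] := boolP (odd l).
  right=> B K mB bK.
  (* From [l >= 2] and [l] odd, [l = 2 m + 1] with [m >= 1], the range in which odd moments are
     assumed to vanish. *)
  have lE : l = (l./2).*2.+1 by rewrite -[LHS]odd_double_half ol.
  have l20 : (1 <= l./2)%N by rewrite half_gt0.
  have [g [cg g0]] := bodd (l./2) l20.
  have mbl : measurable_fun setT (fun w => b w ^+ (l./2).*2.+1) by exact: measurable_funX.
  have [_ h] := cond_exp_integral ma mbl cg mB (power_bounded _ bK).
  by rewrite lE; exact: h.
left=> B K mB DK.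
(* A product is treated as a sum of products with a single summand, as required for factors without
   sign and even [l]. *)
pose phi (x : fun_space 'I_q.+1 R) (j : 'I_1) (z : 'I_q.+1) : R := x z.
have phiE w (tau : config q k) :
    \sum_j \prod_h phi (f h w) j (tau h) = \prod_h f h w (tau h).
  by rewrite big_ord1.
have mphi j z : measurable_fun setT (fun x => phi x j z) by exact: measurable_fun_space_eval.
have mDphi tau : measurable_fun setT (fun w => \sum_j \prod_h phi (f h w) j (tau h)).
  apply: measurable_sum => j; apply: measurable_prod => h _.
  exact: (measurableT_comp (mphi j (tau h)) (mf h)).
have m1 : measurable_fun setT (fun w => \1_B (a w) : R).
  by case: (bounded_mfun_indic_comp ma mB).
rewrite (@ae_eq_bRintegral _ _ _ P _ (fun w => \1_B (a w) * moment l pi1 pi2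
  (fun tau => \sum_j \prod_h phi (f h w) j (tau h) : R))).
- apply: (moment_integral_ge0 pi1 pi2 ma mf iidf mphi (K := K)) => //.
    by right; split.
  move: DK DeltaE; apply: filterS2 => w DK DE Bw tau.
  by rewrite big_ord1 -normr_prod -DE; exact: DK.
- apply: measurable_funM => //; apply: measurable_moment => tau.
  exact: (measurableT_comp (measurable_fun_space_eval tau) mD).
- by apply: measurable_funM => //; exact: measurable_moment.
apply: filterS DeltaE => w DE; congr (_ * moment _ _ _ _).
by apply/funext => tau; rewrite phiE DE.
Qed.

Lemma Pplus_nabla_ge0 p : Pplus lo up p ->
  0 <= \int[p]_x @nabla_cube R q k lo up pi1 pi2 x.
Proof.
move=> [d [T [P [a [b [Delta [psi [f [vt [f0 [DeltaE [iidf pE]]]]]]]]]]]].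
have bm := moment_hypothesis vt.
have [a0 [_ [bD [ci [psiE psiQ]]]]] := vt.
have ma : measurable_fun setT a by exact: measurable_funPT.
have mb : measurable_fun setT b by exact: measurable_funPT.
have mD : measurable_fun setT Delta by exact: measurable_funPT.
have mpsi : measurable_fun setT psi by exact: measurable_funPT.
have mf h : measurable_fun setT (f h) by exact: measurable_funPT.
rewrite (integral_law_nabla pE).
apply: (triple_nabla_ge0 lo0 mean1 mean2 ma mb mD mpsi a0 bD ci psiE psiQ bm).
move=> l l2; left=> B K mB DK.
pose term w (tau : config q k) j := \prod_h f h w j (tau h).
have term0 w tau j : 0 <= term w tau j by apply: prodr_ge0 => h _; exact: f0.
(* Partial sums increase to [Delta] because the factors are nonnegative, so the bound on [Delta]
   dominates all of them and bounded convergence applies. *)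
pose D_ m w : weight_space R q k := fun tau => \sum_(j < m) term w tau j.
have sumE n w tau : (\sum_(0 <= j < n) (term w tau j)%:E = (D_ n w tau)%:E)%E.
  by rewrite sumEFin big_mkord.
have cterm : {ae P, forall w, forall tau, D_ n w tau @[n --> \oo] --> Delta w tau}.
  apply: filterS DeltaE => w DE tau.
  have cv : (\sum_(0 <= j < n) (term w tau j)%:E)%E @[n --> \oo] --> (Delta w tau)%:E.
    by rewrite DE; apply: is_cvg_ereal_nneg_natsum => j _; rewrite lee_fin.
  have /fine_cvgP[_] := cv.
  by under eq_cvg do rewrite /= sumE.
have leterm : {ae P, forall w, forall n tau, D_ n w tau <= Delta w tau}.
  apply: filterS DeltaE => w DE n tau; rewrite -lee_fin -sumE DE.
  by apply: nneseries_lim_ge => j _ _; rewrite lee_fin; exact: term0.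
have mfz h j z : measurable_fun setT (fun w => f h w j z).
  have m1 : measurable_fun setT (fun x : fun_space nat (fun_space 'I_q.+1 R) => x j).
    exact: measurable_fun_space_eval.
  have m2 : measurable_fun setT (fun x : fun_space 'I_q.+1 R => x z).
    exact: measurable_fun_space_eval.
  exact: (measurableT_comp m2 (measurableT_comp m1 (mf h))).
have mD_ n tau : measurable_fun setT (fun w => D_ n w tau).
  by apply: measurable_sum => j; apply: measurable_prod => h _.
have D_0 n w tau : 0 <= D_ n w tau by exact: sumr_ge0.
apply: (moment_integral_lim ma mD_ _ (K := K)) => //.
- by move=> tau; exact: (measurableT_comp (measurable_fun_space_eval tau) mD).
- move: DK leterm; apply: filterS2 => w DK le Bw n tau.
  rewrite ger0_norm// (le_trans (le n tau))// (le_trans (ler_norm _))//.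
  exact: DK.
- by apply: filterS cterm => w ct _.
move=> n.
(* The positive part does not change the factors [f h w], but gives a function that is nonnegative
   on the whole space. *)
pose phi (x : fun_space nat (fun_space 'I_q.+1 R)) (j : 'I_n) (z : 'I_q.+1) : R :=
  Num.max (x j z) 0.
have mphi j z : measurable_fun setT (fun x => phi x j z).
  apply: measurable_maxr; last exact: measurable_cst.
  have m1 : measurable_fun setT (fun x : fun_space nat (fun_space 'I_q.+1 R) => x j).
    exact: measurable_fun_space_eval.
  have m2 : measurable_fun setT (fun x : fun_space 'I_q.+1 R => x z).
    exact: measurable_fun_space_eval.
  exact: (measurableT_comp m2 m1).
have phiE w : D_ n w = fun tau => \sum_j \prod_h phi (f h w) j (tau h).
  apply/funext => tau; apply: eq_bigr => j _; apply: eq_bigr => h _.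
  by rewrite /phi max_l.
under eq_Rintegral do rewrite phiE.
apply: (moment_integral_ge0 pi1 pi2 ma mf iidf mphi (K := K)) => //.
  by left=> x j z; rewrite le_max lexx orbT.
move: DK leterm; apply: filterS2 => w DK le Bw tau.
rewrite (_ : \sum_j _ = D_ n w tau).
  by rewrite (le_trans (le n tau))// (le_trans (ler_norm _))//; exact: DK.
rewrite phiE; apply: eq_bigr => j _; apply: eq_bigr => h _.
by rewrite ger0_norm// /phi le_max lexx orbT.
Qed.

End valid_laws.

(** * Countable mixtures of laws *)

Section countable_mixture.
Context d (T : measurableType d) (R : realType) (p : probability T R).
Variables (alpha : probability nat R) (pj : nat -> probability T R).
Hypothesis pE : forall A, measurable A ->
  p A = (\sum_(0 <= j <oo) alpha [set j] * pj j A)%E.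

Lemma mixture_weights_sum : (\sum_(0 <= j <oo) alpha [set j])%E = 1%E.
Proof.
apply/esym/(etrans (esym (probability_setT p)))/(etrans (pE measurableT)).
apply: eq_eseriesr => j _; rewrite -[RHS]mule1; congr (_ * _)%E.
exact: probability_setT.
Qed.

Lemma mixture_full_mass (A : set T) : measurable A -> (forall j, pj j A = 1%E) -> p A = 1%E.
Proof.
move=> mA pA; rewrite pE// -mixture_weights_sum; apply: eq_eseriesr => j _.
by rewrite pA mule1.
Qed.

Lemma ge0_integral_mixture (f : T -> \bar R) : measurable_fun setT f ->
  (forall x, 0 <= f x)%E ->
  (\int[p]_x f x = \sum_(0 <= j <oo) alpha [set j] * \int[pj j]_x f x)%E.
Proof.
move=> mf f0.
have a0 j : (0 <= fine (alpha [set j])) by rewrite fine_ge0.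
pose m j : {measure set T -> \bar R} := mscale (NngNum (a0 j)) (pj j).
transitivity (\int[mseries m 0]_x f x)%E.
  apply: eq_measure_integral => A mA _; apply: (etrans (pE mA)).
  by apply: eq_eseriesr => j _; rewrite /m /= /mscale/= fineK// fin_num_measure.
rewrite ge0_integral_measure_series//; apply: eq_eseriesr => j _.
rewrite ge0_integral_mscale//= fineK// fin_num_measure//.
Qed.

(** Sum and integral are exchanged for nonnegative integrands, so [f] is shifted by its bound [M].
    Each component contributes at least [M] times its weight, and the weights add up to 1. *)
Lemma mixture_integral_ge0 (f : T -> R) : bounded_mfun f ->
  (forall j, 0 <= \int[pj j]_x f x) -> 0 <= \int[p]_x f x.
Proof.
move=> bf f0; have [mf [M fM]] := bf.
have bfM : bounded_mfun (fun x => f x + M) := bounded_mfunD bf (bounded_mfun_cst _ M).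
have fM0 x : 0 <= f x + M by have := fM x; rewrite ler_norml; lra.
have M0 : 0 <= M by rewrite (le_trans (normr_ge0 _) (fM point)).
have intE (P : probability T R) :
    (\int[P]_x (f x + M)%:E = (\int[P]_x f x + M)%R%:E)%E.
  by rewrite EFin_Rintegral// bRintegralD ?Rintegral_prob_cst//; exact: bounded_mfun_cst.
have mfM : measurable_fun setT (fun x => (f x + M)%:E).
  by apply/measurable_EFinP; case: bfM.
have fM0' x : (0 <= (f x + M)%:E)%E by rewrite lee_fin.
have e := ge0_integral_mixture mfM fM0'; rewrite intE in e.
suff : (M%:E <= (\int[p]_x f x + M)%:E)%E by rewrite lee_fin lerDr.
rewrite e -[leLHS]mule1 -mixture_weights_sum -nneseriesZl//.
apply: lee_nneseries => [j _ _|j _]; first by rewrite mule_ge0// lee_fin.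
by rewrite muleC lee_wpmul2l// intE lee_fin lerDr.
Qed.

End countable_mixture.

(** The expectation defining [nabla] is taken in the extended reals under a product law. Outside the
    cube lies a null set, so the integrand may be replaced by a bounded one, and Fubini integrates
    out the replicas first. *)
Lemma nabla_nabla_cube (R : realType) (q k : nat) (lo up : R)
    (p : probability (weight_space R q k) R)
    (pi1 pi2 : probability (spin_law R q) R) :
  0 < lo -> p (weight_cube lo up) = 1%E ->
  nabla p pi1 pi2 = (\int[p]_psi nabla_cube lo up pi1 pi2 psi)%:E.
Proof.
move=> lo0 pQ.
have mQ := @measurable_weight_cube R q k lo up.
rewrite /nabla unlock.
transitivity (\int[(p \x replica_law k pi1 pi2)%E]_x (nabla_int (@Lambda R) x.1 x.2)%:E)%E.
  by [].
have bN := @bounded_mfun_nabla_cube R q k lo up lo0.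
transitivity (\int[(p \x replica_law k pi1 pi2)%E]_x
   (\1_(weight_cube lo up) x.1 * nabla_int (@Lambda R) x.1 x.2)%:E)%E.
  apply: ae_eq_integral => //.
  - by apply/measurable_EFinP; exact: measurable_nabla_int.
  - by apply/measurable_EFinP; case: bN.
  have : (p \x replica_law k pi1 pi2)%E (~` (weight_cube lo up) `*` setT) = 0%E.
    rewrite product_measure1E//; last exact: measurableC.
    by rewrite [X in (X * _)%E]probability_setC// pQ subee// mul0e.
  move=> pN; exists (~` (weight_cube lo up) `*` setT); split => //.
    by apply: measurableX => //; exact: measurableC.
  move=> x /= nx; split => // Qx; apply: nx => _.
  by rewrite indicE mem_set// mul1r.
rewrite EFin_Rintegral// bounded_fubini//; congr EFin.
by apply: eq_Rintegral => psi _; rewrite nabla_cubeE.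
Qed.

Theorem proposition2p1 (R : realType) (q k : nat) (psi_lo psi_up : R)
    (hlo : 0 < psi_lo < (q.+1%:R)^-1) (hup : psi_up = psi_lo^-1)
    (p : probability (weight_space R q k) R) (gam : spin_law R q)
    (hp : Pval psi_lo psi_up p)
    (hgam : forall z : 'I_q.+1, (psi_lo%:E <= gam [set z])%E)
    (hmax : Zbar p gam = xi p) :
  admissible psi_lo psi_up (p, gam).
Proof.
have lo0 : 0 < psi_lo by case/andP: hlo.
have [alpha [pj [pjv pE]]] := hp.
have mQ := @measurable_weight_cube R q k psi_lo psi_up.
have pQ : p (weight_cube psi_lo psi_up) = 1%E.
  by apply: (mixture_full_mass pE mQ) => j; exact: valid_law_cube.
split => //= pi1 pi2 m1 m2.
rewrite (nabla_nabla_cube _ _ lo0 pQ) lee_fin.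
(* For fixed [pi1] and [pi2] the functional is linear in the law of the weights, so its sign can be
   checked on each component of the mixture. *)
apply: (mixture_integral_ge0 pE); first exact: bounded_mfun_nabla.
move=> j; case: (pjv j) => h.
  exact: (Pminus_nabla_ge0 lo0 m1 m2 h).
exact: (Pplus_nabla_ge0 lo0 m1 m2 h).
Qed.
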